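(* Let $\mu,\nu\in\mathcal M^0([0,\tau])$, and let $u_\mu,u_\nu\in\mathcal W(0,T)$ be the weak solutions of the delay problem with kernels $\mu$ and $\nu$, respectively, and with the same data $u_0\in H$, $f\in L^2(0,T;V^* )$, $\psi\in L^2(-\tau,0;V)$. Let $\beta\ge0$ satisfy $d_{\mu,\beta}:=\alpha_0-\Lambda_1\kappa_\mu(\beta)>0$, and set $R_{\mu,\nu}:=\mathcal K_{\mu-\nu}\tilde u_\nu$. Then $R_{\mu,\nu}\in L^2_\beta(0,T;V^* )$ and $$\|u_\mu-u_\nu\|_{L^2_\beta(0,T;V)}\le d_{\mu,\beta}^{-1}\|R_{\mu,\nu}\|_{L^2_\beta(0,T;V^* )},$$ $$\sup_{0\le t\le T}e^{-\beta t}\|u_\mu(t)-u_\nu(t)\|_H\le\frac{\sqrt{\alpha_0}}{d_{\mu,\beta}}\|R_{\mu,\nu}\|_{L^2_\beta(0,T;V^* )},$$ $$\|\partial_tu_\mu-\partial_tu_\nu\|_{L^2_\beta(0,T;V^* )}\le\frac{\alpha_0+\Lambda_0}{d_{\mu,\beta}}\|R_{\mu,\nu}\|_{L^2_\beta(0,T;V^* )}.$$ Consequently, $$\|u_\mu-u_\nu\|_{\mathcal W(0,T)}+\|u_\mu-u_\nu\|_{\mathcal C([0,T];H)}\le e^{\beta T}\,\frac{1+\sqrt{\alpha_0}+\alpha_0+\Lambda_0}{d_{\mu,\beta}}\,\|R_{\mu,\nu}\|_{L^2_\beta(0,T;V^* )}.$$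
   Context: Fix real numbers $T>0$ and $\tau>0$. $V,H$ are real separable Hilbert spaces with $V\hookrightarrow H$ continuously and densely; $H$ is identified with its dual, giving the Gelfand triple $V\hookrightarrow H\cong H^*\hookrightarrow V^*$, and $\langle\cdot,\cdot\rangle$ is the duality pairing between $V^*$ and $V$. $a_0,a_1:V\times V\to\mathbb R$ are bilinear forms and $\Lambda_0,\Lambda_1,\alpha_0>0$ are constants with $|a_i(w,v)|\le\Lambda_i\|w\|_V\|v\|_V$ for all $w,v\in V$, $i\in\{0,1\}$, and $a_0(v,v)\ge\alpha_0\|v\|_V^2$ for all $v\in V$. The operators $A_i\in\mathcal L(V,V^* )$ are given by $\langle A_iw,v\rangle=a_i(w,v)$. $\mathcal M([0,\tau])$ is the Banach space of finite signed Borel measures on $[0,\tau]$ with norm $\|\sigma\|_{\mathcal M([0,\tau])}=|\sigma|([0,\tau])$, where $|\sigma|$ is the total variation measure; $\mathcal M^0([0,\tau])=\{\sigma\in\mathcal M([0,\tau]):|\sigma|(\{0\})=0\}$. For $\beta\ge0$, $\kappa_\mu(\beta):=\int_{[0,\tau]}e^{-\beta s}\,d|\mu|(s)$. For a Hilbert space $X$, $\|g\|_{L^2_\beta(0,T;X)}:=\bigl(\int_0^Te^{-2\beta t}\|g(t)\|_X^2\,dt\bigr)^{1/2}$. For $\sigma\in\mathcal M([0,\tau])$ and $g\in L^2(-\tau,T;V)$, $\mathcal K_\sigma g\in L^2(0,T;V^* )$ is defined by $(\mathcal K_\sigma g)(t)=\int_{[0,\tau]}A_1g(t-s)\,d\sigma(s)$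 for a.e. $t\in(0,T)$ (Bochner integral, using any Borel strongly measurable representative of $g$; the resulting element of $L^2(0,T;V^* )$ does not depend on the representative). $\mathcal W(0,T)=\{u\in L^2(0,T;V):\partial_tu\in L^2(0,T;V^* )\}$ with norm $\|u\|_{\mathcal W(0,T)}=\bigl(\|u\|_{L^2(0,T;V)}^2+\|\partial_tu\|_{L^2(0,T;V^* )}^2\bigr)^{1/2}$; it embeds into $\mathcal C([0,T];H)$, and pointwise values refer to the $H$-continuous representative. For $u:(0,T)\to V$ the joined trajectory is $\tilde u(t)=\psi(t)$ for $-\tau<t<0$ and $\tilde u(t)=u(t)$ for $0<t<T$. For $\mu\in\mathcal M^0([0,\tau])$, the weak solution $u_\mu$ of the delay problem with kernel $\mu$ and data $(u_0,f,\psi)$ is the (unique) $u\in\mathcal W(0,T)$ with $u(0)=u_0$ in $H$ and $\partial_tu(t)+A_0u(t)+(\mathcal K_\mu\tilde u)(t)=f(t)$ in $V^*$ for a.e. $t\in(0,T)$. *)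

(* Defs.v *)
From HB Require Import structures.
From mathcomp Require Import all_boot all_order all_algebra.
From mathcomp Require Import all_classical all_reals all_analysis.

Set Implicit Arguments.
Unset Strict Implicit.
Unset Printing Implicit Defensive.

Import Order.TTheory GRing.Theory Num.Theory.
Import numFieldNormedType.Exports.

Local Open Scope classical_set_scope.
Local Open Scope ring_scope.

HB.mixin Record CompleteNormedModule_isHilbert (R : realType) V
    & CompleteNormedModule R V := {
  inner : V -> V -> R ;
  innerC : forall x y, inner x y = inner y x ;
  innerP : forall a x y z, inner (a *: x + y) z = a * inner x z + inner y z ;
  inner_norm : forall x, inner x x = `|x| ^+ 2
}.

#[short(type="hilbertType")]
HB.structure Definition Hilbert (R : realType) :=
  {V of CompleteNormedModule_isHilbert R V & CompleteNormedModule R V}.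

Definition separable (T : topologicalType) : Prop :=
  exists2 A : set T, countable A & dense A.

Section hilbert_theory.
Context {R : realType} {V : hilbertType R}.
Implicit Types x y : V.

Lemma inner_linearr x : linear (inner x : V -> R^o).
Proof. by move=> a y z; rewrite innerC innerP !(innerC _ x). Qed.

Lemma cauchy_schwarz x y : `|inner x y| <= `|x| * `|y|.
Proof.
have in0 (z : V) : inner 0 z = 0 :> R.
  by have := innerP (-1) (0 : V) 0 z; rewrite scaler0 addr0 mulN1r addNr.
have [->|x0] := eqVneq x 0; first by rewrite in0 !normr0 mul0r.
have x2 : 0 < `|x| ^+ 2 by rewrite exprn_gt0// normr_gt0.
set c := inner x y.
rewrite -ler_sqr ?nnegrE ?mulr_ge0// real_normK ?num_real// exprMn.
have := sqr_ge0 `|(- c / `|x| ^+ 2) *: x + y|.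
rewrite -inner_norm innerP ![inner _ (_ + y)]innerC !innerP inner_norm.
rewrite [inner y x]innerC inner_norm -/c.
suff -> : - c / `|x| ^+ 2 * (- c / `|x| ^+ 2 * `|x| ^+ 2 + c) +
  (- c / `|x| ^+ 2 * c + `|y| ^+ 2) = `|y| ^+ 2 - c ^+ 2 / `|x| ^+ 2.
  by rewrite subr_ge0 ler_pdivrMr// mulrC.
rewrite divfK ?gt_eqF// addNr mulr0 add0r addrC mulrAC mulNr -expr2 mulNr.
by [].
Qed.

End hilbert_theory.

Section dual.
Context {R : realType} (V : normedModType R).

Definition dual_pred : {pred V -> R^o} :=
  fun l => `[< linear l /\ continuous l >].

Lemma dual_submod_closed : submod_closed dual_pred.
Proof.
split=> [|a f g /asboolP[lf cf] /asboolP[lg cg]].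
  apply/asboolP; split; last exact: cst_continuous.
  by move=> a u v /=; rewrite scaler0 addr0.
apply/asboolP; split=> [b u v|x] /=.
  rewrite /GRing.add/= /GRing.scale/= lf lg.
  by rewrite /GRing.scale/= !mulrDr mulrCA addrACA.
by apply: cvgD; [apply: cvgZr; exact: cf|exact: cg].
Qed.

HB.instance Definition _ :=
  GRing.isSubmodClosed.Build R (V -> R^o) dual_pred dual_submod_closed.

Record dual := Dual { dual_fun : V -> R^o ; _ : dual_fun \in dual_pred }.

HB.instance Definition _ := [isSub for dual_fun].
HB.instance Definition _ := [Choice of dual by <:].
HB.instance Definition _ := [SubChoice_isSubLmodule of dual by <:].
Coercion dual_fun : dual >-> Funclass.

Implicit Types l : dual.

Lemma dualP l : linear l /\ continuous l.
Proof. by case: l => f /= /asboolP. Qed.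

Let ball_image l : set R := [set `|l v| | v in [set v | `|v| <= 1]].

Definition dual_norm l : R := sup (ball_image l).

Let dual0 l : l 0 = 0.
Proof. by have := (dualP l).1 (-1) 0 0; rewrite scaler0 addr0 scaleN1r addNr. Qed.

Let ball_image_sup l : has_sup (ball_image l).
Proof.
split; first by exists `|l 0|, 0 => //=; rewrite normr0.
have [ll cl] := dualP l.
pose F : {linear V -> R^o} :=
  HB.pack (l : V -> R^o) (GRing.isLinear.Build _ _ _ _ _ ll).
have /bounded_funP/(_ 1)[M HM] : bounded_near F (nbhs (0 : V)).
  by apply/linear_bounded_continuous.
by exists M => _ [v /= v1 <-]; exact: HM.
Qed.

Let dual_norm_ball l v : `|v| <= 1 -> `|l v| <= dual_norm l.
Proof. by move=> v1; apply: sup_upper_bound; [exact: ball_image_sup|exists v]. Qed.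

Let dual_norm_le l c : (forall v, `|v| <= 1 -> `|l v| <= c) -> dual_norm l <= c.
Proof.
move=> H; apply: ge_sup => [|_ [v v1 <-]]; last exact: H.
by have [] := ball_image_sup l.
Qed.

Let dual_norm_ge0 l : 0 <= dual_norm l.
Proof. by rewrite (le_trans (normr_ge0 (l 0)))// dual_norm_ball// normr0. Qed.

Lemma dual_ler_normD l1 l2 : dual_norm (l1 + l2) <= dual_norm l1 + dual_norm l2.
Proof.
by apply: dual_norm_le => v v1; rewrite (le_trans (ler_normD _ _))// lerD// dual_norm_ball.
Qed.

Let dual_normrZ_le a l : dual_norm (a *: l) <= `|a| * dual_norm l.
Proof.
by apply: dual_norm_le => v v1; rewrite [leLHS]normrM ler_wpM2l// dual_norm_ball.
Qed.

Lemma dual_normrZ a l : dual_norm (a *: l) = `|a| * dual_norm l.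
Proof.
apply/eqP; rewrite eq_le dual_normrZ_le/=.
have [->|a0] := eqVneq a 0; first by rewrite normr0 mul0r dual_norm_ge0.
rewrite -ler_pdivlMl ?normr_gt0// -normfV.
by rewrite (le_trans _ (dual_normrZ_le _ _))// scalerA mulVf// scale1r.
Qed.

Lemma dual_normr0_eq0 l : dual_norm l = 0 -> l = 0.
Proof.
move=> l0; apply: val_inj; apply/funext => v /=.
have [->|v0] := eqVneq v 0; first by rewrite dual0.
have := @dual_norm_ball l (`|v|^-1 *: v).
rewrite normrZ normfV normr_id mulVf ?normr_eq0// => /(_ (lexx _)).
have := (dualP l).1 `|v|^-1 v 0; rewrite !addr0 dual0 addr0 => ->.
rewrite l0 normr_le0 scaler_eq0 invr_eq0 normr_eq0 (negbTE v0)/=.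
by move/eqP.
Qed.

HB.instance Definition _ := Lmodule_isNormed.Build R dual
  dual_ler_normD dual_normrZ dual_normr0_eq0.

End dual.

Record gelfandTriple (R : realType) (V H : hilbertType R) := GelfandTriple {
  emb : {linear V -> H} ;
  emb_continuous : continuous emb ;
  emb_inj : injective emb ;
  emb_dense : dense (range emb) }.

Section pivot.
Context {R : realType} {V H : hilbertType R} (G : gelfandTriple V H).

Let pivot_fun (h : H) : V -> R^o := fun v => inner h (emb G v).

Let pivot_dual h : pivot_fun h \in @dual_pred R V.
Proof.
have lp : linear (pivot_fun h).
  by move=> a u v; rewrite /pivot_fun linearP inner_linearr.
apply/asboolP; split => //.
pose F : {linear V -> R^o} :=
  HB.pack (pivot_fun h) (GRing.isLinear.Build _ _ _ _ _ lp).
suff : continuous F by [].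
apply/linear_bounded_continuous/bounded_funP => r.
have /linear_bounded_continuous/bounded_funP/(_ r)[M HM] := @emb_continuous _ _ _ G.
exists (`|h| * M) => v vr.
by rewrite (le_trans (cauchy_schwarz _ _))// ler_wpM2l// HM.
Qed.

(* H ~ H^* -> V^* : h is sent to the functional v |-> (h, v)_H *)
Definition pivot (h : H) : dual V := Dual (pivot_dual h).

Definition toDual (v : V) : dual V := pivot (emb G v).

End pivot.

Section bochner.
Context d (T : measurableType d) (R : realType) (X : normedModType R).
Implicit Types (mu : {measure set T -> \bar R}) (D : set T) (f s : T -> X).

Definition simple_fun s : Prop :=
  finite_set (range s) /\ forall x, measurable (s @^-1` [set x]).

Definition strongly_measurable D f : Prop :=
  exists2 s : (T -> X)^nat, forall n, simple_fun (s n) &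
    forall t, D t -> s n t @[n --> \oo] --> f t.

Definition simple_integral mu D s : X :=
  \sum_(x \in range s) fine (mu (D `&` s @^-1` [set x])) *: x.

Definition is_bochner_integral mu D f (I : X) : Prop :=
  exists s : (T -> X)^nat,
    [/\ forall n, simple_fun (s n) /\ (\int[mu]_(t in D) `|s n t|%:E < +oo)%E,
        forall t, D t -> s n t @[n --> \oo] --> f t,
        (\int[mu]_(t in D) `|f t - s n t|%:E)%E @[n --> \oo] --> 0%E &
        simple_integral mu D (s n) @[n --> \oo] --> I].

(* [0] when [f] is not Bochner integrable on [D]. Approximation is required at
   every point of [D] rather than a.e.: integrands are Borel representatives. *)
Definition bochner mu D f : X := xget 0 (is_bochner_integral mu D f).

End bochner.

Section signed_measures.
Context d (T : measurableType d) (R : realType).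
Variable nu : {charge set T -> \bar R}.

Definition hahn_pos : set T := projT1 (cid (Hahn_decomposition nu)).

Definition hahn_neg : set T :=
  projT1 (cid (projT2 (cid (Hahn_decomposition nu)))).

Lemma hahnP : hahn_decomposition nu hahn_pos hahn_neg.
Proof. exact: projT2 (cid (projT2 (cid (Hahn_decomposition nu)))). Qed.

Definition total_variation : {measure set T -> \bar R} :=
  charge_variation hahnP.

Definition charge_bochner (X : normedModType R) (D : set T) (f : T -> X) : X :=
  bochner (jordan_pos hahnP) D f - bochner (jordan_neg hahnP) D f.

End signed_measures.

(* A finite signed Borel measure on [0, tau] is encoded as a charge on the real
   line that does not charge the complement of [0, tau]. *)
Definition in_M0 (R : realType) (tau : R)
    (sigma : {charge set (measurableTypeR R) -> \bar R}) : Prop :=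
  (forall A, measurable A -> sigma A = sigma (A `&` `[0, tau])) /\
  total_variation sigma [set 0] = 0%E.

Definition kappa (R : realType) (tau : R)
    (mu : {charge set (measurableTypeR R) -> \bar R}) (beta : R) : R :=
  \int[total_variation mu]_(s in `[0, tau]) expR (- (beta * s)).

(* Elements of the Lebesgue-Bochner spaces are given by Borel strongly
   measurable representatives; norms are extended reals so that an infinite
   norm is not confused with 0. *)
Section L2.
Context {R : realType} {X : normedModType R}.
Local Notation leb := (@lebesgue_measure R).
Local Open Scope ereal_scope.

Definition L2norm (D : set R) (g : R -> X) : \bar R :=
  (\int[leb]_(t in D) (`|g t| ^+ 2)%:E) `^ 2^-1.

Definition in_L2 (D : set R) (g : R -> X) : Prop :=
  @strongly_measurable _ (measurableTypeR R) R X D g /\ L2norm D g < +oo.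

Definition L2norm_w (beta : R) (D : set R) (g : R -> X) : \bar R :=
  (\int[leb]_(t in D) (expR (- (2 * beta * t)) * `|g t| ^+ 2)%:E) `^ 2^-1.

Definition in_L2_w (beta : R) (D : set R) (g : R -> X) : Prop :=
  @strongly_measurable _ (measurableTypeR R) R X D g /\
  L2norm_w beta D g < +oo.

End L2.

Definition test_function (R : realType) (T : R) (phi : R -> R) : Prop :=
  (forall n x, derivable (derive1n n phi) x 1) /\
  exists a b : R, [/\ 0 < a, b < T & forall t, t \notin `[a, b] -> phi t = 0].

Section evolution.
Context {R : realType} {V H : hilbertType R} (G : gelfandTriple V H) (T : R).
Local Notation leb := (@lebesgue_measure R).
Implicit Types (u : R -> V) (w : R -> dual V).

(* w = d_t u as V^*-valued distributions on (0, T) *)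
Definition is_weak_derivative u w : Prop :=
  forall phi, test_function T phi ->
    bochner leb `]0, T[ (fun t : R => derive1 phi t *: toDual G (u t)) =
    - bochner leb `]0, T[ (fun t : R => phi t *: w t).

Definition is_dt u w : Prop := in_L2 `]0, T[ w /\ is_weak_derivative u w.

(* determined up to a null subset of (0, T) when [in_W u] *)
Definition dt u : R -> dual V := xget (cst 0) (is_dt u).

Definition in_W u : Prop := in_L2 `]0, T[ u /\ exists w, is_dt u w.

Definition Wnorm u : \bar R :=
  ((L2norm `]0%R, T[ u ^+ 2 + L2norm `]0%R, T[ (dt u) ^+ 2) `^ 2^-1)%E.

(* the continuous representative; only its values on [0, T] are determined *)
Definition crep u : R -> H :=
  xget (cst 0) [set c : R -> H | {within `[0, T], continuous c} /\
    \forall t \ae leb, t \in `]0, T[ -> emb G (u t) = c t].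

Definition Cnorm (c : R -> H) : \bar R :=
  ereal_sup [set `|c t|%:E | t in `[0, T]%classic].

Definition Cnorm_w (beta : R) (c : R -> H) : \bar R :=
  ereal_sup [set (expR (- (beta * t)) * `|c t|)%:E | t in `[0, T]%classic].

End evolution.

Section delay.
Context {R : realType} {V H : hilbertType R} (G : gelfandTriple V H).
Context (T tau : R) (A0 A1 : V -> dual V).

(* the value at t = 0 is irrelevant up to null sets *)
Definition joined (psi u : R -> V) : R -> V :=
  fun t => if t < 0 then psi t else u t.

Definition delay_op (sigma : {charge set (measurableTypeR R) -> \bar R})
    (g : R -> V) : R -> dual V :=
  fun t => charge_bochner sigma `[0, tau] (fun s : R => A1 (g (t - s))).

Definition weak_solution (mu : {charge set (measurableTypeR R) -> \bar R})
    (u0 : H) (f : R -> dual V) (psi u : R -> V) : Prop :=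
  [/\ in_W G T u, crep G T u 0 = u0 &
      \forall t \ae @lebesgue_measure R, t \in `]0, T[ ->
        dt G T u t + A0 (u t) + delay_op mu (joined psi u) t = f t].

End delay.

(* Main.v *)
Require Import Defs.
From HB Require Import structures.
From mathcomp Require Import all_boot all_order all_algebra.
From mathcomp Require Import all_classical all_reals all_analysis.
From mathcomp Require Import measurable_realfun ring lra.

(* Subtracting the two equations, z = u_mu - u_nu satisfies z' + A0 z + K_mu z~ = - R
   with z(0) = 0 and zero history.  Testing with e^{-2 beta t} z and using Young's
   inequality in the weighted space, where the delay term has norm at most
   L1 kappa_mu(beta), gives
     e^{-2 beta b} |z(b)|_H^2 + d \int_0^b e^{-2 beta t} |z|_V^2 <= d^{-1} |R|^2,
   which yields the first two bounds; the third is read off the equation.  The energy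
   identity |z(b)|^2 - |z(a)|^2 = 2 \int_a^b <z', z> (Lions) is proved with Steklov
   averages: for h -> 0, the integral over [a, b] of (|z(t+h)|^2 - |z(t)|^2) / h is on
   the one hand an average of the pairing <z'(t+r), z(t+h) + z(t)>, controlled by L^2
   continuity of translations, and on the other hand a difference of averages near the
   endpoints. *)

Set Implicit Arguments.
Unset Strict Implicit.
Unset Printing Implicit Defensive.

Import Order.TTheory GRing.Theory Num.Theory.
Import numFieldNormedType.Exports.
Import HBSimple.

Local Open Scope classical_set_scope.
Local Open Scope ring_scope.

(** * Strong measurability *)

(** The energy bound must hold at each time [b] separately, while the weighted convolution estimate
    lives on the whole line. Causality bridges the two: cutting the trajectory at [b] leaves the
    delay term unchanged before [b], and the estimate is applied to the truncation. The factor kappa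
    comes from e^{-beta t} = e^{-beta s} e^{-beta (t - s)}. Since k = L1 kappa may vanish, products
    are split with k + eta in place of k, and eta is removed at the end. Constants: the integral
    bound d S <= d^{-1} P gives S <= d^{-2} P; sqrt(alpha) / d comes from d^{-1} <= alpha d^{-2}, as
    d <= alpha; alpha + L0 is L0 + k + d. The values of [bochner], [dt] and [crep] are selected by
    [xget], so existence and uniqueness must be established before anything can be computed.
    Identities in the dual are checked on vectors, and separability of V merges the exceptional null
    sets. The continuous representative is not an input of the energy identity: the identity is
    first proved between almost all pairs of times, and continuity is derived from it. *)

Section simple_functions.
Context d (T : measurableType d) (R : realType).
Implicit Types X Y Z : normedModType R.

(** The range is finite, so the preimage of an arbitrary set is a finite union of measurable level
    sets. *)
Lemma simple_preimage X (s : T -> X) (A : set X) :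
  simple_fun s -> measurable (s @^-1` A).
Proof.
move=> [fs ms].
have -> : s @^-1` A = \bigcup_(x in range s `&` A) s @^-1` [set x].
  apply/seteqP; split => [t At|t [_ [[t' _ <-] At'] /= ->//]].
  by exists (s t) => //; split => //; exists t.
by apply: fin_bigcup_measurable => //; exact: finite_setIl.
Qed.

Lemma simple_comp X Y (g : X -> Y) (s : T -> X) :
  simple_fun s -> simple_fun (g \o s).
Proof.
move=> ss; split => [|y]; last by rewrite comp_preimage; exact: simple_preimage.
by apply: sub_finite_set (finite_image g ss.1) => _ [t _ <-]; exists (s t) => //; exists t.
Qed.

Lemma simple_comp2 X Y Z (g : X -> Y -> Z) (s : T -> X) (r : T -> Y) :
  simple_fun s -> simple_fun r -> simple_fun (fun t => g (s t) (r t)).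
Proof.
move=> ss sr; split => [|z].
  have := finite_image (fun p => g p.1 p.2) (finite_setX ss.1 sr.1).
  apply: sub_finite_set => _ [t _ <-]; exists (s t, r t) => //=.
  by split; exists t.
have -> : (fun t => g (s t) (r t)) @^-1` [set z] =
    \bigcup_(x in range s) (s @^-1` [set x] `&` r @^-1` [set y | g x y = z]).
  apply/seteqP; split => [t /= gz|t [_ [t' _ <-] [/= -> //]]].
  by exists (s t); first by exists t.
apply: fin_bigcup_measurable; first exact: ss.1.
by move=> x _; apply: measurableI; exact: simple_preimage.
Qed.

Lemma simple_cst X (x : X) : simple_fun (cst x : T -> X).
Proof.
split=> [|y]; first by apply: sub_finite_set (finite_set1 x) => _ [t _ <-].
by rewrite preimage_cst; case: ifP.
Qed.

Lemma simple_patch X (A : set T) (s r : T -> X) : measurable A ->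
  simple_fun s -> simple_fun r ->
  simple_fun (fun t => if t \in A then s t else r t).
Proof.
move=> mA ss sr; split => [|x].
  have : finite_set (range s `|` range r) by rewrite finite_setU; split; [exact: ss.1|exact: sr.1].
  by apply: sub_finite_set => _ [t _ <-]; case: ifP => _; [left|right]; exists t.
have -> : (fun t => if t \in A then s t else r t) @^-1` [set x] =
    (A `&` s @^-1` [set x]) `|` (~` A `&` r @^-1` [set x]).
  apply/seteqP; split => t /=.
    by case: ifPn => [/set_mem|/negP]; [left|right; split => // /mem_set].
  by case=> -[At tx]; [rewrite (mem_set At)|rewrite memNset].
by apply: measurableU; apply: measurableI => //;
  [exact: simple_preimage|exact: measurableC|exact: simple_preimage].
Qed.

Lemma simple_precomp d' (T' : measurableType d') X (s : T -> X) (h : T' -> T) :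
  measurable_fun setT h -> simple_fun s -> simple_fun (s \o h).
Proof.
move=> mh ss; split => [|x].
  by apply: sub_finite_set ss.1 => _ [t _ <-]; exists (h t).
by rewrite comp_preimage -[X in measurable X]setTI; apply: mh => //; exact: simple_preimage.
Qed.

Lemma simple_measurable (s : T -> R) : simple_fun s -> measurable_fun setT s.
Proof. by move=> ss _ A mA; rewrite setTI; exact: simple_preimage. Qed.

End simple_functions.

Section strong_measurability.
Context d (T : measurableType d) (R : realType).
Implicit Types X Y Z : normedModType R.

Lemma sm_cst X (D : set T) (x : X) : strongly_measurable D (cst x : T -> X).
Proof. by exists (fun=> cst x) => [_|t _]; [exact: simple_cst|exact: cvg_cst]. Qed.

Lemma sm_comp X Y (D : set T) (g : X -> Y) (f : T -> X) :
  continuous g -> strongly_measurable D f -> strongly_measurable D (g \o f).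
Proof.
move=> cg [s ss sf]; exists (fun n => g \o s n) => [n|t Dt]; first exact: simple_comp.
exact: (@cvg_comp _ _ _ (fun n => s n t) g _ _ _ (sf t Dt) (cg (f t))).
Qed.

Lemma sm_comp2 X Y Z (D : set T) (g : X -> Y -> Z) (f : T -> X) (h : T -> Y) :
  continuous (fun p : X * Y => g p.1 p.2) ->
  strongly_measurable D f -> strongly_measurable D h ->
  strongly_measurable D (fun t => g (f t) (h t)).
Proof.
move=> cg [s ss sf] [r sr rh].
exists (fun n t => g (s n t) (r n t)) => [n|t Dt]; first exact: simple_comp2.
exact: (@cvg_comp _ _ _ (fun n => (s n t, r n t)) (fun p => g p.1 p.2) _ _ _
  (cvg_pair (sf t Dt) (rh t Dt)) (cg (f t, h t))).
Qed.

Lemma sm_sub X (D D' : set T) (f : T -> X) : D' `<=` D ->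
  strongly_measurable D f -> strongly_measurable D' f.
Proof. by move=> DD [s ss sf]; exists s => // t /DD; exact: sf. Qed.

Lemma sm_eq X (D : set T) (f g : T -> X) : {in D, f =1 g} ->
  strongly_measurable D f -> strongly_measurable D g.
Proof.
by move=> fg [s ss sf]; exists s => // t Dt; rewrite -fg ?inE//; exact: sf.
Qed.

Lemma sm_patch X (D E : set T) (f g : T -> X) : measurable D ->
  strongly_measurable D f -> strongly_measurable E g ->
  strongly_measurable (D `|` E) (fun t => if t \in D then f t else g t).
Proof.
move=> mD [s ss sf] [r sr rg].
exists (fun n t => if t \in D then s n t else r n t) => [n|t DEt].
  exact: simple_patch.
case: ifPn => [/set_mem/sf//|/negP tD]; apply: rg.
by case: DEt => // /mem_set.
Qed.

Lemma sm_precomp d' (T' : measurableType d') X (D : set T) (D' : set T')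
    (f : T -> X) (h : T' -> T) :
  measurable_fun setT h -> D' `<=` h @^-1` D ->
  strongly_measurable D f -> strongly_measurable D' (f \o h).
Proof.
move=> mh DD [s ss sf]; exists (fun n => s n \o h) => [n|t /DD/sf//].
exact: simple_precomp.
Qed.

Lemma sm_measurable (D : set T) (f : T -> R) : measurable D ->
  strongly_measurable D f -> measurable_fun D f.
Proof.
move=> mD [s ss sf]; apply: (measurable_fun_cvg (h := s)) => [n|//].
by apply: measurable_funTS; exact: simple_measurable.
Qed.

Lemma measurable_sm (D : set T) (f : T -> R) : measurable D ->
  measurable_fun D f -> strongly_measurable D f.
Proof.
move=> mD mf; have [|g gf] := @approximation_sfun _ _ _ (EFin \o f) D mD.
  exact/measurable_EFinP.
exists (fun n t => g n t) => [n|t Dt]; last exact: fine_cvg (gf _ Dt).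
split => [|x]; first exact: fimfunP.
by rewrite -[X in measurable X]setTI; apply: (measurable_funP (g n)) => //; exact: measurable_set1.
Qed.

Lemma sm_measurable_comp X (D : set T) (g : X -> R) (f : T -> X) : measurable D ->
  continuous g -> strongly_measurable D f -> measurable_fun D (g \o f).
Proof. by move=> mD cg sf; apply: sm_measurable => //; exact: sm_comp. Qed.

Lemma sm_norm X (D : set T) (f : T -> X) : measurable D ->
  strongly_measurable D f -> measurable_fun D (fun t => `|f t|).
Proof. by move=> mD; apply: sm_measurable_comp => //; exact: norm_continuous. Qed.

Lemma sm_add X (D : set T) (f g : T -> X) :
  strongly_measurable D f -> strongly_measurable D g ->
  strongly_measurable D (fun t => f t + g t).
Proof. by apply: sm_comp2 => p; apply: cvgD; [exact: cvg_fst|exact: cvg_snd]. Qed.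

Lemma sm_sub_fun X (D : set T) (f g : T -> X) :
  strongly_measurable D f -> strongly_measurable D g ->
  strongly_measurable D (fun t => f t - g t).
Proof. by apply: (sm_comp2 (g := fun x y => x - y)) => p; apply: cvgB; [exact: cvg_fst|exact: cvg_snd]. Qed.

Lemma sm_scale X (D : set T) (f : T -> R) (g : T -> X) :
  strongly_measurable D f -> strongly_measurable D g ->
  strongly_measurable D (fun t => f t *: g t).
Proof. by apply: (sm_comp2 (g := fun (x : R) (y : X) => x *: y)) => p; exact: scale_continuous. Qed.

(* [s n t] is the point closest to [f t] among [x 0, ..., x n]. *)
Lemma nearest_point_approx X (D : set T) (f : T -> X) (x : nat -> X) :
  measurable D ->
  (forall k, measurable_fun D (fun t => `|f t - x k|)) ->
  (forall t, D t -> forall e, 0 < e -> exists k, `|f t - x k| < e) ->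
  exists s : nat -> T -> X, [/\ forall n, simple_fun (s n),
    forall n t, ~ D t -> s n t = x 0%N,
    forall t, D t -> s n t @[n --> \oo] --> f t &
    forall n t, D t -> `|f t - s n t| <= `|f t - x 0%N|].
Proof.
move=> mD mx dx.
pose closer (s : T -> X) k := D `&` [set t | `|f t - x k| < `|f t - s t|].
pose s := fix s n := if n is m.+1
  then fun t => if t \in closer (s m) m.+1 then x m.+1 else s m t
  else cst (x 0%N).
have s_m n : measurable_fun D (fun t => `|f t - s n t|) /\ simple_fun (s n).
  elim: n => [|n [IH1 IH2]] /=; first by split; [exact: mx|exact: simple_cst].
  have mc : measurable (closer (s n) n.+1).
    have := measurable_fun_ltr (mx n.+1) IH1.
    move=> /(_ mD [set true]).
    rewrite /closer (_ : [set t | _ < _] = (fun t => `|f t - x n.+1| < `|f t - s n t|) @^-1` [set true]); last first.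
      by apply/seteqP; split => t /=.
    exact.
  split; last by apply: simple_patch => //; exact: simple_cst.
  (* On [D] the new distance is the minimum of the old one and the distance to [x n.+1]. *)
  have := measurable_minr IH1 (mx n.+1).
  apply: eq_measurable_fun => t tD /=; case: ifPn.
    by move=> /set_mem[_ /= /ltW lt]; apply/min_idPr.
  move=> /negP nc; apply/min_idPl; rewrite leNgt; apply/negP => lt.
  by apply: nc; apply/mem_set; split => //; exact/set_mem.
have sS n t : D t -> `|f t - s n.+1 t| <= `|f t - s n t| /\ `|f t - s n.+1 t| <= `|f t - x n.+1|.
  move=> Dt /=; case: ifPn; first by move=> /set_mem[_ /= /ltW lt]; split.
  move=> /negP nc; split => //; rewrite leNgt; apply/negP => lt.
  by apply: nc; apply/mem_set; split.
have s_le n m t : D t -> (n <= m)%N -> `|f t - s m t| <= `|f t - s n t|.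
  move=> Dt; elim: m => [|m IH]; first by rewrite leqn0 => /eqP ->.
  rewrite leq_eqVlt => /orP[/eqP <-//|]; rewrite ltnS => /IH; apply: le_trans.
  exact: (sS m t Dt).1.
have s_lex n t : D t -> `|f t - s n t| <= `|f t - x n|.
  by move=> Dt; case: n => [//|n]; exact: (sS n t Dt).2.
exists s; split => [n|n t nD|t Dt|n t Dt].
- exact: (s_m n).2.
- by elim: n => //= n ->; rewrite memNset// => -[].
- apply/cvgrPdist_lt => e e0.
  have [k ke] := dx t Dt e e0.
  near=> n; apply: le_lt_trans ke; apply: le_trans (s_lex _ _ Dt).
  by apply: s_le => //; near: n; exact: nbhs_infty_ge.
- exact: (s_le 0%N n t Dt (leq0n n)).
Unshelve. all: by end_near. Qed.

(** The values of countably many simple functions form a countable set whose closure contains [f t]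
    for every [t] in [D]. An injection into the naturals turns the set into a sequence; indices
    outside its image get the harmless point 0. *)
Lemma countable_approx X (D : set T) (f : T -> X) : strongly_measurable D f ->
  exists x : nat -> X, forall t, D t -> forall e, 0 < e -> exists k, `|f t - x k| < e.
Proof.
move=> [s ss sf].
have cs : countable (\bigcup_n range (s n)).
  by apply: bigcup_countable => // n _; apply: finite_set_countable; exact: (ss n).1.
have /countable_injP[h hinj] := cs.
exists (fun k => xget 0 [set y | (\bigcup_n range (s n)) y /\ h y = k]) => t Dt e e0.
have /cvgrPdist_lt/(_ e e0)[N _ /(_ N (leqnn N)) sN] := sf t Dt.
exists (h (s N t)); case: xgetP => [y _ [y1 y2]|/(_ (s N t))[]]; last first.
  by split => //; exists N => //; exists t.
rewrite (_ : y = s N t)//; apply: hinj => //; rewrite inE//.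
by exists N => //; exists t.
Qed.

(** Putting 0 in front of the dense sequence makes every nearest point at least as good as 0. The
    error is therefore dominated by [|f|], which is what dominated convergence asks for. *)
Lemma sm_dominated X (D : set T) (f : T -> X) : measurable D ->
  strongly_measurable D f ->
  exists s : nat -> T -> X, [/\ forall n, simple_fun (s n),
    forall n t, ~ D t -> s n t = 0,
    forall t, D t -> s n t @[n --> \oo] --> f t &
    forall n t, D t -> `|s n t| <= 2 * `|f t| /\ `|f t - s n t| <= `|f t|].
Proof.
move=> mD smf; have [x xf] := countable_approx smf.
pose x' k := if k is k'.+1 then x k' else 0.
have [|t Dt e e0|s [s1 s2 s3 s4]] := @nearest_point_approx X D f x' mD.
- move=> k; apply: (sm_norm mD); apply: sm_sub_fun => //; exact: sm_cst.
- by have [k ke] := xf t Dt e e0; exists k.+1.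
exists s; split => // n t Dt; have := s4 n t Dt; rewrite /= subr0 => h; split => //.
rewrite mulrDl mul1r; apply: le_trans (lerD (lexx _) h).
by rewrite -[X in `|X| <= _](addrNK (f t)) addrC (le_trans (ler_normD _ _))// lerD2l distrC.
Qed.

(** The approximating points of all the [f n] together, enumerated by pairs of indices, come
    arbitrarily close to the values of [g]. The distances from [g] to these points are limits of
    measurable functions, so the nearest-point construction applies to [g] directly. *)
Lemma sm_lim X (D : set T) (f : nat -> T -> X) (g : T -> X) : measurable D ->
  (forall n, strongly_measurable D (f n)) ->
  (forall t, D t -> f n t @[n --> \oo] --> g t) -> strongly_measurable D g.
Proof.
move=> mD smf fg.
have /choice[x xf] := fun n => countable_approx (smf n).
pose x' k := if unpickle k is Some p then x p.1 p.2 else 0.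
have [k|t Dt e e0|s [s1 s2 s3 s4]] := @nearest_point_approx X D g x' mD.
- apply: (measurable_fun_cvg (h := fun n t => `|f n t - x' k|)).
    by move=> n; apply: (sm_norm mD); apply: sm_sub_fun => //; exact: sm_cst.
  by move=> t Dt; apply: cvg_norm; apply: cvgB; [exact: fg|exact: cvg_cst].
- have /cvgrPdist_lt/(_ (e / 2))[|N _ /(_ N (leqnn N)) gN] := fg t Dt.
    by rewrite divr_gt0.
  have [|k fk] := xf N t Dt (e / 2); first by rewrite divr_gt0.
  exists (pickle (N, k)); rewrite /x' pickleK/=.
  rewrite (splitr e) -(subrKA (f N t)) (le_lt_trans (ler_normD _ _))// ltrD//.
by exists s.
Qed.

End strong_measurability.

(** * The dual space *)

Section dual_theory.
Context {R : realType} {V : normedModType R}.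
Implicit Types l m : dual V.

Lemma dualD l m v : (l + m) v = l v + m v. Proof. by []. Qed.
Lemma dualB l m v : (l - m) v = l v - m v. Proof. by []. Qed.
Lemma dualZ a l v : (a *: l) v = a * l v. Proof. by []. Qed.
Lemma dual0E v : (0 : dual V) v = 0. Proof. by []. Qed.

Lemma dual_ext l m : (forall v, l v = m v) -> l = m.
Proof. by move=> lm; apply: val_inj; apply/funext => v; exact: lm. Qed.

Lemma dual_lin l a u v : l (a *: u + v) = a * l u + l v.
Proof. exact: (dualP l).1. Qed.

Lemma dual_linD l u v : l (u + v) = l u + l v.
Proof. by have := dual_lin l 1 u v; rewrite scale1r mul1r. Qed.

Lemma dual_lin0 l : l 0 = 0.
Proof. by have := dual_lin l (-1) 0 0; rewrite scaler0 addr0 mulN1r addNr. Qed.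

Lemma dual_linZ l a u : l (a *: u) = a * l u.
Proof. by have := dual_lin l a u 0; rewrite !addr0 dual_lin0 addr0. Qed.

Lemma dual_linB l u v : l (u - v) = l u - l v.
Proof. by rewrite dual_linD -scaleN1r dual_linZ mulN1r. Qed.

Lemma dual_le l v : `|l v| <= `|l| * `|v|.
Proof.
have [->|v0] := eqVneq v 0; first by rewrite dual_lin0 !normr0 mulr0.
have v_gt0 : 0 < `|v| by rewrite normr_gt0.
rewrite -ler_pdivrMr// mulrC -[X in X * _]gtr0_norm ?invr_gt0// -normrM -dual_linZ.
apply: ub_le_sup; last first.
  by exists (`|v|^-1 *: v) => //=; rewrite normrZ normfV normr_id mulVf// gt_eqF.
have [ll cl] := dualP l.
pose F : {linear V -> R^o} :=
  HB.pack (l : V -> R^o) (GRing.isLinear.Build _ _ _ _ _ ll).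
have /bounded_funP/(_ 1)[M HM] : bounded_near F (nbhs (0 : V)).
  by apply/linear_bounded_continuous.
by exists M => _ [w /= w1 <-]; exact: HM.
Qed.

Lemma dual_norm_leP l c : 0 <= c -> (forall v, `|l v| <= c * `|v|) -> `|l| <= c.
Proof.
move=> c0 lc; apply: ge_sup; first by exists `|l 0|, 0 => //=; rewrite normr0.
by move=> _ [v /= v1 <-]; rewrite (le_trans (lc v))// ler_piMr.
Qed.

(** Entry point for elements of the dual given by a formula, such as the functional sending [v] to
    the integral of [f t v]. *)
Lemma dual_of_bound (g : V -> R) (M : R) :
  (forall a u v, g (a *: u + v) = a * g u + g v) ->
  (forall v, `|g v| <= M * `|v|) -> exists l : dual V, forall v, l v = g v.
Proof.
move=> lg gM.
have gD : g \in @dual_pred R V.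
  apply/asboolP; split; first by move=> a u v; rewrite lg.
  pose F : {linear V -> R^o} :=
    HB.pack (g : V -> R^o) (GRing.isLinear.Build _ _ _ _ _ (fun a u v => lg a u v)).
  suff : continuous F by [].
  apply/linear_bounded_continuous/bounded_funP => r.
  exists (`|M| * r) => v vr; rewrite (le_trans (gM v))//.
  by rewrite (le_trans (ler_wpM2r (normr_ge0 v) (ler_norm M)))// ler_wpM2l.
by exists (Dual gD).
Qed.

Lemma dual_eval_continuous v : continuous (fun l : dual V => l v : R).
Proof.
move=> l; apply/(@cvgrPdist_lt _ R _ (nbhs l) (nbhs_filter l)) => e e0.
have v1 : 0 < `|v| + 1 by rewrite ltr_wpDl.
have := @nbhsx_ballx R (dual V) l _ (divr_gt0 e0 v1).
apply: filterS => m; rewrite -ball_normE/= => lm.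
rewrite -dualB (le_lt_trans (dual_le _ _))//.
rewrite (@le_lt_trans _ _ (`|l - m| * (`|v| + 1)))//.
  by rewrite ler_wpM2l// lerDl.
by rewrite -ltr_pdivlMr.
Qed.

Lemma pairing_continuous : continuous (fun p : dual V * V => p.1 p.2 : R).
Proof.
move=> [l v]; rewrite /continuous_at/=.
(* Expansion around [(l, v)]: the quadratic remainder is bounded by a product of two norms tending
   to 0, and each of the other terms varies in a single argument. *)
have -> : (fun p : dual V * V => p.1 p.2 : R) =
    (fun p => (p.1 - l) (p.2 - v) + p.1 v + l p.2 - l v).
  by apply/funext => p; rewrite dualB !dual_linB; ring.
rewrite -[X in _ --> X](_ : 0 + l v + l v - l v = _); last by ring.
have c1 : p.1 @[p --> (l, v)] --> l by exact: cvg_fst.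
have c2 : p.2 @[p --> (l, v)] --> v by exact: cvg_snd.
apply: cvgB; last exact: cvg_cst.
apply: cvgD.
  apply: cvgD.
    have cM : `|p.1 - l| * `|p.2 - v| @[p --> (l, v)] --> (0 : R).
      rewrite -[X in _ --> X](_ : `|l - l| * `|v - v| = _); last by rewrite !subrr !normr0 mul0r.
      by apply: cvgM; apply: cvg_norm; apply: cvgB => //; exact: cvg_cst.
    apply/norm_cvg0P; apply: (squeeze_cvgr _ (@cvg_cst _ _ _ _ _) cM).
    by near=> p; apply/andP; split; [exact: normr_ge0|exact: dual_le].
  exact: (@cvg_comp _ _ _ fst (fun m : dual V => m v) _ _ _ c1 (@dual_eval_continuous v l)).
exact: (@cvg_comp _ _ _ snd l _ _ _ c2 ((dualP l).2 v)).
Unshelve. all: by end_near. Qed.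

End dual_theory.

Section inner_theory.
Context {R : realType} {H : hilbertType R}.
Implicit Types x y z : H.

Lemma innerDl x y z : inner (x + y) z = inner x z + inner y z.
Proof. by have := innerP 1 x y z; rewrite scale1r mul1r. Qed.

Lemma innerDr x y z : inner z (x + y) = inner z x + inner z y.
Proof. by rewrite innerC innerDl !(innerC z). Qed.

Lemma inner0l z : inner 0 z = 0 :> R.
Proof. by have := innerP (-1) (0 : H) 0 z; rewrite scaler0 addr0 mulN1r addNr. Qed.

Lemma innerZl a x z : inner (a *: x) z = a * inner x z.
Proof. by have := innerP a x 0 z; rewrite inner0l !addr0. Qed.

Lemma innerBl x y z : inner (x - y) z = inner x z - inner y z.
Proof. by rewrite innerDl -scaleN1r innerZl mulN1r. Qed.

Lemma innerBr x y z : inner z (x - y) = inner z x - inner z y.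
Proof. by rewrite innerC innerBl !(innerC z). Qed.

End inner_theory.

From mathcomp Require Import finmap.
Import HBSimple.

(** * Bochner integrals in the dual *)

Section real_integrals.
Context d (T : measurableType d) (R : realType) (mu : {measure set T -> \bar R}).
Variable D : set T.
Hypothesis mD : measurable D.
Implicit Types f g : T -> R.

Lemma integrable_measurable f : mu.-integrable D (EFin \o f) -> measurable_fun D f.
Proof. by move=> /measurable_int/measurable_EFinP. Qed.

Lemma integrable_dom f g : measurable_fun D f ->
  (forall x, D x -> `|f x| <= g x) ->
  mu.-integrable D (EFin \o g) -> mu.-integrable D (EFin \o f).
Proof.
move=> mf fg; apply: le_integrable => //; first exact/measurable_EFinP.
by move=> x Dx; rewrite lee_fin (le_trans (fg x Dx)) ?ler_norm.
Qed.

Lemma ge0_integrable f : measurable_fun D f -> (forall x, D x -> 0 <= f x) ->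
  (\int[mu]_(x in D) (f x)%:E < +oo)%E -> mu.-integrable D (EFin \o f).
Proof.
move=> mf f0 lty; apply/integrableP; split; first exact/measurable_EFinP.
rewrite (le_lt_trans _ lty)// le_eqVlt; apply/orP; left; apply/eqP.
by apply: eq_integral => x /set_mem Dx; rewrite /= ger0_norm// f0.
Qed.

Lemma EFin_Rintegral f : mu.-integrable D (EFin \o f) ->
  (\int[mu]_(x in D) f x)%:E = (\int[mu]_(x in D) (f x)%:E)%E.
Proof. by move=> fi; rewrite /Rintegral fineK//; exact: integrable_fin_num. Qed.

Lemma integrableZlR (k : R) f : mu.-integrable D (EFin \o f) ->
  mu.-integrable D (EFin \o (fun x => k * f x)).
Proof. by move=> fi; apply: eq_integrable (integrableZl mD k fi). Qed.

Lemma integrableDR f g : mu.-integrable D (EFin \o f) ->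
  mu.-integrable D (EFin \o g) -> mu.-integrable D (EFin \o (fun x => f x + g x)).
Proof. by move=> fi gi; apply: eq_integrable (integrableD mD fi gi). Qed.

Lemma integrableBR f g : mu.-integrable D (EFin \o f) ->
  mu.-integrable D (EFin \o g) -> mu.-integrable D (EFin \o (fun x => f x - g x)).
Proof. by move=> fi gi; apply: eq_integrable (integrableB mD fi gi). Qed.

Lemma le_Rintegral_norm f g : mu.-integrable D (EFin \o f) ->
  mu.-integrable D (EFin \o g) -> (forall x, D x -> `|f x| <= g x) ->
  `|\int[mu]_(x in D) f x| <= \int[mu]_(x in D) g x.
Proof.
move=> fi gi fg; rewrite (le_trans (le_normr_Rintegral _ _))//.
by apply: le_Rintegral => //; exact: integrable_norm.
Qed.

Lemma Rintegral_cvg_dom (f_ : nat -> T -> R) f g :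
  (forall n, measurable_fun D (f_ n)) ->
  (forall x, D x -> f_ n x @[n --> \oo] --> f x) ->
  mu.-integrable D (EFin \o g) -> (forall n x, D x -> `|f_ n x| <= g x) ->
  (\int[mu]_(x in D) f_ n x)%R @[n --> \oo] --> \int[mu]_(x in D) f x.
Proof.
move=> mf ff gi fg.
have mf' : measurable_fun D f by exact: measurable_fun_cvg mf ff.
have [] := @dominated_convergence _ _ _ mu D mD (fun n => EFin \o f_ n)
  (EFin \o f) (EFin \o g).
- by move=> n; exact/measurable_EFinP.
- exact/measurable_EFinP.
- by apply: aeW => x Dx /=; apply: cvg_EFin; [exact: nearW|exact: ff].
- by [].
- by apply: aeW => x n Dx /=; rewrite lee_fin fg.
- move=> fi _ h; apply: fine_cvg; rewrite fineK; first exact: h.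
  exact: integrable_fin_num.
Qed.

End real_integrals.

Section bochner_dual.
Context d (T : measurableType d) (R : realType) (V : normedModType R).
Context (mu : {measure set T -> \bar R}) (D : set T).
Hypothesis mD : measurable D.
Implicit Types f s : T -> dual V.

Lemma sm_pairing (w : T -> dual V) (u : T -> V) :
  strongly_measurable D w -> strongly_measurable D u ->
  measurable_fun D (fun t => w t (u t) : R).
Proof.
move=> sw su; apply: sm_measurable => //.
by apply: (sm_comp2 (g := fun (l : dual V) (v : V) => l v : R)) => //; exact: pairing_continuous.
Qed.

Lemma dual_integrable f v : strongly_measurable D f ->
  mu.-integrable D (EFin \o (fun t => `|f t|)) ->
  mu.-integrable D (EFin \o (fun t => f t v)).
Proof.
move=> sf fi; apply: (integrable_dom mD _ _ (integrableZlR mD `|v| fi)).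
  by apply: sm_pairing => //; exact: sm_cst.
by move=> t Dt; rewrite mulrC dual_le.
Qed.

(** Integrability of the norm forces every level set of a nonzero value to have finite measure, so
    [fine] loses nothing in the terms that count. *)
Lemma simple_integral_dual s v : simple_fun s ->
  mu.-integrable D (EFin \o (fun t => `|s t|)) ->
  simple_integral mu D s v = (\int[mu]_(t in D) (s t v))%R.
Proof.
move=> ss si; rewrite /simple_integral fsbig_finite/=; last exact: ss.1.
rewrite (big_morph (fun l : dual V => l v) (fun l m => dualD l m v) (dual0E v)).
set r := fset_set (range s).
have sE t : s t v = \sum_(x <- r) \1_(s @^-1` [set x]) t * x v.
  rewrite (bigD1_seq (s t))/=; last exact: fset_uniq.
    rewrite indicE mem_set// mul1r big1 ?addr0// => x xst.
    by rewrite indicE memNset ?mul0r//= => /esym/eqP; rewrite (negbTE xst).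
  by rewrite /r in_fset_set; [apply/mem_set; exists t|exact: ss.1].
have mA x : measurable (s @^-1` [set x]) by exact: ss.2.
have ti (x : dual V) : mu.-integrable D (EFin \o (fun t => \1_(s @^-1` [set x]) t * x v)).
  apply: (integrable_dom mD _ _ (integrableZlR mD `|v| si)).
    by apply: measurable_funM => //; apply: measurable_funTS; exact: measurable_indic.
  move=> t Dt; rewrite indicE; case: (boolP (t \in _)); last by rewrite mul0r normr0 mulr_ge0.
  by move=> /set_mem/= ->; rewrite mul1r mulrC dual_le.
have -> : (\int[mu]_(t in D) (s t v))%R =
    fine (\sum_(x <- r) \int[mu]_(t in D) (\1_(s @^-1` [set x]) t * x v)%:E)%E.
  congr fine; rewrite -(integral_sum mD ti).
  by apply: eq_integral => t _; rewrite /= sumEFin sE.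
rewrite -(sum_fine _ _ (F := fun x => (\int[mu]_(t in D) (\1_(s @^-1` [set x]) t * x v)%:E)%E)); last first.
  by move=> x _; apply: integrable_fin_num => //; exact: ti.
apply: eq_bigr => x _; rewrite dualZ.
(* This case contains x = 0, whose level set may have infinite measure; both sides are 0. *)
have [xv|xv] := eqVneq (x v) 0.
  rewrite xv mulr0 (_ : (fun t => _) = cst 0%E) ?integral0//.
  by apply/funext => t; rewrite mulr0.
have mDA : (mu (D `&` s @^-1` [set x]) < +oo)%E.
  have x0 : 0 < `|x|.
    by rewrite normr_gt0; apply: contraNN xv => /eqP ->.
  have mn : measurable_fun D (EFin \o (fun t => `|s t|)) by case/integrableP : si.
  have := le_integral_abse mu mD mn x0.
  move=> h; have {}h : (`|x|%:E * mu (D `&` s @^-1` [set x]) < +oo)%E.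
    move: si => /integrableP[_]; apply: le_lt_trans; apply: le_trans h.
    apply: lee_wpmul2l; first by rewrite lee_fin.
    apply: le_measure.
    - by apply/mem_set; exact: measurableI.
    - by apply/mem_set; apply: emeasurable_fun_c_infty => //; exact: measurableT_comp.
    - by move=> t [Dt /= <-]; split => //=; rewrite lee_fin normr_id.
  rewrite ltey; apply: contraTN h => /eqP ->.
  by rewrite gt0_muley// ltxx.
have -> : (\int[mu]_(t in D) (\1_(s @^-1` [set x]) t * x v)%:E)%E =
   ((x v)%:E * mu (D `&` s @^-1` [set x]))%E.
  under eq_integral do rewrite EFinM muleC.
  rewrite integralZl//; first by rewrite integral_indic// setIC.
  apply/integrableP; split.
    by apply/measurable_EFinP; apply: measurable_funTS; exact: measurable_indic.
  under eq_integral do rewrite gee0_abs ?lee_fin//.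
  by rewrite integral_indic// setIC.
rewrite fineM//; last by rewrite ge0_fin_numE.
by rewrite [RHS]mulrC.
Qed.

(** Pairing with [v] commutes with the integral of simple functions and passes to the limit, so the
    integral is determined by its values on vectors. Integrability of [|f|] follows from one simple
    function at finite distance. *)
Lemma bochner_integral_dual f (I : dual V) v : is_bochner_integral mu D f I ->
  mu.-integrable D (EFin \o (fun t => `|f t|)) /\
  I v = (\int[mu]_(t in D) f t v)%R.
Proof.
move=> [s [ss sf fs sI]].
have sf' : strongly_measurable D f by exists s => // n; exact: (ss n).1.
have sms n : strongly_measurable D (s n) by exists (fun=> s n) => [_|t _]; [exact: (ss n).1|exact: cvg_cst].
have si n : mu.-integrable D (EFin \o (fun t => `|s n t|)).
  by apply: ge0_integrable => //; [apply: sm_norm|exact: (ss n).2].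
have md n : measurable_fun D (fun t => `|f t - s n t|).
  by apply: sm_norm => //; exact: sm_sub_fun.
have [N _ Nd] : \forall n \near \oo, mu.-integrable D (EFin \o (fun t => `|f t - s n t|)).
  have /fine_cvgP[[N _ Nf] _] := fs.
  exists N => // n /Nf /= fin; apply: ge0_integrable => //.
  by rewrite -ge0_fin_numE// integral_ge0.
have fi : mu.-integrable D (EFin \o (fun t => `|f t|)).
  apply: (integrable_dom mD _ _ (integrableDR mD (si N) (Nd N (leqnn N)))).
    exact: sm_norm.
  move=> t Dt; rewrite normr_id -[X in `|X| <= _](addrNK (s N t)) addrC.
  by rewrite (le_trans (ler_normD _ _))// .
split => //.
have c1 : simple_integral mu D (s n) v @[n --> \oo] --> (I v : R).
  exact: (@cvg_comp _ _ _ (fun n => simple_integral mu D (s n)) (fun l : dual V => l v : R)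
    _ _ _ sI (@dual_eval_continuous _ _ v I)).
have c2 : simple_integral mu D (s n) v @[n --> \oo] --> (\int[mu]_(t in D) f t v)%R.
  have d0 : `|v| * (\int[mu]_(t in D) `|f t - s n t|)%R @[n --> \oo] --> (0 : R).
    by rewrite -(mulr0 `|v|); apply: cvgMr; exact: fine_cvg fs.
  apply/subr_cvg0/norm_cvg0P.
  apply: (squeeze_cvgr _ (@cvg_cst _ _ _ _ _) d0); near=> n.
  have Nn : (N <= n)%N by near: n; exact: nbhs_infty_ge.
  rewrite normr_ge0/= simple_integral_dual//; last exact: (ss n).1.
  rewrite distrC -RintegralB//; [|exact: dual_integrable..].
  rewrite -RintegralZl//; last exact: Nd.
  apply: le_Rintegral_norm => //.
  - by apply: integrableBR => //; exact: dual_integrable.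
  - by apply: integrableZlR => //; exact: Nd.
  - by move=> t Dt; rewrite mulrC -dualB dual_le.
exact: (cvg_unique _ c1 c2).
Unshelve. all: by end_near. Qed.

(** The candidate is the weak integral, a functional bounded by the integral of [|f|]. Simple
    integrals converge to it because the dual norm of the difference is at most the integral of
    [|f - s n|], which tends to 0 by domination. *)
Lemma bochner_exists f : strongly_measurable D f ->
  mu.-integrable D (EFin \o (fun t => `|f t|)) ->
  exists I, is_bochner_integral mu D f I.
Proof.
move=> sf fi.
have [||I IE] := @dual_of_bound _ V (fun v => \int[mu]_(t in D) f t v)%R
    (\int[mu]_(t in D) `|f t|)%R.
- move=> a u v; rewrite -RintegralZl//; last exact: dual_integrable.
  rewrite -RintegralD//; [|apply: integrableZlR => //; exact: dual_integrable|exact: dual_integrable].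
  by apply: eq_Rintegral => t _; rewrite dual_lin.
- move=> v; rewrite mulrC -RintegralZl//; apply: le_Rintegral_norm => //.
  + exact: dual_integrable.
  + exact: integrableZlR.
  + by move=> t Dt; rewrite mulrC dual_le.
have [s [s1 s2 s3 s4]] := sm_dominated mD sf.
have sms n : strongly_measurable D (s n) by exists (fun=> s n) => [_|t _]; [exact: s1|exact: cvg_cst].
have si n : mu.-integrable D (EFin \o (fun t => `|s n t|)).
  apply: (integrable_dom mD _ _ (integrableZlR mD 2 fi)); first exact: sm_norm.
  by move=> t Dt; rewrite normr_id; exact: (s4 n t Dt).1.
have md n : measurable_fun D (fun t => `|f t - s n t|).
  by apply: sm_norm => //; exact: sm_sub_fun.
have fsi n : mu.-integrable D (EFin \o (fun t => `|f t - s n t|)).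
  by apply: (integrable_dom mD _ _ fi) => // t Dt; rewrite normr_id; exact: (s4 n t Dt).2.
have fs0 : (\int[mu]_(t in D) `|f t - s n t|)%R @[n --> \oo] --> 0.
  have -> : (0 : R) = (\int[mu]_(t in D) cst 0 t)%R by rewrite /Rintegral integral0.
  apply: (Rintegral_cvg_dom mD md _ fi) => [t Dt|n t Dt].
    rewrite [X in _ --> X](_ : _ = `|f t - f t|); last by rewrite subrr normr0.
    by apply: cvg_norm; apply: cvgB; [exact: cvg_cst|exact: s3].
  by rewrite normr_id; exact: (s4 n t Dt).2.
exists I, s; split => //.
- move=> n; split => //.
  move: (si n) => /integrableP[_]; apply: le_lt_trans.
  by apply: ge0_le_integral => //; [exact/measurable_EFinP/sm_norm|apply: measurableT_comp => //; exact/measurable_EFinP/sm_norm|move=> t _; exact: lee_abs].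
- rewrite -[X in X @ _ --> _](_ : EFin \o (fun n => \int[mu]_(t in D) `|f t - s n t|)%R = _).
    by apply: cvg_EFin => //; exact: nearW.
  by apply/funext => n /=; rewrite EFin_Rintegral.
- apply/subr_cvg0/norm_cvg0P.
  apply: (squeeze_cvgr _ (@cvg_cst _ _ _ _ _) fs0); near=> n.
  apply/andP; split; first exact: normr_ge0.
  apply: dual_norm_leP; first exact: Rintegral_ge0.
  move=> v; rewrite dualB simple_integral_dual// IE -RintegralB//; [|exact: dual_integrable..].
  rewrite mulrC -RintegralZl//; apply: le_Rintegral_norm => //.
  - by apply: integrableBR => //; exact: dual_integrable.
  - exact: integrableZlR.
  - by move=> t Dt; rewrite mulrC distrC -dualB dual_le.
Unshelve. all: by end_near. Qed.

Lemma bochnerE f v : strongly_measurable D f ->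
  mu.-integrable D (EFin \o (fun t => `|f t|)) ->
  bochner mu D f v = (\int[mu]_(t in D) f t v)%R.
Proof.
move=> sf fi; rewrite /bochner; case: xgetP => [I _ /bochner_integral_dual h|h].
  exact: (h v).2.
by have [I /h] := bochner_exists sf fi.
Qed.

(** A Bochner integral can exist only for an integrable norm; otherwise [xget] returns its default
    0. *)
Lemma bochner_nonintegrable f :
  ~ mu.-integrable D (EFin \o (fun t => `|f t|)) -> bochner mu D f = 0.
Proof.
move=> fi; rewrite /bochner; case: xgetP => [I _ /(bochner_integral_dual 0)[]//|//].
Qed.

(** The right-hand side is an extended real so that the estimate also covers the non-integrable
    case, where the left-hand side is the default 0. *)
Lemma bochner_norm f : strongly_measurable D f ->
  (`|bochner mu D f|%:E <= \int[mu]_(t in D) `|f t|%:E)%E.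
Proof.
move=> sf; have [fi|fi] := pselect (mu.-integrable D (EFin \o (fun t => `|f t|))); last first.
  by rewrite bochner_nonintegrable// normr0 integral_ge0.
rewrite -EFin_Rintegral// lee_fin; apply: dual_norm_leP; first exact: Rintegral_ge0.
move=> v; rewrite bochnerE// mulrC -RintegralZl//; apply: le_Rintegral_norm => //.
- exact: dual_integrable.
- exact: integrableZlR.
- by move=> t Dt; rewrite mulrC dual_le.
Qed.

End bochner_dual.

(** * Test functions *)

Section smooth_functions.
Context {R : realType}.
Implicit Types (f g : R -> R) (p : {poly R}).

(** Differentiability of order [n] with the successive derivatives as witnesses. Closure under
    products and affine substitutions becomes an induction on [n], without formulas for iterated
    derivatives. *)
Fixpoint nsmooth n f : Prop :=
  if n is m.+1 then exists2 g : R -> R, forall x : R, is_derive x 1 f (g x) & nsmooth m g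
  else True.

Lemma nsmoothW n f : nsmooth n.+1 f -> nsmooth n f.
Proof. by elim: n f => [//|n IH] f [g fg ng]; exists g => //; exact: IH. Qed.

Lemma nsmooth_cst n (c : R) : nsmooth n (cst c).
Proof. by elim: n c => [//|n IH] c; exists (cst 0) => // x; exact: is_derive_cst. Qed.

Lemma nsmoothD n f g : nsmooth n f -> nsmooth n g -> nsmooth n (f \+ g).
Proof.
elim: n f g => [//|n IH] f g [f' ff' nf] [g' gg' ng].
by exists (f' \+ g'); [move=> x; exact: is_deriveD|exact: IH].
Qed.

Lemma nsmoothM n f g : nsmooth n f -> nsmooth n g -> nsmooth n (f \* g).
Proof.
elim: n f g => [//|n IH] f g nf ng.
have [f' ff' nf'] := nf; have [g' gg' ng'] := ng.
exists ((f \* g') \+ (g \* f')); first by move=> x; exact: is_deriveM.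
by apply: nsmoothD; apply: IH => //; exact: nsmoothW.
Qed.

Lemma nsmooth_affine n f (c e : R) : nsmooth n f ->
  nsmooth n (fun x => f (c * x + e)).
Proof.
elim: n f => [//|n IH] f [f' ff' nf].
exists (cst c \* (fun x => f' (c * x + e))); last first.
  by apply: nsmoothM; [exact: nsmooth_cst|exact: IH].
move=> x; have h : is_derive x 1 (fun y : R => c * y + e) c.
  rewrite -[X in is_derive _ _ _ X]addr0; apply: is_deriveD.
  by apply: is_derive_eq; rewrite /GRing.scale/= mulr1.
have := @is_derive1_comp R f (fun y : R => c * y + e) x _ _ (ff' _) h.
by rewrite mulrC.
Qed.

Lemma nsmooth_derivable f : (forall n, nsmooth n f) ->
  forall n x, derivable (derive1n n f) x 1.
Proof.
move=> nf n; move: (nf n.+1); elim: n f {nf} => [|n IH] f [g fg ng] x.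
  by have [] := fg x.
rewrite /derive1n iterSr; have -> : derive1 f = g; last exact: IH.
by apply/funext => y; rewrite derive1E; have [] := fg y.
Qed.

(** The flat functions p(1/x) e^{-1/x} for x > 0, continued by 0. Polynomial prefactors are allowed
    so that the family is stable under differentiation. *)
Definition expinv p : R -> R :=
  fun x => if x <= 0 then 0 else p.[x^-1] * expR (- x^-1).

Lemma poly_bound p (y : R) : 1 <= y ->
  `|p.[y]| <= (\sum_(i < size p) `|p`_i|) * y ^+ size p.
Proof.
move=> y1; rewrite horner_coef (le_trans (ler_norm_sum _ _ _))// mulr_suml.
apply: ler_sum => i _; rewrite normrM ler_wpM2l// normrX ger0_norm ?(le_trans ler01)//.
by rewrite ler_weXn2l// ltnW.
Qed.

(** A bound of order two is what makes the difference quotient at 0 vanish. With y = 1/x >= 1 and n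
    = [size p], |p(y)| <= S y^n while e^y >= y^(n+2) / (n+2)!, which leaves the factor x^2. The
    constant uses S + 1 to stay positive when p = 0. *)
Lemma expinv_bound p : exists2 C : R, 0 < C &
  forall x, x <= 1 -> `|expinv p x| <= C * x ^+ 2.
Proof.
pose S : R := \sum_(i < size p) `|p`_i|.
have S0 : 0 <= S by exact: sumr_ge0.
have C0 : 0 < (S + 1) * (size p).+2`!%:R.
  by rewrite mulr_gt0// ?ltr_wpDl// ltr0n fact_gt0.
exists ((S + 1) * (size p).+2`!%:R) => // x x1; rewrite /expinv; case: ifPn => [_|].
  by rewrite normr0; apply: mulr_ge0; [exact: ltW|exact: sqr_ge0].
rewrite -ltNge => x0.
have y1 : 1 <= x^-1 by rewrite invf_ge1.
set y := x^-1 in y1 *; have y0 : 0 < y by rewrite invr_gt0.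
have xy : x = y^-1 by rewrite /y invrK.
rewrite normrM (ger0_norm (expR_ge0 _)) xy exprVn expRN.
rewrite ler_pdivrMr ?expR_gt0// -mulrA (le_trans (poly_bound p y1))//.
have : y ^+ (size p).+2 / (size p).+2`!%:R <= expR y.
  by have := expR_ge1Dxn (size p).+1 (ltW y0); apply: le_trans; rewrite lerDr.
rewrite ler_pdivrMr ?ltr0n ?fact_gt0// => h.
rewrite -/S (_ : y ^+ size p = y ^+ (size p).+2 * y ^- 2); last first.
  by rewrite -addn2 exprD mulfK// expf_neq0// gt_eqF.
have y2 : 0 <= y ^- 2 by rewrite invr_ge0 exprn_ge0// ltW.
rewrite -(mulrA (S + 1)); apply: ler_pM => //; last by rewrite [leRHS]mulrAC ler_wpM2r// mulrC.
- by rewrite mulr_ge0// exprn_ge0// ltW.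
- by rewrite lerDl.
Qed.

(** For x > 0 the chain rule gives x^{-2} (p - p')(1/x) e^{-1/x}, that is, the prefactor X^2 (p -
    p'). At 0 the difference quotient is at most C |h|. *)
Lemma is_derive_expinv p (x : R) :
  is_derive x 1 (expinv p) (expinv ('X ^+ 2 * (p - p^`())) x).
Proof.
have [x0|x0|->] := ltgtP x 0.
- rewrite {2}/expinv (ltW x0); apply: (@near_eq_is_derive _ _ _ (cst 0)) => //.
  near=> y; rewrite /expinv ifT//; apply: ltW; near: y; exact: lt_nbhsl.
- rewrite {2}/expinv leNgt x0/=.
  apply: (@near_eq_is_derive _ _ _ (fun y : R => p.[y^-1] * expR (- y^-1) : R)).
    near=> y; rewrite /expinv leNgt ifF//; apply/negbF; near: y; exact: lt_nbhsr.
  have x_neq0 : x != 0 by rewrite gt_eqF.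
  have dV : is_derive x 1 (fun y : R => y^-1) (- (x ^- 2)).
    by apply: is_derive_eq; [exact: is_deriveV|rewrite /GRing.scale/= mulr1].
  have d1 := @is_derive1_comp R (horner p) (fun y : R => y^-1) x _ _ (is_derive_poly p x^-1) dV.
  have d2 := @is_derive1_comp R expR (fun y : R => - y^-1) x _ _
    (is_derive_expR _) (is_deriveN dV).
  apply: (is_derive_eq (is_deriveM d1 d2)).
  rewrite /GRing.scale/= hornerM hornerXn hornerD hornerN; field.
  exact: x_neq0.
- rewrite {2}/expinv lexx.
  have [C C0 CE] := expinv_bound p.
  have h : h^-1 *: (expinv p (h *: 1 + 0) - expinv p 0) @[h --> 0^'] --> (0 : R).
    apply/norm_cvg0P; apply: (@squeeze_cvgr _ _ _ _ (cst 0) (fun h => C * `|h|)).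
    + near=> h; rewrite normr_ge0/= addr0 {2}/expinv lexx subr0.
      have h0 : h != 0 by near: h; exact: nbhs_dnbhs_neq.
      rewrite normrZ normfV ler_pdivrMl ?normr_gt0//.
      rewrite [X in expinv p X]mulr1 (le_trans (CE _ _))//.
        apply: ltW; near: h; apply: nbhs_dnbhs; apply: lt_nbhsl; exact: ltr01.
      by rewrite [leRHS]mulrCA -expr2 real_normK// num_real.
    + exact: cvg_cst.
    + rewrite [X in _ --> X](_ : 0 = C * `|0 : R|); last by rewrite normr0 mulr0.
      by apply: cvgMr; apply: cvg_norm; exact: cvg_within.
  apply: DeriveDef; first by apply/cvg_ex; exists 0.
  exact: cvg_lim h.
Unshelve. all: by end_near. Qed.

Lemma nsmooth_expinv n p : nsmooth n (expinv p).
Proof.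
elim: n p => [//|n IH] p.
by exists (expinv ('X ^+ 2 * (p - p^`()))); [exact: is_derive_expinv|exact: IH].
Qed.

(* [n]-th member of a family converging pointwise to the indicator of [`]a, b[] *)
Definition bump (a b : R) (n : nat) : R -> R :=
  fun x => expinv 1 (n.+1%:R * x + - (n.+1%:R * a)) *
           expinv 1 (- n.+1%:R * x + n.+1%:R * b).

Lemma nsmooth_bump a b n m : nsmooth m (bump a b n).
Proof. by apply: nsmoothM; apply: nsmooth_affine; exact: nsmooth_expinv. Qed.

Lemma expinv1_itv (x : R) : 0 <= expinv 1 x <= 1.
Proof.
rewrite /expinv; case: ifPn => [_|]; first by rewrite lexx ler01.
rewrite -ltNge => x0; rewrite hornerC mul1r expR_ge0/= -expR0 ler_expR.
by rewrite oppr_le0 invr_ge0 ltW.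
Qed.

Lemma bump_itv a b n x : 0 <= bump a b n x <= 1.
Proof.
have /andP[h1 h2] := expinv1_itv (n.+1%:R * x + - (n.+1%:R * a)).
have /andP[h3 h4] := expinv1_itv (- n.+1%:R * x + n.+1%:R * b).
by rewrite /bump mulr_ge0//= mulr_ile1.
Qed.

Lemma bump_out a b n x : x \notin `]a, b[ -> bump a b n x = 0.
Proof.
rewrite in_itv/= negb_and -!leNgt => /orP[xa|xb].
  by rewrite /bump {1}/expinv ifT ?mul0r// -mulrN -mulrDr pmulr_rle0// subr_le0.
by rewrite /bump {2}/expinv ifT ?mulr0// mulNr -mulrN -mulrDr pmulr_rle0// addrC subr_le0.
Qed.

Lemma expinv1_cvg (x : R) : 0 < x ->
  expinv 1 (n.+1%:R * x) @[n --> \oo] --> (1 : R).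
Proof.
move=> x0; have -> : (fun n => expinv 1 (n.+1%:R * x)) =
    (fun n => expR (- (x^-1 * n.+1%:R^-1))).
  apply/funext => n; rewrite /expinv ifF ?hornerC ?mul1r ?invfM 1?mulrC//.
  by apply/negbTE; rewrite -ltNge mulr_gt0.
rewrite -[X in _ --> X]expR0 -oppr0 -(mulr0 x^-1).
apply: (@cvg_comp _ _ _ (fun n : nat => - (x^-1 * n.+1%:R^-1)) expR); last exact: continuous_expR.
by apply: cvgN; apply: cvgMr; exact: cvg_harmonic.
Qed.

Lemma bump_cvg a b x : bump a b n x @[n --> \oo] --> (\1_(`]a, b[%classic) x : R).
Proof.
have [xab|xab] := boolP (x \in `]a, b[); last first.
  rewrite indicE memNset; last exact/negP.
  rewrite (_ : (fun n => _) = cst 0); first exact: cvg_cst.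
  by apply/funext => n; rewrite bump_out.
rewrite indicE mem_set//= -(mulr1 1).
move: xab; rewrite in_itv/= => /andP[ax xb].
rewrite /bump; apply: cvgM.
  under eq_fun do rewrite -mulrN -mulrDr.
  by apply: expinv1_cvg; rewrite subr_gt0.
under eq_fun do rewrite mulNr -mulrN -mulrDr addrC.
by apply: expinv1_cvg; rewrite subr_gt0.
Qed.

Lemma bump_continuous a b n : continuous (bump a b n).
Proof.
move=> x; have [f' h _] := nsmooth_bump a b n 1.
by apply/differentiable_continuous/derivable1_diffP; have [] := h x.
Qed.

End smooth_functions.

(** * Weak derivatives of scalar functions *)

Section almost_everywhere.
Context d (T : measurableType d) (R : realType) (mu : {measure set T -> \bar R}).
Implicit Types P Q : T -> Prop.

Lemma aeS P Q : (forall x, P x -> Q x) ->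
  {ae mu, forall x, P x} -> {ae mu, forall x, Q x}.
Proof. by move=> PQ [N [mN N0 PN]]; exists N; split => // x nQ; apply: PN => /PQ. Qed.

Lemma aeI P Q : {ae mu, forall x, P x} -> {ae mu, forall x, Q x} ->
  {ae mu, forall x, P x /\ Q x}.
Proof.
move=> [N [mN N0 PN]] [M [mM M0 QM]]; exists (N `|` M); split.
- exact: measurableU.
- by rewrite null_set_setU.
- by move=> x /not_andP[nP|nQ]; [left; exact: PN|right; exact: QM].
Qed.

End almost_everywhere.

(** * Integration by parts and primitives of integrable functions *)

Section primitives.
Context {R : realType}.
Implicit Types (f g h k rho : R -> R).
Local Notation leb := (@lebesgue_measure R).
Local Notation integrable f := (leb.-integrable setT (EFin \o f)).

Lemma Rintegral_patch (D : set R) f : (\int[leb]_(t in D) f t)%R = (\int[leb]_t (f \_ D) t)%R.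
Proof. exact: Rintegral_mkcond. Qed.

Lemma integrable_patch (D : set R) f : measurable D ->
  leb.-integrable D (EFin \o f) <-> integrable (f \_ D).
Proof. by move=> mD; rewrite -restrict_EFin; exact: integrable_mkcond. Qed.

Lemma integrable_sub (D : set R) f : measurable D -> integrable f ->
  leb.-integrable D (EFin \o f).
Proof. by move=> mD; apply: integrableS. Qed.

(** Fubini for f(t) g(s) on the half-plane s <= t. This is integration by parts for primitives of
    merely integrable functions; it serves both for primitives of test functions and for the
    exponential weight in the energy. *)
Lemma triangle_fubini f g : integrable f -> integrable g ->
  [/\ integrable (fun t => f t * (\int[leb]_(s in `]-oo, t]) g s)%R),
      integrable (fun s => g s * (\int[leb]_(t in `[s, +oo[) f t)%R) &
      (\int[leb]_t (f t * (\int[leb]_(s in `]-oo, t]) g s)%R))%R =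
      (\int[leb]_s (g s * (\int[leb]_(t in `[s, +oo[) f t)%R))%R].
Proof.
move=> fi gi.
pose P (p : measurableTypeR R * measurableTypeR R) : R := f p.1 * g p.2 * (p.2 <= p.1)%R%:R.
have mf : measurable_fun setT f by exact: (integrable_measurable fi).
have mg : measurable_fun setT g by exact: (integrable_measurable gi).
have mP : measurable_fun setT (EFin \o P).
  apply/measurable_EFinP; apply: measurable_funM.
    apply: measurable_funM; first exact: measurableT_comp mf measurable_fst.
    exact: measurableT_comp mg measurable_snd.
  have -> : (fun p : measurableTypeR R * measurableTypeR R => (p.2 <= p.1)%R%:R : R) =
     (fun b : bool => if b then 1 else 0) \o (fun p => (p.2 <= p.1)%R).
    by apply/funext => p /=; case: (_ <= _).
  apply: measurableT_comp => //.
  by apply: measurable_fun_ler; [exact: measurable_snd|exact: measurable_fst].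
have mP' : measurable_fun setT P by exact/measurable_EFinP.
have PE1 t s : P (t, s) = f t * (g \_ `]-oo, t]) s.
  rewrite /P/= patchE -mulrA; congr (_ * _).
  rewrite mem_setE in_itv/=; by case: ifP; rewrite ?mulr1 ?mulr0.
have PE2 t s : P (t, s) = g s * (f \_ `[s, +oo[) t.
  rewrite /P/= patchE mulrAC mulrC; congr (_ * _).
  rewrite mem_setE in_itv/= andbT; by case: ifP; rewrite ?mulr1 ?mulr0.
have iP : (leb \x leb)%E.-integrable setT (EFin \o P).
  apply/integrable12ltyP => //.
  have -> : (\int[leb]_x \int[leb]_y `|(EFin \o P) (x, y)|)%E =
            (\int[leb]_x \int[leb]_y `|P (x, y)|%:E)%E by [].
  apply: (@le_lt_trans _ _ (\int[leb]_x (`|f x|%:E * \int[leb]_y `|g y|%:E))%E).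
    apply: ge0_le_integral => //.
    - by move=> x _; apply: integral_ge0 => y _; rewrite lee_fin.
    - by apply: (measurable_fun_fubini_tonelli_F (abse \o (EFin \o P))); [exact: measurableT_comp|move=> p; exact: abse_ge0].
    - apply: emeasurable_funM; last exact: measurable_cst.
      by apply/measurable_EFinP; exact: measurableT_comp.
    - move=> x _; rewrite -ge0_integralZl//.
      + apply: ge0_le_integral => //.
        * apply/measurable_EFinP; apply: measurableT_comp => //.
          exact: (measurableT_comp mP' (measurable_pair1 x)).
        * apply: emeasurable_funM; first exact: measurable_cst.
          by apply/measurable_EFinP; exact: measurableT_comp.
        * move=> y _; rewrite -EFinM lee_fin /P/= normrM normrM ler_piMr ?mulr_ge0//.
          by rewrite normr_nat lern1 leq_b1.
      + by apply/measurable_EFinP; exact: measurableT_comp.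
  rewrite ge0_integralZr//.
  - move/integrableP : fi => [_ fi]; move/integrableP : gi => [_ gi].
    by apply: lte_mul_pinfty => //; [exact: integral_ge0|rewrite ge0_fin_numE//; exact: integral_ge0].
  - by apply/measurable_EFinP; exact: measurableT_comp.
  - exact: integral_ge0.
have FE : fubini_F leb (EFin \o P) = EFin \o (fun t => f t * (\int[leb]_(s in `]-oo, t]) g s)%R).
  apply/funext => t; rewrite /fubini_F /=.
  under eq_integral do rewrite PE1.
  have gt : integrable (g \_ `]-oo, t]) := (integrable_patch g (measurable_itv _)).1 (integrable_sub (measurable_itv _) gi).
  under eq_integral do rewrite EFinM.
  by rewrite integralZl// EFinM Rintegral_patch EFin_Rintegral.
have GE : fubini_G leb (EFin \o P) = EFin \o (fun s => g s * (\int[leb]_(t in `[s, +oo[) f t)%R).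
  apply/funext => s; rewrite /fubini_G /=.
  under eq_integral do rewrite PE2.
  have ft : integrable (f \_ `[s, +oo[) := (integrable_patch f (measurable_itv _)).1 (integrable_sub (measurable_itv _) fi).
  under eq_integral do rewrite EFinM.
  by rewrite integralZl// EFinM Rintegral_patch EFin_Rintegral.
split.
- by have := integrable_fubini_F iP; rewrite FE.
- have iG : leb.-integrable setT (fubini_G leb (EFin \o P)).
    apply/integrableP; split; first exact: (measurable_fubini_G iP).
    apply: le_lt_trans ((integrable21ltyP leb leb mP).1 iP).
    apply: ge0_le_integral => //.
    + by apply: measurableT_comp => //; exact: (measurable_fubini_G iP).
    + by apply: (measurable_fun_fubini_tonelli_G (abse \o (EFin \o P))); [exact: measurableT_comp|move=> p; exact: abse_ge0].
    + move=> x _; apply: le_abse_integral => //.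
      exact: (measurableT_comp mP (measurable_pair2 x)).
  by move: iG; rewrite GE.
- have := Fubini iP; rewrite -/(fubini_F leb (EFin \o P)) => h.
  rewrite /Rintegral; congr fine.
  have <- : (\int[leb]_t fubini_F leb (EFin \o P) t)%E = (\int[leb]_t (f t * (\int[leb]_(s in `]-oo, t]) g s)%R)%:E)%E by rewrite FE.
  have <- : (\int[leb]_t fubini_G leb (EFin \o P) t)%E = (\int[leb]_s (g s * (\int[leb]_(t in `[s, +oo[) f t)%R)%:E)%E by rewrite GE.
  exact: h.
Qed.

(** Almost every point is a point of differentiability of the primitive of [g], and near x in (0, T)
    this primitive is constantly 0. The hypothesis only concerns intervals inside (0, T), so the
    primitive starts at 1/(n+1) with n depending on x. *)
Lemma integral_itv_eq0_ae (T : R) g : integrable g ->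
  (forall a b, 0 < a -> a < b -> b < T -> (\int[leb]_(t in `]a, b[) g t)%R = 0) ->
  {ae leb, forall t, t \in `]0, T[ -> g t = 0}.
Proof.
move=> gi g0.
have lg : locally_integrable setT g by apply: open_integrable_locally => //; exact: openT.
have hn n : {ae leb, forall x : R, n.+1%:R^-1 < x ->
    derivable (fun x : R => \int[leb]_(t in [set` Interval (BRight (n.+1%:R^-1 : R)) (BRight x)]) g t)%R x 1 /\
    (derive1 (fun x : R => \int[leb]_(t in [set` Interval (BRight (n.+1%:R^-1 : R)) (BRight x)]) g t)%R x = g x)}.
  have := @FTC1 R g (BRight (n.+1%:R^-1 : R)) (fun y => integrable_sub (measurable_itv _) gi) lg.
  by apply: aeS => x h nx; apply: h; exact: nx.
have := ae_foralln hn; apply: aeS => x hx; rewrite in_itv/= => /andP[x0 xT].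
have [n nx] : exists n : nat, n.+1%:R^-1 < x.
  have := @near_infty_natSinv_lt R (PosNum x0).
  by case => N _ /(_ N (leqnn N)) /= h; exists N.
have [_ <-] := hx n nx.
rewrite derive1E (near_eq_derive (g := cst 0)) ?derive_cst//.
near=> y.
have ny : n.+1%:R^-1 < y by near: y; exact: lt_nbhsr.
have yT : y < T by near: y; exact: lt_nbhsl.
rewrite -Rintegral_itv_bndo_bndc; last exact: integrable_sub.
by apply: g0.
Unshelve. all: by end_near. Qed.

End primitives.

Section weak_derivatives.
Context {R : realType}.
Implicit Types (f g h k rho : R -> R).
Local Notation leb := (@lebesgue_measure R).
Local Notation integrable f := (leb.-integrable setT (EFin \o f)).

Lemma integrable_cst_itv (a b c : R) : integrable (fun t => c * \1_(`]a, b[%classic) t).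
Proof. by apply: integrableZlR => //; exact: integrable_indic_itv. Qed.

Lemma Rintegral_indic_itv (a b : R) : a <= b ->
  (\int[leb]_t \1_(`]a, b[%classic) t)%R = b - a.
Proof.
move=> ab; rewrite /Rintegral integral_indic// setIT.
rewrite /= lebesgue_measure_itv/= lte_fin; case: ltP => // ba.
by have /eqP <- : a == b; [rewrite eq_le ab ba|rewrite subrr].
Qed.

Lemma Rintegral_itv_indic (a b : R) f :
  (\int[leb]_(t in `]a, b[) f t)%R = (\int[leb]_t (\1_(`]a, b[%classic) t * f t))%R.
Proof.
rewrite Rintegral_patch; apply: eq_Rintegral => t _.
by rewrite patchE indicE; case: ifP; rewrite ?mul1r ?mul0r.
Qed.

(** Zero mean makes the primitive vanish to the right of the support as well as to the left, so it
    is again compactly supported in (0, T). *)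
Lemma test_antiderivative (a b T : R) rho : 0 < a -> b < T ->
  (forall n, nsmooth n rho) -> (forall t, t \notin `]a, b[ -> rho t = 0) ->
  integrable rho -> (\int[leb]_t rho t)%R = 0 ->
  test_function T (fun t => \int[leb]_(s in `]-oo, t]) rho s)%R /\
  derive1 (fun t => \int[leb]_(s in `]-oo, t]) rho s)%R = rho.
Proof.
move=> a0 bT nr r0 ri rI.
set Phi := (fun t => \int[leb]_(s in `]-oo, t]) rho s)%R.
have dPhi (x : R) : is_derive x 1 Phi (rho x).
  have [| |||d1 d2] := @continuous_FTC1 R rho -oo%O x (x + 1).
  - by rewrite ltrDl.
  - exact: (integrable_sub (measurable_itv _) ri).
  - by rewrite ltNyr.
  - have [f' hf _] := nr 1.
    by apply/differentiable_continuous/derivable1_diffP; have [] := hf x.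
  - by apply: DeriveDef; [exact: d1|rewrite -derive1E; exact: d2].
have dPhi1 : derive1 Phi = rho.
  by apply/funext => x; rewrite derive1E; have [] := dPhi x.
split => //; split.
  by apply: nsmooth_derivable => -[//|n]; exists rho.
exists a, b; split => // t; rewrite in_itv/= negb_and -!ltNge => /orP[ta|bt].
- transitivity (\int[leb]_(s in `]-oo, t]) cst 0 s)%R; last by rewrite /Rintegral integral0.
  apply: eq_Rintegral => s; rewrite mem_setE in_itv/= => st.
  by apply: r0; rewrite in_itv/= negb_and -!leNgt (le_trans st (ltW ta)).
- rewrite /Phi Rintegral_patch -[RHS]rI; apply: eq_Rintegral => s _.
  rewrite patchE mem_setE in_itv/=; case: leP => // ts.
  by apply/esym/r0; rewrite in_itv/= negb_and -!leNgt (ltW (lt_trans bt ts)) orbT.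
Qed.

Lemma bump_integrable a b n : integrable (bump a b n).
Proof.
apply: (integrable_dom _ _ _ (integrable_indic_itv a b false true)) => //.
  by apply: continuous_measurable_fun; exact: bump_continuous.
move=> t _ /=; rewrite indicE; have [tab|tab] := boolP (t \in `]a, b[).
  rewrite mem_set//; have /andP[b0 b1] := bump_itv a b n t.
  by rewrite ger0_norm.
by rewrite bump_out// normr0.
Qed.

Lemma integrable_bdd_mul (c : R) rho g : measurable_fun (setT : set (measurableTypeR R)) rho ->
  (forall t, `|rho t| <= c) -> integrable g -> integrable (fun t => rho t * g t).
Proof.
move=> mr rc gi.
apply: (integrable_dom measurableT _ _ (integrableZlR measurableT c (integrable_norm gi))).
  by apply: measurable_funM => //; exact: (integrable_measurable gi).
by move=> t _; rewrite /= normrM ler_wpM2r.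
Qed.

Lemma bump_integral_cvg a b g : integrable g ->
  (\int[leb]_t (bump a b n t * g t))%R @[n --> \oo] --> (\int[leb]_(t in `]a, b[) g t)%R.
Proof.
move=> gi; rewrite Rintegral_itv_indic.
have mb n : measurable_fun (setT : set (measurableTypeR R)) (bump a b n).
  by apply: continuous_measurable_fun; exact: bump_continuous.
apply: (@Rintegral_cvg_dom _ _ _ leb setT measurableT (fun n t => bump a b n t * g t)
  (fun t => \1_(`]a, b[%classic) t * g t) (Num.norm \o g)).
- by move=> n; apply: measurable_funM; [exact: mb|exact: (integrable_measurable gi)].
- by move=> t _; apply: cvgMl; exact: bump_cvg.
- exact: integrable_norm.
- move=> n t _; rewrite /= normrM ler_piMl//.
  by have /andP[b0 b1] := bump_itv a b n t; rewrite ger0_norm.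
Qed.

(* du Bois-Reymond: pairing [h - int k] with the zero-mean test functions
   [m' B - m B'], [B] and [B'] bumps of masses [m] and [m'], shows that its
   averages over all the subintervals agree. *)
Lemma weak_derivative_ae (T : R) h k : 0 < T -> integrable h -> integrable k ->
  (forall phi, test_function T phi ->
    (\int[leb]_t (derive1 phi t * h t))%R = - (\int[leb]_t (phi t * k t))%R) ->
  exists c, {ae leb, forall t, t \in `]0, T[ ->
    h t = c - (\int[leb]_(s in `[t, +oo[) k s)%R}.
Proof.
move=> T0 hi ki wd.
pose Q s := (\int[leb]_(t in `[s, +oo[) k t)%R.
(* The tail integral [Q] is minus a primitive of [k], so [g] is the function to be shown constant on
   (0, T). The indicator keeps the product integrable on the line. *)
pose g s := h s + \1_(`]0, T[%classic) s * Q s.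
have Qi : integrable (fun s => \1_(`]0, T[%classic) s * Q s).
  by have [] := triangle_fubini ki (integrable_indic_itv 0 T false true).
have gi : integrable g by exact: integrableDR.
have mB a b n : measurable_fun (setT : set (measurableTypeR R)) (bump a b n).
  by apply: continuous_measurable_fun; exact: bump_continuous.
have nB (a b : R) n t : `|bump a b n t| <= 1.
  by have /andP[b0 b1] := bump_itv a b n t; rewrite ger0_norm.
have key (a b a' b' : R) n : 0 < a -> b < T -> 0 < a' -> b' < T ->
    (\int[leb]_t bump a' b' n t)%R * (\int[leb]_t (bump a b n t * g t))%R =
    (\int[leb]_t bump a b n t)%R * (\int[leb]_t (bump a' b' n t * g t))%R.
  move=> a0 bT a'0 b'T.
  set m := (\int[leb]_t bump a b n t)%R; set m' := (\int[leb]_t bump a' b' n t)%R.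
  pose rho t := m' * bump a b n t - m * bump a' b' n t.
  have rhoi : integrable rho.
    by apply: integrableBR => //; apply: integrableZlR => //; exact: bump_integrable.
  have rho0 t : t \notin `]Num.min a a', Num.max b b'[ -> rho t = 0.
    rewrite in_itv/= lt_max gt_min => tab.
    rewrite /rho !bump_out ?mulr0 ?subrr// in_itv/=.
    - by apply: contraNN tab => /andP[-> ->]; rewrite !orbT.
    - by apply: contraNN tab => /andP[-> ->].
  have rhoI : (\int[leb]_t rho t)%R = 0.
    rewrite RintegralB//; [|by apply: integrableZlR => //; exact: bump_integrable..].
    rewrite !RintegralZl//; [|exact: bump_integrable..].
    by rewrite -/m -/m' mulrC subrr.
  have [||||||t1 t2] := @test_antiderivative (Num.min a a') (Num.max b b') T rho.
  - by rewrite lt_min a0.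
  - by rewrite gt_max bT.
  - move=> j; apply: nsmoothD; first by apply: (nsmoothM (nsmooth_cst _ _)); exact: nsmooth_bump.
    have -> : (fun t => - (m * bump a' b' n t)) = cst (- m) \* bump a' b' n.
      by apply/funext => t; rewrite /= mulNr.
    by apply: (nsmoothM (nsmooth_cst _ _)); exact: nsmooth_bump.
  - exact: rho0.
  - exact: rhoi.
  - exact: rhoI.
  have := wd _ t1; rewrite t2 => wd1.
  have [F1 F2 F3] := triangle_fubini ki rhoi.
  have mrho : measurable_fun (setT : set (measurableTypeR R)) rho := integrable_measurable rhoi.
  have rho_bd t : `|rho t| <= `|m'| + `|m|.
    rewrite /rho; apply: le_trans (ler_normB _ _) _; rewrite (normrM m') (normrM m).
    by apply: lerD; rewrite ler_piMr//; exact: nB.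
  have rhg : (\int[leb]_t (rho t * g t))%R = 0.
    have -> : (\int[leb]_t (rho t * g t))%R = (\int[leb]_t (rho t * h t + rho t * Q t))%R.
      apply: eq_Rintegral => t _; rewrite /g mulrDr; congr (_ + _).
      have [tI|tI] := boolP (t \in `]0, T[); first by rewrite indicE mem_set//= mul1r.
      rewrite rho0 ?mul0r//; apply: contraNN tI; rewrite !in_itv/= => /andP[h1 h2].
      rewrite (lt_trans _ h1) ?(lt_trans h2)// ?lt_min ?a0// gt_max bT//.
    rewrite RintegralD//; last exact: (integrable_bdd_mul mrho rho_bd hi).
    (* The tested equation replaces the [h] part by minus the integral of [k] against the primitive
       of [rho]; Fubini on the triangle identifies that integral with the one of [rho * Q]. *)
    rewrite wd1 -F3 addrC; apply/eqP; rewrite subr_eq0; apply/eqP.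
    by apply: eq_Rintegral => t _; rewrite mulrC.
  have Bi a1 b1 : integrable (fun t => bump a1 b1 n t * g t).
    exact: (integrable_bdd_mul (mB a1 b1 n) (nB a1 b1 n) gi).
  have : (\int[leb]_t (m' * (bump a b n t * g t) - m * (bump a' b' n t * g t)))%R = 0.
    rewrite -[RHS]rhg; apply: eq_Rintegral => t _; rewrite /rho.
    exact: (esym (etrans (mulrBl _ _ _) (congr2 (fun x y => x - y) (esym (mulrA _ _ _)) (esym (mulrA _ _ _))))).
  rewrite (RintegralB measurableT (integrableZlR measurableT m' (Bi a b)) (integrableZlR measurableT m (Bi a' b'))).
  rewrite (RintegralZl m' measurableT (Bi a b)) (RintegralZl m measurableT (Bi a' b')).
  by move/eqP; rewrite subr_eq0 => /eqP.
have key2 (a b a' b' : R) : 0 < a -> a <= b -> b < T -> 0 < a' -> a' <= b' -> b' < T ->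
    (b' - a') * (\int[leb]_(t in `]a, b[) g t)%R = (b - a) * (\int[leb]_(t in `]a', b'[) g t)%R.
  move=> a0 ab bT a'0 ab' b'T.
  have mc (a1 b1 : R) : a1 <= b1 -> (\int[leb]_t bump a1 b1 n t)%R @[n --> \oo] --> b1 - a1.
    move=> ab1; rewrite -(Rintegral_indic_itv ab1).
    apply: (@Rintegral_cvg_dom _ _ _ leb setT measurableT (bump a1 b1) _ _ _ _ (integrable_indic_itv a1 b1 false true)) => //.
      by move=> t _; exact: bump_cvg.
    move=> n t _ /=; rewrite indicE; have [tab|tab] := boolP (t \in `]a1, b1[).
      by rewrite mem_set.
    by rewrite bump_out// normr0.
  have c1 : (\int[leb]_t bump a' b' n t)%R * (\int[leb]_t (bump a b n t * g t))%R @[n --> \oo] -->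
      (b' - a') * (\int[leb]_(t in `]a, b[) g t)%R.
    by apply: cvgM; [exact: mc|exact: bump_integral_cvg].
  have c2 : (\int[leb]_t bump a b n t)%R * (\int[leb]_t (bump a' b' n t * g t))%R @[n --> \oo] -->
      (b - a) * (\int[leb]_(t in `]a', b'[) g t)%R.
    by apply: cvgM; [exact: mc|exact: bump_integral_cvg].
  rewrite -(funext (fun n => @key a b a' b' n a0 bT a'0 b'T)) in c2.
  exact: (cvg_unique _ c1 c2).
(* The mean of [g] over the middle third, a fixed interval with which all others are compared. *)
pose c := 3 / T * (\int[leb]_(t in `]T / 3, 2 * T / 3[) g t)%R.
have gc (a b : R) : 0 < a -> a <= b -> b < T -> (\int[leb]_(t in `]a, b[) g t)%R = c * (b - a).
  move=> a0 ab bT.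
  have [h1 h2 h3] : [/\ 0 < T / 3, T / 3 <= 2 * T / 3 & 2 * T / 3 < T] by split; lra.
  have := @key2 a b (T / 3) (2 * T / 3) a0 ab bT h1 h2 h3.
  rewrite /c; move: (Rintegral _ _ _) (Rintegral _ _ _) => J I IJ.
  have T_neq0 : T != 0 by rewrite gt_eqF.
  have -> : I = 3 / T * ((2 * T / 3 - T / 3) * I) by field.
  by rewrite IJ; ring.
exists c.
have := @integral_itv_eq0_ae R T (fun t => g t - c * \1_(`]0, T[%classic) t).
case.
- by apply: integrableBR => //; exact: integrable_cst_itv.
- move=> a b a0 ab bT.
  rewrite RintegralB//; [|exact: (integrable_sub (measurable_itv _) gi)|
    exact: (integrable_sub (measurable_itv _) (integrable_cst_itv 0 T c))].
  rewrite gc ?ltW// RintegralZl//; last first.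
    exact: (integrable_sub (measurable_itv _) (integrable_indic_itv 0 T false true)).
  rewrite (@eq_Rintegral _ _ _ _ _ (cst 1)); last first.
    move=> t; rewrite mem_setE in_itv/= => /andP[h1 h2].
    by rewrite indicE mem_set//= in_itv/= (lt_trans a0 h1) (lt_trans h2 bT).
  rewrite Rintegral_cst//= lebesgue_measure_itv/= lte_fin ab mul1r.
  by rewrite subrr.
move=> N [mN N0 hN]; exists N; split => // t ht; apply: hN => Ht; apply: ht => tI.
have := Ht tI; rewrite /g indicE mem_set//= mul1r mulr1 => /eqP.
by rewrite subr_eq0 => /eqP <-; rewrite addrK.
Qed.

End weak_derivatives.

(** * Translations *)

Section translations.
Context {R : realType}.
Local Notation leb := (@lebesgue_measure R).
Local Notation integrable f := (leb.-integrable setT (EFin \o f)).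
Implicit Types (f g : R -> R) (h : R).

Lemma measurable_shift h : measurable_fun (setT : set (measurableTypeR R)) (fun t : measurableTypeR R => t + h : measurableTypeR R).
Proof. by apply: measurable_funD => //; exact: measurable_cst. Qed.

Lemma lebesgue_pushforward_shift h (A : set (measurableTypeR R)) : measurable A ->
  leb ((fun t : measurableTypeR R => t + h) @^-1` A) = leb A.
Proof.
move=> mA; apply/esym.
apply: (lebesgue_measure_unique (mu := pushforward leb (fun t : measurableTypeR R => t + h : measurableTypeR R))) => //.
  exact: measurable_shift.
move=> _ _ [[a b] _ <-] /=; rewrite /pushforward.
rewrite (_ : _ @^-1` _ = `]a - h, b - h]%classic); last first.
  by apply/seteqP; split => t; rewrite /= !in_itv/= ltrBlDr lerBrDr.
by rewrite !lebesgue_measure_itv/= !lte_fin ltrD2r; case: ifP => // _; congr EFin; ring.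
Qed.

Lemma ge0_integral_shift h (f : R -> \bar R) :
  measurable_fun (setT : set (measurableTypeR R)) f -> (forall t, 0 <= f t)%E ->
  (\int[leb]_t f (t + h)%R = \int[leb]_t f t)%E.
Proof.
move=> mf f0.
have := @ge0_integral_pushforward _ _ _ _ R _ (measurable_shift h) leb setT f measurableT mf (fun t _ => f0 t).
rewrite preimage_setT => <-.
apply: eq_measure_integral => [|mphi A mA _]; first exact: measurable_shift.
exact: (lebesgue_pushforward_shift h mA).
Qed.

Lemma ae_shift h (P : R -> Prop) :
  {ae leb, forall t, P t} -> {ae leb, forall t, P (t + h)}.
Proof.
move=> [N [mN N0 hN]]; exists ((fun t : measurableTypeR R => t + h) @^-1` N); split.
- by rewrite -[X in measurable X]setTI; exact: measurable_shift.
- by rewrite lebesgue_pushforward_shift.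
- by move=> t; exact: hN.
Qed.

Lemma integrable_shift h f : integrable f -> integrable (fun t => f (t + h)).
Proof.
move=> fi; have mf := integrable_measurable fi.
apply/integrableP; split.
  apply/measurable_EFinP; exact: (measurableT_comp mf (measurable_shift h)).
move/integrableP : fi => [mf' fi].
have := @ge0_integral_shift h (fun t => `|f t|%:E); rewrite /= => -> //.
by apply/measurable_EFinP; exact: measurableT_comp.
Qed.

Lemma Rintegral_shift h f : integrable f ->
  (\int[leb]_t f (t + h))%R = (\int[leb]_t f t)%R.
Proof.
move=> fi; have fih := integrable_shift h fi.
have fE t : f t = f^\+ t - f^\- t by rewrite -[in LHS](funrposBneg f).
have fpi : integrable (f^\+) by exact: integrable_funrpos.
have fni : integrable (f^\-) by exact: integrable_funrneg.
have ge0 g : integrable g -> (forall t, 0 <= g t) ->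
    (\int[leb]_t g (t + h))%R = (\int[leb]_t g t)%R.
  move=> gi g0; congr fine; apply: (@ge0_integral_shift h (EFin \o g)).
    by case/integrableP : gi.
  by move=> t; rewrite lee_fin.
transitivity (\int[leb]_t (f^\+ (t + h) - f^\- (t + h)))%R.
  by apply: eq_Rintegral => t _; rewrite fE.
rewrite RintegralB//; [|exact: (integrable_shift h fpi)|exact: (integrable_shift h fni)].
rewrite !ge0// -?RintegralB//; first by apply: eq_Rintegral => t _; rewrite -fE.
Qed.

(** Continuity of addition gives a neighbourhood for each [t]; compactness of [K] makes the
    admissible [h] uniform. *)
Lemma compact_shift_sub (K U : set R) : compact K -> open U -> K `<=` U ->
  \forall h \near 0, forall t, K t -> U (t + h).
Proof.
move=> cK oU KU; have /compact_near_coveringP nK := cK.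
have := nK R (nbhs 0) (fun h t => U (t + h)) _; apply => t Kt.
have : (fun p : R * R => p.1 + p.2) @ (nbhs (t, 0)) --> t + 0.
  by apply: cvgD; [exact: cvg_fst|exact: cvg_snd].
apply; rewrite addr0; apply: open_nbhs_nbhs; split => //; exact: KU.
Qed.

(** By regularity, [A] lies between a compact [K] and an open [U] that differ by a set of small
    measure. Small shifts move [K] into [U], so if only one of [t] and [t + h] is in [A], then [t]
    or [t + h] is in [U] minus [K]. *)
Lemma indic_shift_cvg (A : set (measurableTypeR R)) : measurable A -> (leb A < +oo)%E ->
  (\int[leb]_t `|\1_A (t + h) - \1_A t : R|)%R @[h --> 0] --> (0 : R).
Proof.
move=> mA Afin; apply/cvgrPdist_le => e e0.
(* The inner and outer errors add up to e / 2, and the set between [K] and [U] is counted twice,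
   once shifted. *)
have e4 : 0 < e / 4 by rewrite divr_gt0.
have [K [cK KA KAe]] := lebesgue_regularity_inner mA Afin e4.
have [U [oU AU UAe]] := lebesgue_regularity_outer mA Afin e4.
have mK : measurable (K : set (measurableTypeR R)) by exact: compact_measurable.
have mU : measurable (U : set (measurableTypeR R)) by exact: open_measurable.
have mUK : measurable (U `\` K : set (measurableTypeR R)) by exact: measurableD.
have UKe : (leb (U `\` K) <= (e / 2)%:E)%E.
  have -> : U `\` K = (U `\` A) `|` (A `\` K).
    apply/seteqP; split => [t [Ut nK]|t [[Ut nA]|[At nK]]].
    - by have [At|nA] := pselect (A t); [right|left].
    - by split => // /KA.
    - by split => //; exact: AU.
  apply: (@le_trans _ _ (leb (U `\` A) + leb (A `\` K))%E).
    by apply: measureU2 => //; exact: measurableD.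
  rewrite (_ : (e / 2)%:E = ((e / 4)%:E + (e / 4)%:E)%E); last by rewrite -EFinD; congr EFin; field.
  by apply: leeD; exact: ltW.
have UKi : integrable (\1_(U `\` K) : R -> R).
  apply/integrableP; split; first by apply/measurable_EFinP; exact: measurable_indic.
  under eq_integral do rewrite gee0_abs ?lee_fin//.
  by rewrite integral_indic// setIT (le_lt_trans UKe)// ltry.
have mi (B : set (measurableTypeR R)) : measurable B -> measurable_fun (setT : set (measurableTypeR R)) (\1_B : R -> R).
  by move=> mB; exact: measurable_indic.
have /nbhs_ballP[r /= r0 rU] := compact_shift_sub cK oU (subset_trans KA AU).
near=> h.
have hr : `|h| < r by near: h; exists r => // x; rewrite /= sub0r normrN.
have sub t : K t -> U (t + h).
  by apply: rU; rewrite -ball_normE/= sub0r normrN.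
have sub' t : K (t + h) -> U t.
  by rewrite -{2}[t](addrK h); apply: rU; rewrite -ball_normE/= sub0r opprK.
have bd t : `|\1_A (t + h) - \1_A t : R| <= \1_(U `\` K) (t + h) + \1_(U `\` K) t.
  have ge B x : 0 <= (\1_B x : R) by rewrite indicE.
  rewrite [in leLHS]indicE [X in _ - X]indicE.
  have [At|nAt] := boolP (t \in A); have [Ath|nAth] := boolP (t + h \in A).
  - by rewrite subrr normr0 addr_ge0.
  - rewrite sub0r normrN1.
    have [Kt|nKt] := pselect (K t).
      rewrite (_ : \1_(U `\` K) (t + h) = 1); first by rewrite lerDl.
      rewrite indicE mem_set//; split; first exact: sub.
      by move=> /KA /mem_set; exact/negP.
    rewrite (_ : \1_(U `\` K) t = 1); first by rewrite lerDr.
    by rewrite indicE mem_set//; split => //; apply: AU; exact/set_mem.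
  - rewrite subr0 normr1.
    have [Kt|nKt] := pselect (K (t + h)).
      rewrite (_ : \1_(U `\` K) t = 1); first by rewrite lerDr.
      rewrite indicE mem_set//; split; first exact: sub'.
      by move=> /KA /mem_set; exact/negP.
    rewrite (_ : \1_(U `\` K) (t + h) = 1); first by rewrite lerDl.
    by rewrite indicE mem_set//; split => //; apply: AU; exact/set_mem.
  - by rewrite subrr normr0 addr_ge0.
have UKhi := integrable_shift h UKi.
have si := integrableDR measurableT UKhi UKi.
have di : integrable (fun t => `|\1_A (t + h) - \1_A t : R|).
  apply: (integrable_dom measurableT _ _ si); last by move=> t _; rewrite normr_id.
  apply: measurableT_comp => //; apply: measurable_funB; last exact: mi.
  exact: (measurableT_comp (mi _ mA) (measurable_shift h)).
rewrite sub0r normrN ger0_norm; last exact: Rintegral_ge0.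
apply: (@le_trans _ _ (\int[leb]_t (\1_(U `\` K) (t + h) + \1_(U `\` K) t))%R).
  by apply: le_Rintegral => // t _; exact: bd.
rewrite RintegralD// (Rintegral_shift h UKi).
have -> : (\int[leb]_t \1_(U `\` K) t)%R = fine (leb (U `\` K)).
  by rewrite /Rintegral integral_indic// setIT.
have : fine (leb (U `\` K)) <= e / 2.
  by rewrite -lee_fin fineK// ge0_fin_numE// (le_lt_trans UKe)// ltry.
lra.
Unshelve. all: by end_near. Qed.

End translations.

(** * Continuity of translations in L^2 *)

Section square_integrable.
Context {R : realType} (X : normedModType R).
Local Notation leb := (@lebesgue_measure R).
Local Notation integrable f := (leb.-integrable setT (EFin \o f)).
Local Notation sm f := (strongly_measurable (setT : set (measurableTypeR R)) f).
Implicit Types f g : R -> X.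

Lemma sq_normB_le (x y : X) : `|x - y| ^+ 2 <= 2 * `|x| ^+ 2 + 2 * `|y| ^+ 2.
Proof.
have h : `|x - y| ^+ 2 <= (`|x| + `|y|) ^+ 2.
  by rewrite lerXn2r ?nnegrE ?addr_ge0//; exact: ler_normB.
have := sqr_ge0 (`|x| - `|y|); nra.
Qed.

Lemma sm_sq_norm f : sm f -> measurable_fun (setT : set (measurableTypeR R)) (fun t => `|f t| ^+ 2).
Proof. by move=> sf; apply: measurable_funX; exact: sm_norm. Qed.

Lemma sq_integrable_le f (g : R -> R) : sm f -> integrable g ->
  (forall t, `|f t| ^+ 2 <= g t) -> integrable (fun t => `|f t| ^+ 2).
Proof.
move=> sf gi fg; apply: (integrable_dom measurableT _ _ gi); first exact: sm_sq_norm.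
by move=> t _; rewrite ger0_norm ?exprn_ge0.
Qed.

Lemma sq_integrableB f g : sm f -> sm g -> integrable (fun t => `|f t| ^+ 2) ->
  integrable (fun t => `|g t| ^+ 2) -> integrable (fun t => `|f t - g t| ^+ 2).
Proof.
move=> sf sg fi gi.
have si := integrableDR measurableT (integrableZlR measurableT 2 fi) (integrableZlR measurableT 2 gi).
apply: (sq_integrable_le _ si); first exact: sm_sub_fun.
by move=> t; exact: sq_normB_le.
Qed.

Lemma sm_shift f h : sm f -> sm (fun t => f (t + h)).
Proof. by move=> sf; apply: (sm_precomp (measurable_shift h) _ sf). Qed.

Lemma sq_integrable_shiftB f h : sm f -> integrable (fun t => `|f t| ^+ 2) ->
  integrable (fun t => `|f (t + h) - f t| ^+ 2).
Proof.
move=> sf fi; apply: sq_integrableB => //; first exact: sm_shift.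
exact: (integrable_shift h fi).
Qed.

(** When f(t+h) and f(t) differ, at least one of them is a nonzero value x, and the indicator of its
    level set jumps by 1. The square is thus bounded by (2M)^2 times a finite sum of indicator
    differences. Only nonzero values enter, since their level sets have finite measure by square
    integrability. *)
Lemma simple_shift_cvg f : simple_fun (f : measurableTypeR R -> X) ->
  integrable (fun t => `|f t| ^+ 2) ->
  (\int[leb]_t `|f (t + h) - f t| ^+ 2)%R @[h --> 0] --> (0 : R).
Proof.
move=> sf fi.
have smf : sm f by exists (fun=> f) => // t _; exact: cvg_cst.
pose r : seq X := finmap.enum_fset (fset_set (range f)).
have fr t : f t \in r.
  by rewrite /r in_fset_set; [apply/mem_set; exists t|exact: sf.1].
pose A x : set (measurableTypeR R) := f @^-1` [set x].
have mA x : measurable (A x) by exact: sf.2.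
have Afin x : x != 0 -> (leb (A x) < +oo)%E.
  move=> x0; have x2 : 0 < `|x| ^+ 2 by rewrite exprn_gt0// normr_gt0.
  have mn : measurable_fun (setT : set (measurableTypeR R)) (EFin \o (fun t => `|f t| ^+ 2)).
    by case/integrableP : fi.
  have h : ((`|x| ^+ 2)%:E * leb (A x) < +oo)%E.
    case/integrableP : fi => _; apply: le_lt_trans.
    apply: le_trans (le_integral_abse leb measurableT mn x2).
    apply: lee_wpmul2l; first by rewrite lee_fin ltW.
    apply: le_measure.
    - by apply/mem_set; exact: mA.
    - by apply/mem_set; apply: emeasurable_fun_c_infty => //; exact: measurableT_comp.
    - by move=> t; rewrite /A/= => ->; split => //=; rewrite lee_fin ger0_norm ?exprn_ge0.
  rewrite ltey; apply: contraTN h => /eqP ->.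
  by rewrite gt0_muley// ltxx.
pose M := \sum_(x <- r) `|x|.
have fM t : `|f t| <= M.
  rewrite /M (big_rem (f t))//= lerDl; exact: sumr_ge0.
pose I x h := (\int[leb]_t `|\1_(A x) (t + h) - \1_(A x) t : R|)%R.
have Ii x h : x != 0 -> integrable (fun t => `|\1_(A x) (t + h) - \1_(A x) t : R|).
  move=> x0; have Ai : integrable (\1_(A x) : R -> R).
    apply/integrableP; split; first by apply/measurable_EFinP; exact: measurable_indic.
    under eq_integral do rewrite gee0_abs ?lee_fin//.
    by rewrite integral_indic// setIT Afin.
  have di : integrable (fun t => \1_(A x) (t + h) - \1_(A x) t : R).
    by apply: integrableBR => //; exact: (integrable_shift h Ai).
  exact: (integrable_norm di).
pose S h t := \sum_(x <- r | x != 0) `|\1_(A x) (t + h) - \1_(A x) t : R|.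
have S_ge h t : `|f (t + h) - f t| ^+ 2 <= (2 * M) ^+ 2 * S h t.
  have [->|ne] := eqVneq (f (t + h)) (f t).
    by rewrite subrr normr0 expr0n/= mulr_ge0// ?sqr_ge0// sumr_ge0.
  have M0 : 0 <= M by exact: le_trans (fM t).
  have S1 : 1 <= S h t.
    have [x [xr x0 xE]] : exists x, [/\ x \in r, x != 0 & `|\1_(A x) (t + h) - \1_(A x) t : R| = 1].
      have [f0|f0] := eqVneq (f t) 0.
        exists (f (t + h)); split; [exact: fr|by rewrite -f0|].
        rewrite !indicE mem_set// memNset ?subr0 ?normr1//.
        by rewrite /A/= => /esym/eqP; rewrite (negbTE ne).
      exists (f t); split; [exact: fr|by []|].
      rewrite !indicE memNset; last by rewrite /A/= => /eqP; rewrite (negbTE ne).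
      by rewrite mem_set// sub0r normrN1.
    rewrite /S (big_rem x)//= x0 xE lerDl; exact: sumr_ge0.
  rewrite -[leLHS]mulr1; apply: ler_pM => //.
  rewrite lerXn2r ?nnegrE ?mulr_ge0//.
  by rewrite (le_trans (ler_normB _ _))// mulr_natl mulr2n lerD.
have SI h : integrable (S h) /\ (\int[leb]_t S h t)%R = \sum_(x <- r | x != 0) I x h.
  rewrite /S; elim: (r) => [|x r' [IH1 IH2]].
    have -> : (fun t => \sum_(x <- [::] | x != 0) `|\1_(A x) (t + h) - \1_(A x) t : R|) = cst 0.
      by apply/funext => t; rewrite big_nil.
    by rewrite big_nil; split; [exact: integrable0|rewrite /Rintegral integral0].
  rewrite big_cons; case: ifPn => x0; last first.
    under [X in integrable X]eq_fun do rewrite big_cons (negbTE x0).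
    by split => //; rewrite -IH2; apply: eq_Rintegral => t _; rewrite big_cons (negbTE x0).
  have E t : \sum_(y <- x :: r' | y != 0) `|\1_(A y) (t + h) - \1_(A y) t : R| =
      `|\1_(A x) (t + h) - \1_(A x) t : R| + \sum_(y <- r' | y != 0) `|\1_(A y) (t + h) - \1_(A y) t : R|.
    by rewrite big_cons x0.
  rewrite (funext E); split; first by apply: integrableDR => //; exact: Ii.
  by rewrite -IH2 /I -RintegralD//; exact: Ii.
have S0 : \sum_(x <- r | x != 0) I x h @[h --> 0] --> (0 : R).
  elim: (r) => [|x r' IH].
    rewrite (_ : (fun h => _) = cst 0); first exact: cvg_cst.
    by apply/funext => h; rewrite big_nil.
  have [x0|x0] := boolP (x != 0).
    rewrite (_ : (fun h => _) = (fun h => I x h + \sum_(x <- r' | x != 0) I x h)).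
      have c : I x h + \sum_(x <- r' | x != 0) I x h @[h --> 0] --> (0 + 0 : R).
        by apply: cvgD => //; apply: indic_shift_cvg => //; exact: Afin.
      by rewrite addr0 in c.
    by apply/funext => h; rewrite big_cons x0.
  rewrite (_ : (fun h => _) = (fun h => \sum_(x <- r' | x != 0) I x h))//.
  by apply/funext => h; rewrite big_cons (negbTE x0).
have S0' : (2 * M) ^+ 2 * \sum_(x <- r | x != 0) I x h @[h --> 0] --> (0 : R).
  by rewrite -[X in _ --> X](mulr0 ((2 * M) ^+ 2)); apply: cvgMr.
apply: (squeeze_cvgr _ (@cvg_cst _ _ _ _ _) S0'); near=> h.
rewrite Rintegral_ge0 ?andTb; last by move=> t _; exact: exprn_ge0.
have [S1 S2] := SI h; rewrite -S2 -RintegralZl//.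
apply: le_Rintegral => //; [exact: sq_integrable_shiftB|exact: integrableZlR].
Unshelve. all: by end_near. Qed.

(** Density of simple functions. Two applications of |x - y|^2 <= 2|x|^2 + 2|y|^2 and translation
    invariance give 6A + 4B, with A the squared error of [s N] and B the translation error of [s N];
    e / 16 and e / 8 keep the sum below e. *)
Lemma L2_shift_cvg f : sm f -> integrable (fun t => `|f t| ^+ 2) ->
  (\int[leb]_t `|f (t + h) - f t| ^+ 2)%R @[h --> 0] --> (0 : R).
Proof.
move=> smf fi; have [s [s1 _ s3 s4]] := sm_dominated measurableT smf.
have sms n : sm (s n) by exists (fun=> s n) => // t _; exact: cvg_cst.
have si n : integrable (fun t => `|s n t| ^+ 2).
  apply: (sq_integrable_le _ (integrableZlR measurableT 4 fi)) => // t.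
  rewrite (_ : 4 = 2 ^+ 2)//; last by rewrite -natrX.
  by rewrite -exprMn lerXn2r ?nnegrE ?mulr_ge0//; exact: (s4 n t I).1.
have di n : integrable (fun t => `|f t - s n t| ^+ 2) by exact: sq_integrableB.
have d0 : (\int[leb]_t `|f t - s n t| ^+ 2)%R @[n --> \oo] --> (0 : R).
  have -> : (0 : R) = (\int[leb]_t cst 0 t)%R by rewrite /Rintegral integral0.
  apply: (@Rintegral_cvg_dom _ _ _ leb setT measurableT (fun n t => `|f t - s n t| ^+ 2) _ _ _ _ fi).
  - by move=> n; apply: sm_sq_norm; exact: sm_sub_fun.
  - move=> t _; rewrite [X in _ --> X](_ : _ = `|f t - f t| ^+ 2); last by rewrite subrr normr0 expr0n.
    have c : `|f t - s n t| @[n --> \oo] --> `|f t - f t|.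
      by apply: cvg_norm; apply: cvgB; [exact: cvg_cst|exact: s3].
    by rewrite expr2; under eq_fun do rewrite expr2; exact: cvgM.
  - move=> n t _; rewrite ger0_norm ?exprn_ge0// lerXn2r ?nnegrE//.
    exact: (s4 n t I).2.
apply/cvgrPdist_le => e e0.
have arith (A B : R) : A <= e / 16 -> B <= e / 8 -> 4 * A + (4 * B + 2 * A) <= e.
  by clear - e0; lra.
have e16 : 0 < e / 16 by rewrite divr_gt0.
have /cvgrPdist_le/(_ _ e16)[N _ /(_ N (leqnn N))] := d0.
rewrite sub0r normrN ger0_norm => [dN|]; last by apply: Rintegral_ge0 => t _; exact: exprn_ge0.
have e8 : 0 < e / 8 by rewrite divr_gt0.
have /cvgrPdist_le/(_ _ e8) := simple_shift_cvg (s1 N) (si N).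
apply: filterS => h.
rewrite !sub0r !normrN !ger0_norm => [sN| |]; [|by apply: Rintegral_ge0 => t _; exact: exprn_ge0..].
have i1 := integrable_shift h (di N).
have i2 := sq_integrable_shiftB h (sms N) (si N).
have bd t : `|f (t + h) - f t| ^+ 2 <= 4 * `|f (t + h) - s N (t + h)| ^+ 2 +
    (4 * `|s N (t + h) - s N t| ^+ 2 + 2 * `|f t - s N t| ^+ 2).
  have := sq_normB_le (f (t + h) - s N t) (f t - s N t).
  rewrite opprB addrA subrK.
  have := sq_normB_le (f (t + h) - s N (t + h)) (s N t - s N (t + h)).
  rewrite opprB addrA subrK [in X in _ <= _ + X]distrC.
  lra.
have j1 := integrableZlR measurableT 4 i1.
have j2 := integrableZlR measurableT 4 i2.
have j3 := integrableZlR measurableT 2 (di N).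
have j23 := integrableDR measurableT j2 j3.
apply: (@le_trans _ _ (\int[leb]_t (4 * `|f (t + h) - s N (t + h)| ^+ 2 +
    (4 * `|s N (t + h) - s N t| ^+ 2 + 2 * `|f t - s N t| ^+ 2)))%R).
  apply: le_Rintegral => //; [exact: sq_integrable_shiftB|exact: integrableDR].
rewrite RintegralD// RintegralD// !RintegralZl//.
rewrite (Rintegral_shift h (di N)).
exact: arith dN sN.
Qed.

End square_integrable.

(** * Energy identity *)

Section gelfand.
Context {R : realType} {V H : hilbertType R} (G : gelfandTriple V H).
Local Notation leb := (@lebesgue_measure R).
Local Notation integrable f := (leb.-integrable setT (EFin \o f)).
Local Notation sm f := (strongly_measurable (setT : set (measurableTypeR R)) f).

Lemma emb_bounded : exists2 M, 0 < M & forall v : V, `|emb G v| <= M * `|v|.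
Proof.
have /linear_bounded_continuous/linear_boundedP := @emb_continuous _ _ _ G.
move=> [M0 [_ hM]]; exists (`|M0| + 1); first by rewrite ltr_wpDl.
by move=> v; apply: hM; rewrite ltr_pwDr// ler_norm.
Qed.

Lemma toDualE (v x : V) : toDual G v x = inner (emb G v) (emb G x).
Proof. by []. Qed.

Lemma toDual_bounded : exists2 M, 0 < M & forall v : V, `|toDual G v| <= M * `|v|.
Proof.
have [M M0 hM] := emb_bounded; exists (M ^+ 2); first exact: exprn_gt0.
move=> v; apply: dual_norm_leP; first by rewrite mulr_ge0// exprn_ge0// ltW.
move=> x; rewrite toDualE (le_trans (cauchy_schwarz _ _))//.
by rewrite (_ : _ * `|x| = (M * `|v|) * (M * `|x|)); [exact: ler_pM|ring].
Qed.

Lemma toDual_continuous : continuous (toDual G).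
Proof.
have [M M0 hM] := toDual_bounded.
move=> v; apply/(@cvgrPdist_lt _ (dual V) _ (nbhs v) (nbhs_filter v)) => e e0.
have eM : 0 < e / M by rewrite divr_gt0.
have := @nbhsx_ballx R V v _ eM.
apply: filterS => x; rewrite -ball_normE/= => xv.
have -> : toDual G v - toDual G x = toDual G (v - x).
  by apply: dual_ext => z; rewrite dualB !toDualE -innerBl -raddfB.
by rewrite (le_lt_trans (hM _))// mulrC -ltr_pdivlMr.
Qed.

Lemma emb_sq_measurable (u : R -> V) : sm u ->
  measurable_fun (setT : set (measurableTypeR R)) (fun t => `|emb G (u t)| ^+ 2).
Proof.
move=> su; apply: sm_sq_norm; apply: (sm_comp (g := emb G)) => //.
exact: emb_continuous.
Qed.

Lemma emb_sq_integrable (u : R -> V) : sm u -> integrable (fun t => `|u t| ^+ 2) ->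
  integrable (fun t => `|emb G (u t)| ^+ 2).
Proof.
move=> su ui; have [M M0 hM] := emb_bounded.
apply: (integrable_dom measurableT _ _ (integrableZlR measurableT (M ^+ 2) ui)).
  exact: emb_sq_measurable.
move=> t _; rewrite ger0_norm ?exprn_ge0// -exprMn lerXn2r ?nnegrE//.
by rewrite mulr_ge0// ltW.
Qed.

End gelfand.

Section young.
Context {R : realType}.
Implicit Types x y z v k c : R.

Lemma young_mul x y c : 0 < c -> x * y <= x ^+ 2 / (2 * c) + c * y ^+ 2 / 2.
Proof.
move=> c0; rewrite -subr_ge0.
have -> : x ^+ 2 / (2 * c) + c * y ^+ 2 / 2 - x * y = (x - c * y) ^+ 2 / (2 * c).
  by field; rewrite gt_eqF.
by rewrite divr_ge0 ?sqr_ge0// mulr_ge0// ltW.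
Qed.

Lemma young_mul_sum x y z v : y ^+ 2 <= 2 * z ^+ 2 + 2 * v ^+ 2 ->
  x * y <= x ^+ 2 + 2 * (z ^+ 2 + v ^+ 2).
Proof.
move=> yzv; have := young_mul x y ltr01.
have := sqr_ge0 x; have := sqr_ge0 z; have := sqr_ge0 v; lra.
Qed.

Lemma young_mul3 x y z v k c : 0 < c ->
  x * y + x * z + v * k <= c^-1 * (x ^+ 2 + k ^+ 2) + c / 2 * (y ^+ 2 + z ^+ 2 + v ^+ 2).
Proof.
move=> c0.
have := young_mul x y c0; have := young_mul x z c0; have := young_mul k v c0.
have := mulr_ge0 (ltW c0) (sqr_ge0 k); rewrite !invfM.
have : 0 <= c^-1 * k ^+ 2 by rewrite mulr_ge0 ?sqr_ge0// invr_ge0 ltW.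
move: (c^-1) => c'; nra.
Qed.

Lemma young_mass c (p U W : R) : 0 < c -> 0 <= W ->
  p + c / 2 * (U + U + W) <= p + c * (U + W).
Proof. by move=> c0 W0; rewrite lerD2l; nra. Qed.

End young.

(** * Steklov averages *)

Section steklov.
Context {R : realType} {V H : hilbertType R} (G : gelfandTriple V H).
Local Notation leb := (@lebesgue_measure R).
Local Notation integrable f := (leb.-integrable setT (EFin \o f)).
Local Notation sm f := (strongly_measurable (setT : set (measurableTypeR R)) f).
Variables (u : R -> V) (w : R -> dual V).
Hypotheses (su : sm u) (sw : sm w).
Hypotheses (u2 : integrable (fun t => `|u t| ^+ 2)) (w2 : integrable (fun t => `|w t| ^+ 2)).
Hypothesis w1 : integrable (fun t => `|w t|).

Lemma Rintegral_tail_sub (g : R -> R) (a b : R) : a <= b -> integrable g ->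
  (\int[leb]_(s in `[a, +oo[) g s)%R - (\int[leb]_(s in `[b, +oo[) g s)%R =
  (\int[leb]_s (\1_(`[a, b[%classic) s * g s))%R.
Proof.
move=> ab gi; rewrite (Rintegral_patch `[a, +oo[) (Rintegral_patch `[b, +oo[).
rewrite -RintegralB//; [|exact: (integrable_patch g (measurable_itv _)).1 (integrable_sub (measurable_itv _) gi)..].
apply: eq_Rintegral => t _; rewrite !patchE !mem_setE indicE mem_setE !in_itv/= !andbT.
have [at_|ta] := leP a t; have [bt|tb] := leP b t => /=; rewrite ?mul1r ?mul0r ?subrr ?subr0//.
by have := lt_le_trans ta (le_trans ab bt); rewrite ltxx.
Qed.

Lemma Rintegral_lt_sub (g : R -> R) (a b : R) : a <= b -> integrable g ->
  (\int[leb]_(s in `]-oo, b]) g s)%R - (\int[leb]_(s in `]-oo, a]) g s)%R =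
  (\int[leb]_s (\1_(`]a, b]%classic) s * g s))%R.
Proof.
move=> ab gi; rewrite (Rintegral_patch `]-oo, b]) (Rintegral_patch `]-oo, a]).
rewrite -RintegralB//; [|exact: (integrable_patch g (measurable_itv _)).1 (integrable_sub (measurable_itv _) gi)..].
apply: eq_Rintegral => t _; rewrite !patchE !mem_setE indicE mem_setE !in_itv/=.
have [tb|bt] := leP t b; have [ta|at_] := leP t a => /=; rewrite ?mul1r ?mul0r ?subrr ?subr0//.
by have := lt_le_trans bt (le_trans ta ab); rewrite ltxx.
Qed.

Lemma pairing_integrable v : integrable (fun s => w s v).
Proof. exact: (dual_integrable measurableT v sw w1). Qed.

(* the right-hand side of the energy identity tested at shift [(r, h)] *)
Definition steklov_pair (a b h r : R) : R :=
  (\int[leb]_t (\1_(`]a, b[%classic) t * w (t + r) (u (t + h) + u t)))%R.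

Let U := (\int[leb]_t `|u t| ^+ 2)%R.
Let W := (\int[leb]_t `|w t| ^+ 2)%R.

Lemma steklov_integrand_bound (a b h r t : R) :
  `|\1_(`]a, b[%classic) t * w (t + r) (u (t + h) + u t)| <=
  `|w (t + r)| ^+ 2 + 2 * (`|u (t + h)| ^+ 2 + `|u t| ^+ 2).
Proof.
rewrite normrM; apply: (@le_trans _ _ `|w (t + r) (u (t + h) + u t)|).
  by rewrite ler_piMl// indicE; case: (_ \in _); rewrite ?normr1 ?normr0.
apply: (le_trans (dual_le _ _)); apply: young_mul_sum.
by have := sq_normB_le (u (t + h)) (- u t); rewrite opprK normrN.
Qed.

Lemma steklov_integrand_integrable (a b h r : R) :
  integrable (fun t => \1_(`]a, b[%classic) t * w (t + r) (u (t + h) + u t)).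
Proof.
have i1 := integrable_shift r w2.
have i2 := integrable_shift h u2.
have i3 := integrableDR measurableT i1 (integrableZlR measurableT 2 (integrableDR measurableT i2 u2)).
apply: (integrable_dom measurableT _ _ i3).
  apply: measurable_funM; first exact: measurable_indic.
  by apply: sm_pairing => //; [exact: sm_shift|apply: sm_add => //; exact: sm_shift].
by move=> t _; exact: steklov_integrand_bound.
Qed.

(** Twice the pairing of [w] and [u] is the unshifted value. The difference splits bilinearly into
    <w(t+r) - w(t), u(t+h)>, <w(t+r) - w(t), u(t)> and <w(t), u(t+h) - u(t)>. Young's inequality
    with parameter [c] puts the translation errors over [c] and leaves [c] times the total
    masses. *)
Lemma steklov_pair_dist (a b h r c : R) : 0 < c ->
  `|steklov_pair a b h r - 2 * (\int[leb]_t (\1_(`]a, b[%classic) t * w t (u t)))%R| <=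
  ((\int[leb]_t `|w (t + r) - w t| ^+ 2)%R + (\int[leb]_t `|u (t + h) - u t| ^+ 2)%R) / c
  + c * (U + W).
Proof.
move=> c0.
have i0 : integrable (fun t => 2 * (\1_(`]a, b[%classic) t * w t (u t))).
  apply: eq_integrable (steklov_integrand_integrable a b 0 0) => // t _ /=.
  by rewrite !addr0 dual_linD; congr EFin; ring.
have i0' : integrable (fun t => \1_(`]a, b[%classic) t * w t (u t)).
  apply: eq_integrable (integrableZlR measurableT 2^-1 i0) => // t _ /=.
  by congr EFin; field.
rewrite -RintegralZl// /steklov_pair -RintegralB//; last exact: steklov_integrand_integrable.
have dw := sq_integrable_shiftB r sw w2.
have du := sq_integrable_shiftB h su u2.
have uh := integrable_shift h u2.
have i1 := integrableZlR measurableT c^-1 (integrableDR measurableT dw du).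
have i2 := integrableZlR measurableT (c / 2) (integrableDR measurableT (integrableDR measurableT uh u2) w2).
have i12 := integrableDR measurableT i1 i2.
apply: (@le_trans _ _ (\int[leb]_t (c^-1 * (`|w (t + r) - w t| ^+ 2 + `|u (t + h) - u t| ^+ 2) +
  c / 2 * (`|u (t + h)| ^+ 2 + `|u t| ^+ 2 + `|w t| ^+ 2)))%R).
  apply: le_Rintegral_norm => //.
    by apply: integrableBR => //; exact: steklov_integrand_integrable.
  move=> t _.
  have -> : \1_(`]a, b[%classic) t * w (t + r) (u (t + h) + u t) -
      2 * (\1_(`]a, b[%classic) t * w t (u t)) =
    \1_(`]a, b[%classic) t * ((w (t + r) - w t) (u (t + h)) + (w (t + r) - w t) (u t) +
      w t (u (t + h) - u t)).
    by rewrite !dualB dual_linD dual_linB; ring.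
  set q := (_ + _ + _); apply: (@le_trans _ _ `|q|).
    by rewrite normrM ler_piMl// indicE; case: (_ \in _); rewrite ?normr1 ?normr0.
  rewrite /q {q}; apply: (le_trans (ler_normD _ _)).
  apply: (@le_trans _ _ ((`|w (t + r) - w t| * `|u (t + h)| + `|w (t + r) - w t| * `|u t|)
      + `|w t| * `|u (t + h) - u t|)).
    apply: lerD; last exact: dual_le.
    by apply: (le_trans (ler_normD _ _)); apply: lerD; exact: dual_le.
  exact: young_mul3.
have j1 := integrableDR measurableT dw du.
have j3 := integrableDR measurableT uh u2.
have j2 := integrableDR measurableT j3 w2.
rewrite (RintegralD measurableT i1 i2) (RintegralZl _ measurableT j1) (RintegralZl _ measurableT j2).
rewrite (RintegralD measurableT dw du) (RintegralD measurableT j3 w2) (RintegralD measurableT uh u2).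
rewrite (Rintegral_shift h u2) -/U -/W [c^-1 * _]mulrC.
by apply: young_mass => //; apply: Rintegral_ge0 => t _; exact: exprn_ge0.
Qed.

End steklov.

Section energy.
Context {R : realType} {V H : hilbertType R} (G : gelfandTriple V H).
Local Notation leb := (@lebesgue_measure R).
Local Notation integrable f := (leb.-integrable setT (EFin \o f)).
Local Notation sm f := (strongly_measurable (setT : set (measurableTypeR R)) f).
Variables (u : R -> V) (w : R -> dual V).
Hypotheses (su : sm u) (sw : sm w).
Hypotheses (u2 : integrable (fun t => `|u t| ^+ 2)) (w2 : integrable (fun t => `|w t| ^+ 2)).
Hypothesis w1 : integrable (fun t => `|w t|).

(** The integrand is dominated through Young's inequality; by translation invariance its integral in
    [t] is bounded by a constant independent of [r], and [r] ranges over a bounded interval. *)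
Lemma steklov_fubini (a b h : R) :
  [/\ integrable (fun r => \1_(`[0, h[%classic) r * steklov_pair u w a b h r),
   integrable (fun t => \1_(`]a, b[%classic) t *
     (\int[leb]_r (\1_(`[0, h[%classic) r * w (t + r) (u (t + h) + u t)))%R) &
  (\int[leb]_t (\1_(`]a, b[%classic) t *
     (\int[leb]_r (\1_(`[0, h[%classic) r * w (t + r) (u (t + h) + u t)))%R))%R =
  (\int[leb]_r (\1_(`[0, h[%classic) r * steklov_pair u w a b h r))%R].
Proof.
pose Q (p : measurableTypeR R * measurableTypeR R) : R :=
  \1_(`[0, h[%classic) p.2 * (\1_(`]a, b[%classic) p.1 * w (p.1 + p.2) (u (p.1 + h) + u p.1)).
have mQ : measurable_fun setT (EFin \o Q).
  apply/measurable_EFinP; apply: measurable_funM.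
    apply: (measurableT_comp (f := (\1_(`[0, h[%classic) : measurableTypeR R -> R))) => //.
  apply: measurable_funM.
    apply: (measurableT_comp (f := (\1_(`]a, b[%classic) : measurableTypeR R -> R))) => //.
  apply: sm_pairing => //.
    apply: (sm_precomp (h := fun p : measurableTypeR R * measurableTypeR R => p.1 + p.2 : measurableTypeR R) _ _ sw) => //.
    by apply: measurable_funD; [exact: measurable_fst|exact: measurable_snd].
  apply: sm_add.
    apply: (sm_precomp (h := fun p : measurableTypeR R * measurableTypeR R => p.1 + h : measurableTypeR R) _ _ su) => //.
    by apply: measurable_funD; [exact: measurable_fst|exact: measurable_cst].
  apply: (sm_precomp (h := fun p : measurableTypeR R * measurableTypeR R => p.1) _ _ su) => //; exact: measurable_fst.
have i2 := integrable_shift h u2.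
pose C : R := ((\int[leb]_t `|w t| ^+ 2)%R + 2 * ((\int[leb]_t `|u t| ^+ 2)%R + (\int[leb]_t `|u t| ^+ 2)%R)).
have Qbd r : (\int[leb]_t `|(EFin \o Q) (t, r)| <= (C * \1_(`[0, h[%classic) r)%:E)%E.
  have i1 := integrable_shift r w2.
  have i23 := integrableDR measurableT i2 u2.
  have i4 := integrableZlR measurableT 2 i23.
  have i5 := integrableDR measurableT i1 i4.
  have i6 := integrableZlR measurableT (\1_(`[0, h[%classic) r) i5.
  have -> : C * \1_(`[0, h[%classic) r = (\int[leb]_t (\1_(`[0, h[%classic) r *
      (`|w (t + r)| ^+ 2 + 2 * (`|u (t + h)| ^+ 2 + `|u t| ^+ 2))))%R.
    rewrite (RintegralZl _ measurableT i5) (RintegralD measurableT i1 i4) (RintegralZl _ measurableT i23).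
    by rewrite (RintegralD measurableT i2 u2) (Rintegral_shift r w2) (Rintegral_shift h u2) mulrC.
  rewrite EFin_Rintegral//; apply: ge0_le_integral => //.
  - apply: measurableT_comp => //; exact: (measurableT_comp mQ (measurable_pair2 r)).
  - by case/integrableP : i6.
  - move=> t _; rewrite lee_fin /Q/= normrM.
    have ind0 : 0 <= (\1_(`[0, h[%classic) r : R) by rewrite indicE.
    by rewrite (ger0_norm ind0); apply: ler_wpM2l => //; exact: steklov_integrand_bound.
have iQ : (leb \x leb)%E.-integrable setT (EFin \o Q).
  apply/integrable21ltyP => //.
  apply: (@le_lt_trans _ _ (\int[leb]_r (C * \1_(`[0, h[%classic) r)%:E)%E).
    apply: ge0_le_integral => //.
    - by move=> r _; apply: integral_ge0 => t _; exact: abse_ge0.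
    - by apply: (measurable_fun_fubini_tonelli_G (abse \o (EFin \o Q))); [exact: measurableT_comp|move=> p; exact: abse_ge0].
    - by apply/measurable_EFinP; apply: measurable_funM.
  exact: (integrable_lty measurableT (integrableZlR measurableT C (integrable_indic_itv 0 h true true))).
have FE : fubini_F leb (EFin \o Q) = EFin \o (fun t => \1_(`]a, b[%classic) t *
     (\int[leb]_r (\1_(`[0, h[%classic) r * w (t + r) (u (t + h) + u t)))%R).
  apply/funext => t; rewrite /fubini_F /=.
  have ii : integrable (fun r => \1_(`[0, h[%classic) r * w (t + r) (u (t + h) + u t)).
    apply: (integrable_bdd_mul (c := 1)) => //.
      by move=> r; rewrite indicE; case: (_ \in _); rewrite ?normr1 ?normr0.
    have := integrable_shift t (pairing_integrable sw w1 (u (t + h) + u t)).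
    by apply: eq_integrable => // r _ /=; rewrite addrC.
  rewrite -(RintegralZl _ measurableT ii) (EFin_Rintegral measurableT (integrableZlR measurableT _ ii)).
  by apply: eq_integral => r _; rewrite /Q/= mulrCA.
have GE : fubini_G leb (EFin \o Q) = EFin \o (fun r => \1_(`[0, h[%classic) r * steklov_pair u w a b h r).
  apply/funext => r; rewrite /fubini_G /=.
  have ii := steklov_integrand_integrable su sw u2 w2 a b h r.
  by rewrite /steklov_pair -(RintegralZl _ measurableT ii) (EFin_Rintegral measurableT (integrableZlR measurableT _ ii)).
split.
- have iG : leb.-integrable setT (fubini_G leb (EFin \o Q)).
    apply/integrableP; split; first exact: (measurable_fubini_G iQ).
    apply: le_lt_trans ((integrable21ltyP leb leb mQ).1 iQ).
    apply: ge0_le_integral => //.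
    + by apply: measurableT_comp => //; exact: (measurable_fubini_G iQ).
    + by apply: (measurable_fun_fubini_tonelli_G (abse \o (EFin \o Q))); [exact: measurableT_comp|move=> p; exact: abse_ge0].
    + move=> x _; apply: le_abse_integral => //.
      exact: (measurableT_comp mQ (measurable_pair2 x)).
  by move: iG; rewrite GE.
- by have := integrable_fubini_F iQ; rewrite FE.
- have hF := Fubini iQ.
  apply: (congr1 fine).
  transitivity (\int[leb]_t fubini_F leb (EFin \o Q) t)%E; first by rewrite FE.
  by transitivity (\int[leb]_t fubini_G leb (EFin \o Q) t)%E; [exact: hF|rewrite GE].
Qed.

(** The average over 0 <= r < h inherits a bound that is uniform in [r]: all the pairs at shift
    [(r, h)] are within [e] of the limit once [h] is small. *)
Lemma steklov_cvg (a b : R) :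
  h^-1 * (\int[leb]_r (\1_(`[0, h[%classic) r * steklov_pair u w a b h r))%R @[h --> 0^'+] -->
  2 * (\int[leb]_t (\1_(`]a, b[%classic) t * w t (u t)))%R.
Proof.
set L := 2 * _.
set U := (\int[leb]_t `|u t| ^+ 2)%R; set W := (\int[leb]_t `|w t| ^+ 2)%R.
have U0 : 0 <= U by apply: Rintegral_ge0 => t _; exact: exprn_ge0.
have W0 : 0 <= W by apply: Rintegral_ge0 => t _; exact: exprn_ge0.
apply/cvgrPdist_le => e e0.
(* Chosen so that c (U + W) <= e / 2; the summand 1 covers U = W = 0. The two translation errors are
   then taken at most e c / 4 each, so that divided by [c] they also give e / 2. *)
pose c := e / (2 * (U + W + 1)).
have UW : 0 < U + W + 1 by rewrite ltr_wpDl// addr_ge0.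
have c0 : 0 < c by rewrite divr_gt0// mulr_gt0.
have ec : 0 < e * c / 4 by rewrite divr_gt0// mulr_gt0.
have cUW : c * (U + W) <= e / 2.
  rewrite /c -mulrA ler_pM2l// invfM -mulrA ler_piMr//.
  by rewrite ler_pdivrMl// mulr1 lerDl.
have /cvgrPdist_le/(_ _ ec)/nbhs_ballP[d1 /= d10 hd1] := L2_shift_cvg sw w2.
have /cvgrPdist_le/(_ _ ec)/nbhs_ballP[d2 /= d20 hd2] := L2_shift_cvg su u2.
have dist_w r : `|r| < d1 -> (\int[leb]_t `|w (t + r) - w t| ^+ 2)%R <= e * c / 4.
  move=> rd; have := hd1 r; rewrite -ball_normE/= !sub0r !normrN => /(_ rd).
  by rewrite ger0_norm//; apply: Rintegral_ge0 => t _; exact: exprn_ge0.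
have dist_u r : `|r| < d2 -> (\int[leb]_t `|u (t + r) - u t| ^+ 2)%R <= e * c / 4.
  move=> rd; have := hd2 r; rewrite -ball_normE/= !sub0r !normrN => /(_ rd).
  by rewrite ger0_norm//; apply: Rintegral_ge0 => t _; exact: exprn_ge0.
near=> h.
have h0 : 0 < h by near: h; exact: nbhs_right_gt.
have hd1' : h < d1 by near: h; exact: nbhs_right_lt.
have hd2' : h < d2 by near: h; exact: nbhs_right_lt.
have Gr r : 0 <= r -> r < h -> `|steklov_pair u w a b h r - L| <= e.
  move=> r0 rh; apply: le_trans (steklov_pair_dist su sw u2 w2 a b h r c0) _.
  rewrite -/U -/W [leRHS](splitr e); apply: lerD => //.
  rewrite ler_pdivrMr//.
  have rd : `|r| < d1 by rewrite ger0_norm// (lt_trans rh).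
  have hd : `|h| < d2 by rewrite gtr0_norm.
  have h1 := dist_w r rd; have h2 := dist_u h hd.
  rewrite (_ : e / 2 * c = e * c / 4 + e * c / 4); first exact: lerD.
  by field.
have [ig _ _] := steklov_fubini a b h.
have ii : integrable (\1_(`[0, h[%classic) : R -> R) by exact: integrable_indic_itv.
have Ih : (\int[leb]_t \1_(`[0, h[%classic) t)%R = h.
  rewrite /Rintegral integral_indic// setIT /= lebesgue_measure_itv/= lte_fin h0.
  by rewrite oppr0 addr0.
have -> : L - h^-1 * (\int[leb]_r (\1_(`[0, h[%classic) r * steklov_pair u w a b h r))%R =
  h^-1 * (\int[leb]_r (L * \1_(`[0, h[%classic) r - \1_(`[0, h[%classic) r * steklov_pair u w a b h r))%R.
  rewrite RintegralB//; last exact: (integrableZlR measurableT L ii).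
  rewrite (RintegralZl _ measurableT ii) Ih mulrBr; congr (_ - _).
  by rewrite mulrCA mulVf ?mulr1// gt_eqF.
have hV0 : 0 < h^-1 by rewrite invr_gt0.
rewrite normrM (gtr0_norm hV0) ler_pdivrMl//.
rewrite mulrC -[X in e * X]Ih -(RintegralZl e measurableT ii).
apply: le_Rintegral_norm => //.
- by apply: integrableBR => //; exact: (integrableZlR measurableT L ii).
- exact: (integrableZlR measurableT e ii).
- move=> r _; rewrite mulrC -mulrBr indicE mem_setE in_itv/=.
  case: (boolP (0 <= r < h)) => [/andP[r0 rh]|_]; last by rewrite mul0r normr0 mulr0.
  by rewrite mul1r mulr1 distrC Gr.
Unshelve. all: by end_near. Qed.

End energy.

(** * The energy identity between almost all times *)

Section energy_identity.
Context {R : realType} {V H : hilbertType R} (G : gelfandTriple V H).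
Local Notation leb := (@lebesgue_measure R).
Local Notation integrable f := (leb.-integrable setT (EFin \o f)).
Local Notation sm f := (strongly_measurable (setT : set (measurableTypeR R)) f).

Lemma ae_eq_Rintegral (f g : R -> R) : integrable f -> integrable g ->
  {ae leb, forall t, f t = g t} -> (\int[leb]_t f t)%R = (\int[leb]_t g t)%R.
Proof.
move=> fi gi fg; congr fine; apply: ae_eq_integral => //.
- by case/integrableP : fi.
- by case/integrableP : gi.
- by apply: aeS fg => t fgt _ /=; rewrite fgt.
Qed.

Lemma inner_sq_sub (x y : H) : `|x| ^+ 2 - `|y| ^+ 2 = inner (x - y) (x + y).
Proof.
by rewrite innerBl !innerDr !inner_norm (innerC y x); ring.
Qed.

(** Expresses a distance through a difference of energies and a cross term, so that the energy
    identity can later yield continuity. *)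
Lemma sq_norm_sub (x y : H) : `|x - y| ^+ 2 = `|x| ^+ 2 - `|y| ^+ 2 - 2 * inner (x - y) y.
Proof.
by rewrite -!inner_norm !innerBl !innerBr (innerC y x); ring.
Qed.

Variables (u : R -> V) (w : R -> dual V).
Hypotheses (su : sm u) (sw : sm w).
Hypotheses (u2 : integrable (fun t => `|u t| ^+ 2)) (w2 : integrable (fun t => `|w t| ^+ 2)).
Hypothesis w1 : integrable (fun t => `|w t|).
Variables (T : R) (good : R -> Prop).
Hypothesis ae_good : {ae leb, forall t, t \in `]0, T[ -> good t}.
Hypothesis good_increment : forall a b v, good a -> good b ->
  inner (emb G (u b) - emb G (u a)) (emb G v) =
  (\int[leb]_(s in `[a, +oo[) w s v)%R - (\int[leb]_(s in `[b, +oo[) w s v)%R.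

Let e t := `|emb G (u t)| ^+ 2.

(** |x|^2 - |y|^2 = (x - y, x + y), and u(t+h) + u(t) lies in V. Since the set of good times does
    not depend on the test vector, this time-dependent vector is admissible in [good_increment]. *)
Lemma energy_increment t h : 0 <= h -> good t -> good (t + h) ->
  e (t + h) - e t = (\int[leb]_r (\1_(`[0, h[%classic) r * w (t + r) (u (t + h) + u t)))%R.
Proof.
move=> h0 gt gth.
rewrite /e inner_sq_sub -raddfD (good_increment _ gt gth) Rintegral_tail_sub; last 2 first.
- by rewrite lerDl.
- exact: (pairing_integrable sw w1).
have i1 : integrable (fun s => \1_(`[t, t + h[%classic) s * w s (u (t + h) + u t)).
  apply: (integrable_bdd_mul (c := 1)); last exact: (pairing_integrable sw w1).
    by apply: measurable_indic.
  by move=> r; rewrite indicE; case: (_ \in _); rewrite ?normr1 ?normr0.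
rewrite -(Rintegral_shift t i1); apply: eq_Rintegral => r _.
rewrite !indicE !mem_setE !in_itv/= [r + t]addrC; congr (_%:R * _).
by rewrite lerDl ltrD2l.
Qed.

(** The good times are restricted to those where the primitive [E] of the energy is differentiable
    with derivative [e], which are almost all by Lebesgue's theorem. At such endpoints the averages
    of [e] over [b, b+h] and [a, a+h] converge to e(b) and e(a), and their difference is the Steklov
    average whose limit is known. *)
Lemma energy_identity : exists good' : R -> Prop,
  [/\ {ae leb, forall t, t \in `]0, T[ -> good' t}, forall t, good' t -> good t &
    forall a b : R, 0 < a -> a < b -> b < T -> good' a -> good' b ->
      e b - e a = 2 * (\int[leb]_t (\1_(`]a, b[%classic) t * w t (u t)))%R].
Proof.
have ei : integrable e by exact: emb_sq_integrable.
pose E x := (\int[leb]_(t in `]-oo, x]) e t)%R.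
pose good' t := good t /\ derivable E t 1 /\ derive1 E t = e t.
have aeE : {ae leb, forall t : R, derivable E t 1 /\ derive1 E t = e t}.
  apply: FTC1Ny; first by move=> y; exact: (integrable_sub (measurable_itv _) ei).
  by apply: open_integrable_locally => //; exact: openT.
exists good'; split => [|t [] //|a b a0 ab bT [ga [dEa Ea]] [gb [dEb Eb]]].
  by apply: aeS (aeI ae_good aeE) => t [h1 h2] tI; split => //; exact: h1.
set L := 2 * _.
have c1 := @steklov_cvg _ _ u w su sw u2 w2 w1 a b.
rewrite -/L in c1.
have cE x : derivable E x 1 -> derive1 E x = e x ->
    h^-1 * (E (x + h) - E x) @[h --> 0^'+] --> e x.
  move=> dE dEx; apply: cvg_dnbhs_at_right.
  rewrite -dEx derive1E.
  rewrite (_ : (fun h => _) = (fun h : R => h^-1 *: (E (h *: 1 + x) - E x))).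
    exact: dE.
  by apply/funext => h; rewrite /GRing.scale/= mulr1 [h + x]addrC.
have c2 : h^-1 * (E (b + h) - E b) - h^-1 * (E (a + h) - E a) @[h --> 0^'+] --> e b - e a.
  by apply: cvgB; exact: cE.
suff c3 : h^-1 * (E (b + h) - E b) - h^-1 * (E (a + h) - E a) @[h --> 0^'+] --> L.
  exact: (cvg_unique _ c2 c3).
apply: cvg_trans c1; apply: near_eq_cvg; near=> h.
have h0 : 0 < h by near: h; exact: nbhs_right_gt.
(* Keeps [t + h] below [T] for all [t] in (a, b), so that [t] and [t + h] are both good for almost
   every such [t]. *)
have hT : h < T - b by near: h; apply: nbhs_right_lt; rewrite subr_gt0.
have [_ i1 <-] := steklov_fubini su sw u2 w2 w1 a b h.
have ehi := integrable_shift h ei.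
have Ii (g : R -> R) : integrable g -> integrable (fun t => \1_(`]a, b[%classic) t * g t).
  move=> gi; apply: (integrable_bdd_mul (c := 1)) => //.
  by move=> r; rewrite indicE; case: (_ \in _); rewrite ?normr1 ?normr0.
transitivity (h^-1 * (\int[leb]_t (\1_(`]a, b[%classic) t * e (t + h) - \1_(`]a, b[%classic) t * e t))%R).
  congr (_ * _); apply: ae_eq_Rintegral => //; first by apply: integrableBR => //; exact: Ii.
  apply: aeS (aeI ae_good (ae_shift h ae_good)) => t [h1 h2].
  rewrite -mulrBr indicE mem_setE.
  case: (boolP (t \in `]a, b[)) => [tab|]; last by rewrite !mul0r.
  have /andP[at_ tb] : a < t < b by move: tab; rewrite in_itv.
  have gt : good t by apply: h1; rewrite in_itv/= (lt_trans a0 at_) (lt_trans tb bT).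
  have gth : good (t + h).
    apply: h2; rewrite in_itv/= (lt_trans (lt_trans a0 at_)) ?ltrDl//=.
    by rewrite (lt_trans (ltr_leD tb (lexx h)))// -ltrBrDl.
  by rewrite (energy_increment (ltW h0) gt gth).
rewrite RintegralB//; [|exact: Ii..].
have sh : (\int[leb]_t (\1_(`]a, b[%classic) t * e (t + h)))%R = E (b + h) - E (a + h).
  rewrite /E Rintegral_lt_sub//; last by rewrite lerD2r ltW.
  have j : integrable (fun s => \1_(`]a + h, b + h]%classic) s * e s).
    apply: (integrable_bdd_mul (c := 1)) => //.
    by move=> r; rewrite indicE; case: (_ \in _); rewrite ?normr1 ?normr0.
  rewrite -(Rintegral_shift h j).
  have j' := integrable_shift h j.
  apply: ae_eq_Rintegral => //; first exact: Ii.
  exists [set b]; split => //; first by rewrite lebesgue_measure_set1.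
  move=> t ne; apply: contrapT => tb; apply: ne.
  rewrite /= !indicE !mem_setE !in_itv/= ltrD2r lerD2r; congr (_%:R * _).
  by rewrite le_eqVlt; case: eqP tb => //= ->.
have sh0 : (\int[leb]_t (\1_(`]a, b[%classic) t * e t))%R = E b - E a.
  rewrite /E Rintegral_lt_sub//; last exact: ltW.
  have j : integrable (fun s => \1_(`]a, b]%classic) s * e s).
    apply: (integrable_bdd_mul (c := 1)) => //.
    by move=> r; rewrite indicE; case: (_ \in _); rewrite ?normr1 ?normr0.
  apply: ae_eq_Rintegral => //; first exact: Ii.
  exists [set b]; split => //; first by rewrite lebesgue_measure_set1.
  move=> t ne; apply: contrapT => tb; apply: ne.
  rewrite /= !indicE !mem_setE !in_itv/=; congr (_%:R * _).
  by rewrite le_eqVlt; case: eqP tb => //= ->.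
by rewrite sh sh0; ring.
Unshelve. all: by end_near. Qed.

End energy_identity.

Section almost_everywhere_itv.
Context {R : realType}.
Local Notation leb := (@lebesgue_measure R).
Local Notation integrable f := (leb.-integrable setT (EFin \o f)).

Lemma ae_itv_exists (a b : R) (P : R -> Prop) : a < b ->
  {ae leb, forall t, P t} -> exists t, [/\ a < t, t < b & P t].
Proof.
move=> ab [N [mN N0 hN]]; apply: contrapT => nP.
have sub : `]a, b[%classic `<=` N.
  move=> t; rewrite /= in_itv/= => /andP[at_ tb]; apply: hN => Pt.
  by apply: nP; exists t.
have : (leb `]a, b[%classic <= leb N)%E.
  by apply: le_measure => //; apply/mem_set => //; exact: measurable_itv.
by rewrite N0 /= lebesgue_measure_itv/= lte_fin ab -EFinD lee_fin subr_le0 leNgt ab.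
Qed.

Lemma ae_le_Rintegral (f g : R -> R) : integrable f -> integrable g ->
  (forall t, 0 <= f t) -> (forall t, 0 <= g t) ->
  {ae leb, forall t, f t <= g t} -> (\int[leb]_t f t)%R <= (\int[leb]_t g t)%R.
Proof.
move=> fi gi f0 g0 fg; rewrite -lee_fin !EFin_Rintegral//.
apply: ae_ge0_le_integral => //.
- by move=> t _; rewrite lee_fin.
- by case/integrableP : fi.
- by move=> t _; rewrite lee_fin.
- by case/integrableP : gi.
- by apply: aeS fg => t fgt _; rewrite lee_fin.
Qed.

Lemma indic_mul_integrable (A : set (measurableTypeR R)) (g : R -> R) : measurable A ->
  integrable g -> integrable (fun t => \1_A t * g t).
Proof.
move=> mA gi; apply: (integrable_bdd_mul (c := 1)) => //.
by move=> r; rewrite indicE; case: (_ \in _); rewrite ?normr1 ?normr0.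
Qed.

Lemma indic_mul_norm_le (A B : set R) (x y t : R) : A `<=` B -> `|x| <= y ->
  `|\1_A t * x| <= \1_B t * y.
Proof.
move=> AB xy; rewrite !indicE.
have y0 : 0 <= y by exact: le_trans xy.
case: (boolP (t \in A)) => [/set_mem/AB tB|_]; first by rewrite mem_set// !mul1r.
by rewrite mul0r normr0 mulr_ge0.
Qed.

End almost_everywhere_itv.

Section arithmetic.
Context {R : realType}.
Implicit Types x y : R.

Lemma half_young x y : x * y <= 2^-1 * (y ^+ 2 + x ^+ 2).
Proof. by have := sqr_ge0 (x - y); nra. Qed.

Lemma mean_arith x y M d e : x <= 2^-1 * M -> y <= 2^-1 * (M + d) -> d <= M + e ->
  2 * x + 2 * y <= 3 * M + e.
Proof. by lra. Qed.

Lemma sq_dist_arith x y z M e : x <= 2 * y + 2 * z -> y <= 3 * M + e / 4 ->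
  z <= 3 * M + e / 4 -> x <= 12 * M + e.
Proof. by lra. Qed.

Lemma sq_small_arith x e M : x <= 12 * M + e ^+ 2 / 2 -> M <= e ^+ 2 / 24 -> x <= e ^+ 2.
Proof. by lra. Qed.

End arithmetic.

(** * Uniform continuity along the good times *)

Section continuous_representative.
Context {R : realType} {V H : hilbertType R} (G : gelfandTriple V H).
Local Notation leb := (@lebesgue_measure R).
Local Notation integrable f := (leb.-integrable setT (EFin \o f)).
Local Notation sm f := (strongly_measurable (setT : set (measurableTypeR R)) f).
Variables (u : R -> V) (w : R -> dual V).
Hypotheses (su : sm u) (sw : sm w).
Hypotheses (u2 : integrable (fun t => `|u t| ^+ 2)) (w2 : integrable (fun t => `|w t| ^+ 2)).
Hypothesis w1 : integrable (fun t => `|w t|).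
Variables (T : R) (good : R -> Prop).
Hypothesis T_gt0 : 0 < T.
Hypothesis ae_good : {ae leb, forall t, t \in `]0, T[ -> good t}.
Hypothesis good_increment : forall a b v, good a -> good b ->
  inner (emb G (u b) - emb G (u a)) (emb G v) =
  (\int[leb]_(s in `[a, +oo[) w s v)%R - (\int[leb]_(s in `[b, +oo[) w s v)%R.
Hypothesis good_energy : forall a b : R, 0 < a -> a < b -> b < T -> good a -> good b ->
  `|emb G (u b)| ^+ 2 - `|emb G (u a)| ^+ 2 =
  2 * (\int[leb]_t (\1_(`]a, b[%classic) t * w t (u t)))%R.

Let mass p q := (\int[leb]_t (\1_(`]p, q[%classic) t * (`|u t| ^+ 2 + `|w t| ^+ 2)))%R.

Let uw_integrable : integrable (fun t => `|u t| ^+ 2 + `|w t| ^+ 2).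
Proof. exact: integrableDR. Qed.

Let mass_ge0 p q : 0 <= mass p q.
Proof. by apply: Rintegral_ge0 => t _; rewrite mulr_ge0 ?indicE// addr_ge0// exprn_ge0. Qed.

Lemma pairing_self_integrable : integrable (fun t => w t (u t)).
Proof.
apply: (integrable_dom measurableT _ _ uw_integrable); first exact: sm_pairing.
move=> t _; rewrite (le_trans (dual_le _ _))//.
have := sqr_ge0 (`|w t| - `|u t|); have := sqr_ge0 (`|w t|); have := sqr_ge0 `|u t|.
by move: (`|w t|) (`|u t|) => x y; nra.
Qed.

(* a point of [`]p, q[] where [u] is not larger in [V] than its quadratic mean *)
Lemma mean_point p q c : 0 <= p -> p < q -> q <= T -> 0 < c ->
  exists m, [/\ p < m, m < q, good m & (q - p) * `|u m| ^+ 2 <= mass p q + c].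
Proof.
move=> p0 pq qT c0; apply: contrapT => nm.
have lt_u : {ae leb, forall t, \1_(`]p, q[%classic) t * (mass p q + c) <=
    (q - p) * (\1_(`]p, q[%classic) t * (`|u t| ^+ 2 + `|w t| ^+ 2))}.
  apply: aeS ae_good => t gt; rewrite indicE mem_setE.
  case: (boolP (t \in `]p, q[)); last by rewrite !mul0r mulr0.
  rewrite in_itv/= => /andP[pt tq]; rewrite !mul1r.
  apply: (@le_trans _ _ ((q - p) * `|u t| ^+ 2)).
    rewrite leNgt; apply/negP => lt; apply: nm; exists t; split => //; last exact: ltW.
    by apply: gt; rewrite in_itv/= (le_lt_trans p0 pt) (lt_le_trans tq qT).
  by rewrite ler_pM2l ?subr_gt0// lerDl exprn_ge0.
have ii : integrable (fun t => \1_(`]p, q[%classic) t * (`|u t| ^+ 2 + `|w t| ^+ 2)).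
  exact: indic_mul_integrable.
have ic : integrable (\1_(`]p, q[%classic) : R -> R) by exact: integrable_indic_itv.
have := ae_le_Rintegral _ (integrableZlR measurableT (q - p) ii) _ _ lt_u.
rewrite (RintegralZl _ measurableT ii) -/(mass p q).
rewrite (RintegralZr _ measurableT ic) (Rintegral_indic_itv (ltW pq)).
have h1 : integrable (fun t => \1_(`]p, q[%classic) t * (mass p q + c)).
  by apply: eq_integrable (integrable_cst_itv p q (mass p q + c)) => // t _ /=; rewrite mulrC.
move=> /(_ h1).
have h2 t : 0 <= \1_(`]p, q[%classic) t * (mass p q + c).
  by apply: mulr_ge0; [rewrite indicE|apply: addr_ge0; [exact: mass_ge0|exact: ltW]].
have h3 t : 0 <= (q - p) * (\1_(`]p, q[%classic) t * (`|u t| ^+ 2 + `|w t| ^+ 2)).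
  apply: mulr_ge0; first by rewrite subr_ge0 ltW.
  by apply: mulr_ge0; [rewrite indicE|rewrite addr_ge0// exprn_ge0].
move=> /(_ h2 h3); rewrite ler_pM2l ?subr_gt0//.
by rewrite gerDl leNgt c0.
Qed.

(** The energy identity gives the difference of the squared norms, the increment identity tested
    with [u m] gives the cross term. Either endpoint may be the test vector, which lets the one with
    controlled V-norm be used. *)
Lemma sq_dist_endpoint a b m : 0 < a -> a < b -> b < T -> good a -> good b ->
  m = a \/ m = b ->
  `|emb G (u b) - emb G (u a)| ^+ 2 <=
  2 * `|(\int[leb]_t (\1_(`]a, b[%classic) t * w t (u t)))%R| +
  2 * `|(\int[leb]_t (\1_(`[a, b[%classic) t * w t (u m)))%R|.
Proof.
move=> a0 ab bT ga gb mab.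
have eab := good_energy a0 ab bT ga gb.
have iab := @good_increment a b (u m) ga gb.
rewrite (Rintegral_tail_sub (ltW ab) (pairing_integrable sw w1 (u m))) in iab.
rewrite -iab; set X := Rintegral _ _ _ in eab *.
have := ler_norm X; have := ler_norm (- X); rewrite normrN.
case: mab => ->; set Y := inner _ _; have := ler_norm Y; have := ler_norm (- Y); rewrite normrN.
  have := sq_norm_sub (emb G (u b)) (emb G (u a)); rewrite eab -/Y.
  by move: (`|X|) (`|Y|) => x y -> *; lra.
have hY : inner (emb G (u a) - emb G (u b)) (emb G (u b)) = - Y.
  by rewrite /Y !innerBl opprB.
have := sq_norm_sub (emb G (u a)) (emb G (u b)); rewrite hY distrC.
rewrite -(opprB (`|emb G (u b)| ^+ 2)) eab.
by move: (`|X|) (`|Y|) => x y -> *; lra.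
Qed.

(** Both points are compared with a point [m] where (q - p) |u(m)|_V^2 is controlled by the mass, so
    that the cross term with [u m] is too. Each comparison costs 3 masses plus c / 4: one mass from
    the energy identity and two from the cross term; |x - y|^2 <= 2|x|^2 + 2|y|^2 then gives 12. *)
Lemma sq_dist_mass p q c a b : 0 <= p -> q <= T -> 0 < c ->
  p < a < q -> p < b < q -> good a -> good b ->
  `|emb G (u b) - emb G (u a)| ^+ 2 <= 12 * mass p q + c.
Proof.
move=> p0 qT c0 /andP[pa aq] /andP[pb bq] ga gb.
have pq : p < q by exact: lt_trans pa aq.
have c4 : 0 < c / 4 by rewrite divr_gt0.
have [m [pm mq gm um]] := mean_point p0 pq qT c4.
have half x y : p < x -> x < y -> y < q -> good x -> good y -> m = x \/ m = y ->
    `|emb G (u y) - emb G (u x)| ^+ 2 <= 3 * mass p q + c / 4.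
  move=> px xy yq gx gy mxy.
  apply: le_trans (sq_dist_endpoint (le_lt_trans p0 px) xy (lt_le_trans yq qT) gx gy mxy) _.
  have sub1 : `]x, y[%classic `<=` `]p, q[%classic.
    move=> t; rewrite /= !in_itv/= => /andP[xt ty].
    by rewrite (lt_trans px xt) (lt_trans ty yq).
  have sub2 : `[x, y[%classic `<=` `]p, q[%classic.
    move=> t; rewrite /= !in_itv/= => /andP[xt ty].
    by rewrite (lt_le_trans px xt) (lt_trans ty yq).
  have im : integrable (fun t => \1_(`]p, q[%classic) t * (`|u t| ^+ 2 + `|w t| ^+ 2)).
    exact: indic_mul_integrable.
  have i1 : integrable (\1_(`]p, q[%classic) : R -> R) by exact: integrable_indic_itv.
  have b1 : `|(\int[leb]_t (\1_(`]x, y[%classic) t * w t (u t)))%R| <= 2^-1 * mass p q.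
    rewrite /mass -(RintegralZl _ measurableT im).
    apply: le_Rintegral_norm => //.
    - by apply: indic_mul_integrable => //; exact: pairing_self_integrable.
    - exact: (integrableZlR measurableT _ im).
    - move=> t _; rewrite mulrCA; apply: indic_mul_norm_le => //.
      by rewrite (le_trans (dual_le _ _))// half_young.
  have b2 : `|(\int[leb]_t (\1_(`[x, y[%classic) t * w t (u m)))%R| <=
      2^-1 * (mass p q + (q - p) * `|u m| ^+ 2).
    have i2 := integrableZlR measurableT (`|u m| ^+ 2) i1.
    have i3 := integrableDR measurableT im i2.
    rewrite -[q - p](Rintegral_indic_itv (ltW pq)) [_ * `|u m| ^+ 2]mulrC.
    rewrite -(RintegralZl _ measurableT i1) /mass -(RintegralD measurableT im i2).
    rewrite -(RintegralZl _ measurableT i3).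
    apply: le_Rintegral_norm => //.
    - by apply: indic_mul_integrable => //; exact: (pairing_integrable sw w1).
    - exact: (integrableZlR measurableT _ i3).
    - move=> t _; rewrite (mulrC (`|u m| ^+ 2)) -mulrDr mulrCA.
      apply: indic_mul_norm_le => //.
      rewrite (le_trans (dual_le _ _))// (le_trans (half_young _ _))//.
      by rewrite ler_pM2l// [leRHS]addrC lerD2l lerDr exprn_ge0.
  exact: mean_arith b1 b2 um.
have near_m x : p < x -> x < q -> good x -> `|emb G (u x) - emb G (u m)| ^+ 2 <= 3 * mass p q + c / 4.
  move=> px xq gx; have [xm|mx|->] := ltgtP x m.
  - by rewrite distrC; apply: half => //; right.
  - by apply: half => //; left.
  - rewrite subrr normr0 expr0n/=; apply: addr_ge0; [exact: mulr_ge0|exact: ltW].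
have := near_m a pa aq ga; have := near_m b pb bq gb.
have := sq_normB_le (emb G (u b) - emb G (u m)) (emb G (u a) - emb G (u m)).
rewrite opprB addrA subrK => h1 h2 h3.
exact: sq_dist_arith h1 h2 h3.
Qed.

(** Absolute continuity of the integral makes the mass of every short interval at most e^2 / 24, and
    12 e^2 / 24 + e^2 / 2 = e^2. *)
Lemma dist_unif e : 0 < e -> exists2 dlt, 0 < dlt &
  forall a b, 0 < a < T -> 0 < b < T -> good a -> good b -> `|b - a| < dlt ->
    `|emb G (u b) - emb G (u a)| <= e.
Proof.
move=> e0; have e2 : 0 < e ^+ 2 / 2 by rewrite divr_gt0// exprn_gt0.
have e24 : 0 < e ^+ 2 / 24 by rewrite divr_gt0// exprn_gt0.
have [dlt [d0 hd]] := integral_normr_continuous uw_integrable e24.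
have ordered a b : 0 < a < T -> 0 < b < T -> good a -> good b -> a <= b -> b - a < dlt / 3 ->
    `|emb G (u b) - emb G (u a)| <= e.
  move=> /andP[a0 aT] /andP[b0 bT] ga gb ab bad.
  (* Widening by dlt / 3 on each side puts [a] and [b] strictly inside even if they coincide, and
     keeps the length below dlt; clipping stays within [0, T]. *)
  pose p := Num.max 0 (a - dlt / 3); pose q := Num.min T (b + dlt / 3).
  have d3 : 0 < dlt / 3 by rewrite divr_gt0.
  have pa : p < a by rewrite /p gt_max a0 gtrBl.
  have bq : b < q by rewrite /q lt_min bT ltrDl.
  have pq : p < q := lt_trans (lt_le_trans pa ab) bq.
  have mpq : mass p q <= e ^+ 2 / 24.
    rewrite /mass -Rintegral_itv_indic.
    have qp : q - p < dlt.
      have h1 : q <= b + dlt / 3 by rewrite ge_min lexx orbT.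
      have h2 : a - dlt / 3 <= p by rewrite le_max lexx orbT.
      by move: p q h1 h2 {pa bq pq} => p q; lra.
    have lpq : (leb `]p, q[%classic < dlt%:E)%E.
      by rewrite lebesgue_measure_itv/= lte_fin pq -EFinD lte_fin.
    apply: le_trans (ltW (hd _ (measurable_itv _) lpq)).
    apply: le_trans (ler_norm _) _; apply: le_normr_Rintegral => //.
    exact: (integrable_sub (measurable_itv _) uw_integrable).
  have qT : q <= T by rewrite ge_min lexx.
  have p0 : 0 <= p by rewrite le_max lexx.
  have paq : p < a < q by rewrite pa (le_lt_trans ab bq).
  have pbq : p < b < q by rewrite bq (lt_le_trans pa ab).
  have := sq_dist_mass p0 qT e2 paq pbq ga gb.
  move=> h; have {}h := sq_small_arith h mpq.
  by rewrite -(@ler_pXn2r _ 2)// nnegrE// ltW.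
exists (dlt / 3) => [|a b aT bT ga gb]; first by rewrite divr_gt0.
have [ab|ba] := leP a b.
  by rewrite ger0_norm ?subr_ge0//; exact: ordered.
move=> bad; rewrite distrC; apply: ordered => //; first exact: ltW.
by move: bad; rewrite distrC gtr0_norm// subr_gt0.
Qed.

End continuous_representative.

(** * Continuous representatives *)

Section uniform_extension.
Context {R : realType} {H : completeNormedModType R}.
Variables (f : R -> H) (N : R -> Prop) (T : R).
Hypothesis N_dense : forall t r : R, 0 <= t <= T -> 0 < r ->
  exists2 a, N a & `|a - t| < r.
Hypothesis f_unif : forall e : R, 0 < e -> exists2 dlt : R, 0 < dlt &
  forall a b, N a -> N b -> `|b - a| < dlt -> `|f b - f a| <= e.

(** The point [a = t] is allowed when [t] is in [N], which is why the extension agrees with [f] on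
    [N]. *)
Let limit_at t (y : H) := forall e : R, 0 < e -> exists2 dlt : R, 0 < dlt &
  forall a, N a -> `|a - t| < dlt -> `|f a - y| <= e.

(** Density makes the trace of the neighbourhoods of [t] on [N] a proper filter, uniform continuity
    makes its image Cauchy, and [H] is complete. *)
Lemma limit_at_exists t : 0 <= t <= T -> exists y, limit_at t y.
Proof.
move=> tT; pose F := within N (nbhs t).
have FP : ProperFilter F.
  apply: Build_ProperFilter_ex.
  move=> A; rewrite /F /within/= => /nbhs_ballP[r /= r0 hr].
  have [a Na at_] := N_dense tT r0.
  by exists a; apply: hr => //; rewrite -ball_normE/= distrC.
have near_F (dlt : R) : 0 < dlt -> F (fun a => N a /\ `|a - t| < dlt).
  move=> d0; apply/nbhs_ballP; exists dlt => // a; rewrite -ball_normE/= distrC.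
  by split.
have : cvg (f @ F).
  apply: cauchy_cvg; apply: cauchy_exP => e e0.
  have e2 : 0 < e / 2 by rewrite divr_gt0.
  have [dlt d0 hd] := f_unif e2.
  have d2 : 0 < dlt / 2 by rewrite divr_gt0.
  have [a Na at_] := N_dense tT d2.
  exists (f a); rewrite /fmap/=; apply: filterS (near_F _ d2) => b [Nb bt].
  rewrite -ball_normE/= distrC (@le_lt_trans _ _ (e / 2))//; last by rewrite ltr_pdivrMr// ltr_pMr// ltr1n.
  apply: hd => //; rewrite (splitr dlt) -(subrKA t) (le_lt_trans (ler_normD _ _))//.
  by rewrite ltrD// distrC.
move=> /cvg_ex[y Fy]; exists y => e e0.
have /cvgrPdist_le/(_ e e0) := Fy.
rewrite /F /within/= => /nbhs_ballP[r /= r0 hr]; exists r => // a Na at_.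
by rewrite distrC; apply: hr => //; rewrite -ball_normE/= distrC.
Qed.

Lemma uniform_extension : exists c : R -> H, {within `[0, T], continuous c} /\
  forall t, 0 <= t <= T -> N t -> c t = f t.
Proof.
pose c t := xget 0 (limit_at t).
have cP t : 0 <= t <= T -> limit_at t (c t).
  by move=> tT; rewrite /c; case: xgetP => // nl; have [y /nl] := limit_at_exists tT.
exists c; split; last first.
  move=> t tT Nt; apply/eqP; rewrite -subr_eq0 -normr_le0; apply/ler_addgt0Pl => e e0.
  have [dlt d0 hd] := cP t tT e e0.
  by rewrite addr0 distrC; apply: hd => //; rewrite subrr normr0.
apply/subspace_continuousP => t; rewrite /= in_itv/= => tT.
apply/cvgrPdist_le => e e0.
have e3 : 0 < e / 3 by rewrite divr_gt0.
have [dlt d0 hd] := f_unif e3.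
have [d1 d10 hd1] := cP t tT _ e3.
have d3 : 0 < dlt / 3 by rewrite divr_gt0.
have m1 : 0 < Num.min d1 (dlt / 3) by rewrite lt_min d10.
rewrite /within/=; apply: (filterS _ (nbhsx_ballx t _ d3)) => s.
rewrite -ball_normE/= => st; rewrite in_itv/= => sT.
have [d2 d20 hd2] := cP s sT _ e3.
have m2 : 0 < Num.min d2 (dlt / 3) by rewrite lt_min d20.
have [a Na] := N_dense tT m1; rewrite lt_min => /andP[ad1 ad].
have [b Nb] := N_dense sT m2; rewrite lt_min => /andP[bd2 bd].
have h1 := hd1 a Na ad1; have h2 := hd2 b Nb bd2.
have h3 : `|f b - f a| <= e / 3.
  apply: hd => //.
  have -> : b - a = (b - s) - (a - t) - (t - s) by ring.
  apply: le_lt_trans (ler_normB _ _) _.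
  have h4 := ler_normB (b - s) (a - t).
  by move: (`|_|) (`|_|) (`|_|) (`|_|) ad bd st h4 => *; lra.
have -> : c t - c s = (f b - c s) - (f b - f a) - (f a - c t).
  by rewrite !opprB [RHS]addrC (addrC (f b - c s)) addrA !subrKA.
apply: le_trans (ler_normB _ _) _.
have h5 := ler_normB (f b - c s) (f b - f a).
by move: (`|_|) (`|_|) (`|_|) (`|_|) h1 h2 h3 h5 => *; lra.
Qed.

End uniform_extension.

(** * Weighted energy inequality *)

Section weighted_energy.
Context {R : realType} {V H : hilbertType R} (G : gelfandTriple V H).
Local Notation leb := (@lebesgue_measure R).
Local Notation integrable f := (leb.-integrable setT (EFin \o f)).
Local Notation sm f := (strongly_measurable (setT : set (measurableTypeR R)) f).

Lemma exp_weight_integral (beta s b : R) : s < b ->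
  (\int[leb]_(t in `[s, b]) (2 * beta * expR (- (2 * beta * t))))%R =
  expR (- (2 * beta * s)) - expR (- (2 * beta * b)).
Proof.
move=> sb.
pose F t : R := - expR (- (2 * beta * t)).
have dF (x : R) : is_derive x 1 F (2 * beta * expR (- (2 * beta * x))).
  have d1 : is_derive x 1 (fun t : R => - (2 * beta * t)) (- (2 * beta)).
    by apply: is_derive_eq; rewrite /GRing.scale/= mulr1.
  apply: (is_derive_eq (is_deriveN (@is_derive1_comp R expR (fun t : R => - (2 * beta * t)) x _ _ (is_derive_expR _) d1))).
  by rewrite mulrN opprK mulrC.
have cexp : continuous (fun t : R => 2 * beta * expR (- (2 * beta * t))).
  move=> x; apply: cvgMr.
  apply: (@cvg_comp _ _ _ (fun t : R => - (2 * beta * t)) expR); last exact: continuous_expR.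
  by apply: cvgN; apply: cvgMr; exact: cvg_id.
have cF : continuous F.
  by move=> x; apply/differentiable_continuous/derivable1_diffP; have [] := dF x.
have dOO : derivable_oo_LRcontinuous F s b.
  split; [by move=> x _; have [] := dF x|exact: cvg_at_right_filter (cF s)|exact: cvg_at_left_filter (cF b)].
have dFE : {in `]s, b[, derive1 F =1 (fun t => 2 * beta * expR (- (2 * beta * t)))}.
  by move=> x _; rewrite derive1E; have [] := dF x.
have h := continuous_FTC2 sb (continuous_subspaceT cexp) dOO dFE.
by rewrite /Rintegral h /= /F opprK addrC.
Qed.

Variables (u : R -> V) (w : R -> dual V).
Hypotheses (su : sm u) (sw : sm w).
Hypotheses (u2 : integrable (fun t => `|u t| ^+ 2)) (w2 : integrable (fun t => `|w t| ^+ 2)).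
Variables (T : R) (good : R -> Prop).
Hypothesis T_gt0 : 0 < T.
Hypothesis ae_good : {ae leb, forall t, t \in `]0, T[ -> good t}.
Hypothesis good_energy : forall a b : R, 0 < a -> a < b -> b < T -> good a -> good b ->
  `|emb G (u b)| ^+ 2 - `|emb G (u a)| ^+ 2 =
  2 * (\int[leb]_t (\1_(`]a, b[%classic) t * w t (u t)))%R.
Hypothesis small_at0 : forall e : R, 0 < e -> exists2 dlt : R, 0 < dlt &
  forall a, 0 < a -> a < dlt -> a < T -> good a -> `|emb G (u a)| ^+ 2 <= e.

Let wu_integrable : integrable (fun t => w t (u t)).
Proof. exact: pairing_self_integrable. Qed.

(** The identity holds only from positive good times; it is used from a good [a] so close to 0 that
    the energy at [a] and the pairing integrated over (0, a) are both at most e / 4. *)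
Lemma energy_from0 (b : R) : 0 < b -> b < T -> good b ->
  `|emb G (u b)| ^+ 2 <= 2 * (\int[leb]_t (\1_(`]0, b]%classic) t * w t (u t)))%R.
Proof.
move=> b0 bT gb; apply/ler_addgt0Pl => e e0.
have e2 : 0 < e / 4 by rewrite divr_gt0.
have [d1 d10 hd1] := small_at0 e2.
have [d2 [d20 hd2]] := integral_normr_continuous wu_integrable e2.
have bm : 0 < Num.min b (Num.min d1 d2) by rewrite !lt_min b0 d10 d20.
have [a [a0 am ga]] := ae_itv_exists bm ae_good.
move: am; rewrite !lt_min => /and3P[ab ad1 ad2].
have aT : a < T := lt_trans ab bT.
have {}ga : good a by apply: ga; rewrite in_itv/= a0.
have ea := hd1 a a0 ad1 aT ga.
have lea : (leb `]0%R, a[%classic < d2%:E)%E.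
  by rewrite lebesgue_measure_itv/= lte_fin a0 sube0 lte_fin.
have int_a := hd2 _ (measurable_itv _) lea.
have eab := good_energy a0 ab bT ga gb.
have Ii (x y : R) : integrable (fun t => \1_(`]x, y[%classic) t * w t (u t)).
  exact: indic_mul_integrable.
have split_int : (\int[leb]_t (\1_(`]0, b]%classic) t * w t (u t)))%R =
    (\int[leb]_(t in `]0, a[) w t (u t))%R + (\int[leb]_t (\1_(`]a, b[%classic) t * w t (u t)))%R.
  rewrite Rintegral_itv_indic -RintegralD//.
  apply: ae_eq_Rintegral; first exact: indic_mul_integrable.
    by apply: integrableDR.
  exists [set a; b]; split.
  - exact: measurableU.
  - by apply: null_set_setU => //; exact: lebesgue_measure_set1.
  move=> t ne; apply: contrapT => tab; apply: ne => /=.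
  have [ta tb] : t != a /\ t != b by split; apply/eqP => te; apply: tab; rewrite te; [left|right].
  rewrite -mulrDl !indicE !mem_setE !in_itv/=; congr (_ * _).
  rewrite le_eqVlt (negbTE tb)/=; case: (ltgtP t a) ta => // ta _ /=.
    by rewrite (lt_trans ta ab) !andbT addr0.
  by rewrite (lt_trans a0 ta)/= add0r.
have int_a' : `|(\int[leb]_(t in `]0, a[) w t (u t))%R| <= e / 4.
  apply: le_trans (ltW int_a); apply: le_normr_Rintegral => //.
  exact: (integrable_sub (measurable_itv _) wu_integrable).
rewrite split_int; move: int_a'; rewrite ler_norml => /andP[h1 h2].
move: eab ea h1 h2; move: (Rintegral _ _ _) (Rintegral _ _ _) => x y.
by move: (`|_| ^+ 2) (`|_| ^+ 2) => z v; lra.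
Qed.

(** The weight is introduced by Fubini on the triangle instead of a product rule. The nonnegative
    quantity that is discarded is the double integral dominating the integral of 2 beta e^{-2 beta
    t} |u(t)|^2. *)
Lemma weighted_energy_le (beta b : R) : 0 <= beta -> 0 < b -> b < T -> good b ->
  expR (- (2 * beta * b)) * `|emb G (u b)| ^+ 2 <=
  2 * (\int[leb]_t (\1_(`]0, b[%classic) t * (expR (- (2 * beta * t)) * w t (u t))))%R.
Proof.
move=> beta0 b0 bT gb.
pose wt t : R := expR (- (2 * beta * t)).
have mwt : measurable_fun (setT : set (measurableTypeR R)) wt.
  apply: continuous_measurable_fun => x.
  apply: (@cvg_comp _ _ _ (fun t : R => - (2 * beta * t)) expR); last exact: continuous_expR.
  by apply: cvgN; apply: cvgMr; exact: cvg_id.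
have wt0 t : 0 <= wt t by exact: expR_ge0.
(* On (0, b), [f] is the derivative of -e^{-2 beta t} and [g] is twice the pairing, the density of
   the energy. Integrating [f] over [s, b] gives the weight at [s] minus the weight at [b]. *)
pose f t := \1_(`]0, b[%classic) t * (2 * beta * wt t).
pose g t := 2 * (\1_(`]0, b[%classic) t * w t (u t)).
have bwt t : t \in `]0, b[ -> wt t <= 1.
  rewrite in_itv/= => /andP[t0 _]; rewrite -expR0 ler_expR oppr_le0.
  by rewrite !mulr_ge0// ltW.
have fi : integrable f.
  apply: (integrable_dom measurableT _ _ (integrable_cst_itv 0 b (2 * beta))).
    by apply: measurable_funM; [exact: measurable_indic|apply: measurable_funM => //; exact: measurable_cst].
  move=> t _; rewrite /f indicE mem_setE; case: (boolP (t \in `]0, b[)) => tb.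
    rewrite mul1r mulr1 ger0_norm; last by rewrite !mulr_ge0.
    by rewrite ler_piMr ?bwt// mulr_ge0.
  by rewrite mul0r normr0 mulr0.
have ki : integrable (fun t => \1_(`]0, b[%classic) t * w t (u t)) by exact: indic_mul_integrable.
have gi : integrable g by exact: integrableZlR.
have [i1 i2 eq12] := triangle_fubini fi gi.
(* The inner integral is at least |u(t)|^2 at almost every time in (0, b). *)
have lhs_ge0 : 0 <= (\int[leb]_t (f t * (\int[leb]_(s in `]-oo, t]) g s)%R))%R.
  have i1n : integrable (fun t => `|f t * (\int[leb]_(s in `]-oo, t]) g s)%R|) by exact: (integrable_norm i1).
  rewrite (ae_eq_Rintegral i1 i1n).
  - exact: Rintegral_ge0.
  - apply: aeS ae_good => t gt; rewrite ger0_norm//.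
    rewrite /f indicE mem_setE; case: (boolP (t \in `]0, b[)) => [tb|_]; last by rewrite !mul0r.
    apply: mulr_ge0; first by rewrite mul1r !mulr_ge0.
    have /andP[t0 tb'] : 0 < t < b by move: tb; rewrite in_itv.
    have tT : t < T := lt_trans tb' bT.
    have {}gt : good t by apply: gt; rewrite in_itv/= t0.
    apply: (@le_trans _ _ (`|emb G (u t)| ^+ 2)); first exact: exprn_ge0.
    apply: (le_trans (energy_from0 t0 tT gt)).
    have it : integrable (fun s => \1_(`]0, t]%classic) s * w s (u s)) by exact: indic_mul_integrable.
    rewrite (Rintegral_patch `]-oo, t]) -(RintegralZl _ measurableT it).
    rewrite le_eqVlt; apply/orP; left; apply/eqP; apply: eq_Rintegral => s _.
    rewrite patchE /g !indicE !mem_setE !in_itv/=.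
    case: (leP s t) => st; last by rewrite andbF mul0r mulr0.
    by rewrite andbT (le_lt_trans st tb') andbT.
have GE s : s \in `]0, b[ -> (\int[leb]_(t in `[s, +oo[) f t)%R = wt s - wt b.
  rewrite in_itv/= => /andP[s0 sb]; rewrite -(exp_weight_integral beta sb).
  rewrite [LHS]Rintegral_patch [RHS]Rintegral_patch.
  apply: ae_eq_Rintegral.
  - exact: (integrable_patch f (measurable_itv _)).1 (integrable_sub (measurable_itv _) fi).
  - apply/(integrable_patch _ (measurable_itv _)).
    apply: continuous_compact_integrable; first exact: segment_compact.
    apply: continuous_subspaceT => x; apply: cvgMr.
    apply: (@cvg_comp _ _ _ (fun t : R => - (2 * beta * t)) expR); last exact: continuous_expR.
    by apply: cvgN; apply: cvgMr; exact: cvg_id.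
  exists [set b]; split; [exact: measurable_set1|exact: lebesgue_measure_set1|].
  move=> t ne; apply: contrapT => /eqP tb; apply: ne => /=.
  rewrite !patchE !mem_setE !in_itv/= andbT /f indicE mem_setE in_itv/= [t <= b]le_eqVlt (negbTE tb)/=.
  case: (leP s t) => st //=; rewrite (lt_le_trans s0 st)/=.
  by case: (ltP t b) => _; rewrite ?mul1r ?mul0r.
have wi : integrable (fun t => \1_(`]0, b[%classic) t * (wt t * w t (u t))).
  apply: (integrable_dom measurableT _ _ (integrable_norm ki)).
    apply: measurable_funM; first exact: measurable_indic.
    by apply: measurable_funM => //; exact: sm_pairing.
  move=> t _; rewrite /= indicE mem_setE; case: (boolP (t \in `]0, b[)) => tb.
    by rewrite !mul1r normrM ler_piMl// ger0_norm ?bwt.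
  by rewrite !mul0r normr0.
have rhsE : (\int[leb]_s (g s * (\int[leb]_(t in `[s, +oo[) f t)%R))%R =
    2 * (\int[leb]_t (\1_(`]0, b[%classic) t * (wt t * w t (u t))))%R -
    wt b * (2 * (\int[leb]_t (\1_(`]0, b[%classic) t * w t (u t)))%R).
  rewrite -(RintegralZl 2 measurableT wi) -(RintegralZl 2 measurableT ki) -(RintegralZl (wt b) measurableT gi).
  rewrite -(RintegralB measurableT (integrableZlR measurableT 2 wi) (integrableZlR measurableT (wt b) gi)).
  apply: eq_Rintegral => s _; rewrite /g indicE mem_setE.
  case: (boolP (s \in `]0, b[)) => sb; last by rewrite !mul0r !mulr0 mul0r subrr.
  by rewrite GE// !mul1r; ring.
have eb := energy_from0 b0 bT gb.
have eqK : (\int[leb]_t (\1_(`]0, b]%classic) t * w t (u t)))%R =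
    (\int[leb]_t (\1_(`]0, b[%classic) t * w t (u t)))%R.
  apply: (ae_eq_Rintegral (indic_mul_integrable (measurable_itv _) wu_integrable) ki).
  exists [set b]; split; [exact: measurable_set1|exact: lebesgue_measure_set1|].
  move=> t ne; apply: contrapT => /eqP tb; apply: ne => /=.
  by rewrite !indicE !mem_setE !in_itv/= le_eqVlt (negbTE tb).
rewrite eqK in eb.
apply: (@le_trans _ _ (wt b * (2 * (\int[leb]_t (\1_(`]0, b[%classic) t * w t (u t)))%R))).
  by rewrite ler_wpM2l.
by rewrite -subr_ge0 -rhsE -eq12.
Qed.

End weighted_energy.

(** * The space W *)

Lemma ler_1Dsqr (R : realFieldType) (x : R) : x <= 1 + x ^+ 2.
Proof. by have := sqr_ge0 (x - 2^-1); nra. Qed.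

Section L2_extension.
Context {R : realType} {X : normedModType R}.
Local Notation leb := (@lebesgue_measure R).
Local Notation integrable f := (leb.-integrable setT (EFin \o f)).
Local Notation sm f := (strongly_measurable (setT : set (measurableTypeR R)) f).
Implicit Types (D : set R) (g : R -> X).

(** Extension by zero moves every function to the whole line, where translations and Fubini apply
    without restrictions on domains. *)
Definition ext0 D g : R -> X := fun t => if t \in D then g t else 0.

Lemma ext0E D g t : D t -> ext0 D g t = g t.
Proof. by move=> Dt; rewrite /ext0 mem_set. Qed.

Lemma ext0_out D g t : ~ D t -> ext0 D g t = 0.
Proof. by move=> Dt; rewrite /ext0 memNset. Qed.

Lemma sm_ext0 D g : measurable (D : set (measurableTypeR R)) ->
  strongly_measurable (D : set (measurableTypeR R)) g -> sm (ext0 D g).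
Proof.
move=> mD sg; have := sm_patch mD sg (sm_cst setT 0).
by rewrite setUT.
Qed.

Lemma poweR_half_lty (x : \bar R) : (0 <= x)%E -> (x `^ 2^-1 < +oo)%E -> (x < +oo)%E.
Proof.
case: x => [r _ _|_|//]; first exact: ltry.
by rewrite poweRyr// invr_eq0 pnatr_eq0.
Qed.

Lemma ext0_sq_integrable D g : measurable (D : set (measurableTypeR R)) ->
  strongly_measurable (D : set (measurableTypeR R)) g ->
  (\int[leb]_(t in D) (`|g t| ^+ 2)%:E < +oo)%E -> integrable (fun t => `|ext0 D g t| ^+ 2).
Proof.
move=> mD sg gfin.
have mg : measurable_fun (D : set (measurableTypeR R)) (fun t => `|g t| ^+ 2).
  by apply: measurable_funX; exact: sm_norm.
have gi : leb.-integrable D (EFin \o (fun t => `|g t| ^+ 2)).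
  by apply: ge0_integrable => // t _; exact: exprn_ge0.
have := (integrable_patch _ mD).1 gi; apply: eq_integrable => // t _ /=.
by rewrite patchE /ext0; case: ifP => // _; rewrite normr0 expr0n.
Qed.

Lemma in_L2_ext0 D g : measurable (D : set (measurableTypeR R)) -> in_L2 D g ->
  sm (ext0 D g) /\ integrable (fun t => `|ext0 D g t| ^+ 2).
Proof.
move=> mD [sg gfin]; split; first exact: sm_ext0.
apply: ext0_sq_integrable => //; apply: poweR_half_lty => //.
by apply: integral_ge0 => t _; rewrite lee_fin exprn_ge0.
Qed.

(** On the bounded interval, |g| <= 1 + |g|^2, which is integrable. *)
Lemma norm_integrable_of_sq (a b : R) g : sm g -> integrable (fun t => `|g t| ^+ 2) ->
  (forall t, t \notin `]a, b[ -> g t = 0) -> integrable (fun t => `|g t|).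
Proof.
move=> sg g2 g0.
have i1 := integrableDR measurableT (integrable_indic_itv a b false true) g2.
apply: (integrable_dom measurableT _ _ i1); first exact: sm_norm.
move=> t _; rewrite normr_id; have [tab|tab] := boolP (t \in `]a, b[).
  by rewrite indicE mem_set//=; exact: ler_1Dsqr.
by rewrite g0// normr0 addr_ge0 ?indicE// exprn_ge0.
Qed.

Lemma ge0_integral_ext0 D g (F : R -> X -> \bar R) : (forall t, F t 0 = 0%E) ->
  (\int[leb]_(t in D) F t (g t) = \int[leb]_t F t (ext0 D g t))%E.
Proof.
move=> F0; rewrite integral_mkcond; apply: eq_integral => t _.
by rewrite patchE /ext0; case: ifP.
Qed.

End L2_extension.

(** * Bounds for test functions and the fundamental lemma *)

Section test_functions.
Context {R : realType}.
Local Notation leb := (@lebesgue_measure R).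
Local Notation integrable f := (leb.-integrable setT (EFin \o f)).
Implicit Types phi : R -> R.

Lemma test_continuous (T : R) phi : test_function T phi -> continuous phi.
Proof.
by move=> [dphi _] x; apply/differentiable_continuous/derivable1_diffP; exact: (dphi 0%N).
Qed.

Lemma test_derive (T : R) phi : test_function T phi -> test_function T (derive1 phi).
Proof.
move=> [dphi [a [b [a0 bT phi0]]]]; split.
  by move=> n x; have := dphi n.+1 x; rewrite /derive1n iterSr.
exists a, b; split => // t tab.
have : \forall s \near t, phi s = cst 0 s.
  have oab : open (~` `[a, b]%classic) by apply: closed_openC; exact: interval_closed.
  have : nbhs t (~` `[a, b]%classic).
    by apply: open_nbhs_nbhs; split => //=; exact/negP.
  by apply: filterS => s /= sab; apply: phi0; exact/negP.
by move=> /near_eq_derive h; rewrite derive1E h derive_cst.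
Qed.

Lemma test_bounded (T : R) phi : test_function T phi -> exists M, forall t, `|phi t| <= M.
Proof.
move=> tphi; have cphi := test_continuous tphi; have [_ [a [b [a0 bT phi0]]]] := tphi.
have : compact (phi @` `[a, b]%classic).
  by apply: continuous_compact; [exact: continuous_subspaceT|exact: segment_compact].
move=> /compact_bounded[M [_ hM]].
exists (`|M| + 1) => t; have [tab|tab] := boolP (t \in `[a, b]); last first.
  by rewrite phi0// normr0 addr_ge0.
by apply: (hM (`|M| + 1)); [rewrite ltr_pwDr// ler_norm|exists t].
Qed.

Lemma test_measurable (T : R) phi : test_function T phi ->
  measurable_fun (setT : set (measurableTypeR R)) phi.
Proof. by move=> tphi; apply: continuous_measurable_fun; exact: test_continuous tphi. Qed.

Lemma bump_test (a b T : R) n : 0 < a -> b < T -> test_function T (bump a b n).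
Proof.
move=> a0 bT; split.
  by apply: nsmooth_derivable => m; exact: nsmooth_bump.
exists a, b; split => // t tab; apply: bump_out; apply: contraNN tab.
exact: subset_itv_oo_cc.
Qed.

(** The bumps are test functions converging to indicators of intervals, so the integral of [k] over
    each interval inside (0, T) vanishes. *)
Lemma eq0_of_test (T : R) (k : R -> R) : integrable k ->
  (forall phi, test_function T phi -> (\int[leb]_t (phi t * k t))%R = 0) ->
  {ae leb, forall t, t \in `]0, T[ -> k t = 0}.
Proof.
move=> ki k0; apply: integral_itv_eq0_ae => // a b a0 ab bT.
have := @bump_integral_cvg _ a b k ki.
have -> : (fun n => \int[leb]_t (bump a b n t * k t))%R = cst 0.
  by apply/funext => n; apply: k0; exact: bump_test.
move=> h; have h0 : cst 0 @ \oo --> (0 : R) by exact: cvg_cst.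
exact: (cvg_unique _ h h0).
Qed.

End test_functions.

(** * Weak derivatives with values in the dual *)

Section lions.
Context {R : realType} {V H : hilbertType R} (G : gelfandTriple V H).
Local Notation leb := (@lebesgue_measure R).
Local Notation integrable f := (leb.-integrable setT (EFin \o f)).
Local Notation sm f := (strongly_measurable (setT : set (measurableTypeR R)) f).
Variables (T : R).
Hypothesis T_gt0 : 0 < T.
Local Notation I := (`]0%R, T[%classic : set (measurableTypeR R)).

Let mI : measurable I. Proof. exact: measurable_itv. Qed.

Lemma in_L2_itv (X : normedModType R) (g : R -> X) : in_L2 I g ->
  [/\ sm (ext0 I g), integrable (fun t => `|ext0 I g t| ^+ 2) &
      integrable (fun t => `|ext0 I g t|)].
Proof.
move=> gL2; have [sg g2] := in_L2_ext0 (measurable_itv _) gL2.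
split => //; apply: (norm_integrable_of_sq (a := 0) (b := T) sg g2) => t tI.
by apply: ext0_out => /=; exact/negP.
Qed.

Lemma in_L2_norm_integrable (X : normedModType R) (g : R -> X) : in_L2 I g ->
  leb.-integrable I (EFin \o (fun t => `|g t|)).
Proof.
move=> gL2; have [_ _ g1] := in_L2_itv gL2.
apply: eq_integrable (integrable_sub (measurable_itv _) g1) => // t tI /=.
by rewrite ext0E//; exact: set_mem.
Qed.

(** Turns the Bochner integrals in the definition of the weak derivative into scalar integrals over
    the line; boundedness of [phi] gives the integrability that evaluation at [v] requires. *)
Lemma bochner_test_dual phi (l : R -> dual V) v : test_function T phi -> in_L2 I l ->
  bochner leb I (fun t => phi t *: l t) v = (\int[leb]_t (phi t * ext0 I l t v))%R.
Proof.
move=> tphi lL2; have [M hM] := test_bounded tphi.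
have sphi : strongly_measurable I (phi : measurableTypeR R -> R).
  apply: measurable_sm => //; apply: measurable_funTS; exact: test_measurable tphi.
have sm_l : strongly_measurable I (fun t => phi t *: l t) by apply: sm_scale => //; exact: lL2.1.
rewrite bochnerE//; last first.
  apply: (integrable_dom _ _ _ (integrableZlR _ M (in_L2_norm_integrable lL2))) => //.
    exact: sm_norm.
  by move=> t It; rewrite normr_id normrZ ler_wpM2r.
rewrite Rintegral_patch; apply: eq_Rintegral => t _.
by rewrite patchE /ext0; case: ifP => _; rewrite ?dualZ// dual0E mulr0.
Qed.

Lemma toDual_in_L2 u : in_L2 I u -> in_L2 I (fun t => toDual G (u t)).
Proof.
move=> [su ufin]; have [M M0 hM] := toDual_bounded G.
have st : strongly_measurable I (fun t => toDual G (u t)).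
  by apply: (sm_comp (g := toDual G)) => //; exact: toDual_continuous.
split => //; apply: poweR_lty.
have [sU U2] := in_L2_ext0 (measurable_itv _) (conj su ufin).
have U2I := integrable_sub mI (integrableZlR measurableT (M ^+ 2) U2).
have Ufin := integrable_lty mI U2I.
apply: le_lt_trans Ufin.
apply: ge0_le_integral => //.
- by apply/measurable_EFinP; apply: measurable_funX; exact: sm_norm.
- by case/integrableP : U2I.
- move=> t It; rewrite lee_fin ext0E// -exprMn lerXn2r ?nnegrE//.
  by rewrite mulr_ge0// ltW.
Qed.

Lemma weak_derivative_scalar u w v phi : in_L2 I u -> in_L2 I w ->
  is_weak_derivative G T u w -> test_function T phi ->
  (\int[leb]_t (derive1 phi t * inner (emb G (ext0 I u t)) (emb G v)))%R =
  - (\int[leb]_t (phi t * ext0 I w t v))%R.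
Proof.
move=> uL2 wL2 wd tphi.
have h : bochner leb I (fun t => derive1 phi t *: toDual G (u t)) v =
    - bochner leb I (fun t => phi t *: w t) v.
  exact: (congr1 (fun l : dual V => l v) (wd phi tphi)).
have e1 := bochner_test_dual v (test_derive tphi) (toDual_in_L2 uL2).
have e2 := bochner_test_dual v tphi wL2.
apply: (etrans _ (etrans (esym e1) (etrans h (congr1 -%R e2)))).
apply: eq_Rintegral => t _; congr (_ * _).
by rewrite /ext0; case: ifP => // _; rewrite dual0E raddf0 inner0l.
Qed.

Lemma inner_emb_integrable u v : in_L2 I u ->
  integrable (fun t => inner (emb G (ext0 I u t)) (emb G v)).
Proof.
move=> uL2; have tL2 := toDual_in_L2 uL2; have [st _ t1] := in_L2_itv tL2.
apply: eq_integrable (dual_integrable measurableT v st t1) => // t _ /=.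
by congr EFin; rewrite /ext0; case: ifP => // _; rewrite dual0E raddf0 inner0l.
Qed.

Hypothesis sepV : separable V.

(** Scalar arguments produce one null set per test vector; a dense sequence leaves only countably
    many of them to unite. *)
Lemma dense_sequence : exists v : nat -> V, forall x (e : R), 0 < e ->
  exists n, `|x - v n| < e.
Proof.
have [A cA dA] := sepV; have /countable_injP[h hinj] := cA.
exists (fun k => xget 0 [set y | A y /\ h y = k]) => x e e0.
have [y [/= xy Ay]] : (ball x e `&` A) !=set0.
  by apply: dA; [exists x; exact: ballxx|exact: ball_open].
exists (h y); case: xgetP => [z _ [z1 z2]|/(_ y)[]//].
rewrite (_ : z = y); first by move: xy; rewrite -ball_normE.
by apply: hinj => //; exact: mem_set.
Qed.

Lemma bounded_linear_eq0 (g : V -> R) (C : R) (v : nat -> V) :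
  (forall x (e : R), 0 < e -> exists n, `|x - v n| < e) ->
  (forall x y, g (x - y) = g x - g y) -> (forall x, `|g x| <= C * `|x|) ->
  (forall n, g (v n) = 0) -> forall x, g x = 0.
Proof.
move=> dv gB gC gv x; apply/eqP; rewrite -normr_le0; apply/ler_addgt0Pl => e e0.
rewrite addr0; have C1 : 0 < `|C| + 1 by rewrite ltr_wpDl.
have [n xn] := dv x _ (divr_gt0 e0 C1).
have -> : g x = g (x - v n) by rewrite gB gv subr0.
apply: (le_trans (gC _)); apply: (@le_trans _ _ ((`|C| + 1) * `|x - v n|)).
  by rewrite ler_wpM2r// (le_trans (ler_norm C))// lerDl.
by rewrite mulrC -ler_pdivlMr// ltW.
Qed.

(** For each vector of the dense sequence, the scalar du Bois-Reymond lemma gives a constant and a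
    null set. A time is good if it avoids all these null sets. Subtracting two good times eliminates
    the constants, and the resulting identity is bounded and linear in the test vector, hence
    extends from the sequence to V. *)
Lemma good_points u w : in_L2 I u -> in_L2 I w -> is_weak_derivative G T u w ->
  exists good : R -> Prop, {ae leb, forall t, t \in `]0, T[ -> good t} /\
    forall a b v, good a -> good b ->
      inner (emb G (ext0 I u b) - emb G (ext0 I u a)) (emb G v) =
      (\int[leb]_(s in `[a, +oo[) ext0 I w s v)%R - (\int[leb]_(s in `[b, +oo[) ext0 I w s v)%R.
Proof.
move=> uL2 wL2 wd; have [sw w2 w1] := in_L2_itv wL2.
have [v dv] := dense_sequence.
have wv n : integrable (fun t => ext0 I w t (v n)) by exact: (dual_integrable measurableT (v n) sw w1).
have /choice[c hc] : forall n, exists c, {ae leb, forall t, t \in `]0, T[ ->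
    inner (emb G (ext0 I u t)) (emb G (v n)) = c - (\int[leb]_(s in `[t, +oo[) ext0 I w s (v n))%R}.
  move=> n; apply: (weak_derivative_ae T_gt0 (inner_emb_integrable (v n) uL2) (wv n)).
  by move=> phi; exact: weak_derivative_scalar.
exists (fun t => forall n, inner (emb G (ext0 I u t)) (emb G (v n)) =
  c n - (\int[leb]_(s in `[t, +oo[) ext0 I w s (v n))%R); split.
  by have := ae_foralln hc; apply: aeS => t h tI n; exact: h.
move=> a b x ga gb; apply/eqP; rewrite -subr_eq0; apply/eqP.
pose K t y := (\int[leb]_(s in `[t, +oo[) ext0 I w s y)%R.
have wi t y : leb.-integrable `[t, +oo[ (EFin \o (fun s => ext0 I w s y)).
  exact: (integrable_sub (measurable_itv _) (dual_integrable measurableT y sw w1)).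
have KB t y z : K t (y - z) = K t y - K t z.
  by rewrite /K -RintegralB//; apply: eq_Rintegral => s _; rewrite dual_linB.
pose W := (\int[leb]_t `|ext0 I w t|)%R.
have KC t y : `|K t y| <= W * `|y|.
  rewrite mulrC /W -(RintegralZl _ measurableT w1) /K Rintegral_patch.
  have wyi := integrableZlR measurableT `|y| w1.
  apply: le_Rintegral_norm => //; first exact/(integrable_patch _ (measurable_itv _)).
  move=> s _; rewrite patchE; case: ifP => _; last by rewrite normr0 mulr_ge0.
  by rewrite mulrC dual_le.
have [M M0 hM] := emb_bounded G.
apply: (@bounded_linear_eq0 (fun y => inner (emb G (ext0 I u b) - emb G (ext0 I u a)) (emb G y) -
   (K a y - K b y)) (`|emb G (ext0 I u b) - emb G (ext0 I u a)| * M + (W + W)) v dv).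
- by move=> y z; rewrite raddfB innerBr !KB; ring.
- move=> y; apply: (le_trans (ler_normB _ _)); rewrite mulrDl; apply: lerD.
    by apply: (le_trans (cauchy_schwarz _ _)); rewrite -mulrA ler_wpM2l.
  by apply: (le_trans (ler_normB _ _)); rewrite mulrDl lerD.
- by move=> n; rewrite innerBl ga gb /K; ring.
Qed.

Lemma weak_derivative_uniq u w w' : in_L2 I u -> in_L2 I w -> in_L2 I w' ->
  is_weak_derivative G T u w -> is_weak_derivative G T u w' ->
  {ae leb, forall t, t \in `]0, T[ -> w t = w' t}.
Proof.
move=> uL2 wL2 w'L2 wd wd'.
have [sw w2 w1] := in_L2_itv wL2; have [sw' w2' w1'] := in_L2_itv w'L2.
have [v dv] := dense_sequence.
have h n : {ae leb, forall t, t \in `]0, T[ -> ext0 I w t (v n) - ext0 I w' t (v n) = 0}.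
  have i1 := dual_integrable measurableT (v n) sw w1.
  have i2 := dual_integrable measurableT (v n) sw' w1'.
  apply: eq0_of_test; first exact: integrableBR.
  move=> phi tphi; have [M hM] := test_bounded tphi.
  have mphi := test_measurable tphi.
  have j1 := integrable_bdd_mul mphi hM i1; have j2 := integrable_bdd_mul mphi hM i2.
  have h1 := weak_derivative_scalar (v n) uL2 wL2 wd tphi.
  rewrite (weak_derivative_scalar (v n) uL2 w'L2 wd' tphi) in h1.
  transitivity (\int[leb]_t (phi t * ext0 I w t (v n) - phi t * ext0 I w' t (v n)))%R.
    by apply: eq_Rintegral => t _; rewrite mulrBr.
  by rewrite RintegralB// -[X in X - _]opprK -h1 opprK subrr.
have := ae_foralln h; apply: aeS => t ht tI; apply: dual_ext => x.
apply/eqP; rewrite -subr_eq0 -dualB; apply/eqP.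
apply: (@bounded_linear_eq0 (w t - w' t) `|w t - w' t| v dv).
- by move=> y z; exact: dual_linB.
- by move=> y; exact: dual_le.
- by move=> n; have := ht n tI; rewrite !ext0E.
Qed.

End lions.

(** * The representatives selected by [dt] and [crep] *)

Section representatives.
Context {R : realType} {V H : hilbertType R} (G : gelfandTriple V H).
Local Notation leb := (@lebesgue_measure R).
Local Notation integrable f := (leb.-integrable setT (EFin \o f)).
Local Notation sm f := (strongly_measurable (setT : set (measurableTypeR R)) f).
Variables (T : R).
Hypothesis T_gt0 : 0 < T.
Local Notation I := (`]0%R, T[%classic : set (measurableTypeR R)).

Lemma ae_dense (P : R -> Prop) : {ae leb, forall t, t \in `]0, T[ -> P t} ->
  forall t r : R, 0 <= t <= T -> 0 < r -> exists2 a, 0 < a < T /\ P a & `|a - t| < r.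
Proof.
move=> aeP t r /andP[t0 tT] r0.
have pq : Num.max 0 (t - r) < Num.min T (t + r).
  by rewrite gt_max !lt_min T_gt0 (ltr_wpDl t0 r0)/= ltrBlDr (le_lt_trans tT) ?ltrDl//=; lra.
have [a [pa aq Pa]] := ae_itv_exists pq aeP.
move: pa aq; rewrite gt_max lt_min => /andP[a0 tra] /andP[aT atr].
exists a; first by rewrite a0 aT; split => //; apply: Pa; rewrite in_itv/= a0.
by rewrite ltr_norml; apply/andP; split; lra.
Qed.

(** The times of agreement are dense in the closed interval, endpoints included; this is what gives
    a meaning to the initial value. *)
Lemma continuous_ae_uniq (c c' : R -> H) : {within `[0, T], continuous c} ->
  {within `[0, T], continuous c'} -> {ae leb, forall t, t \in `]0, T[ -> c t = c' t} ->
  forall t, 0 <= t <= T -> c t = c' t.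
Proof.
move=> /subspace_continuousP cc /subspace_continuousP cc' aec t tT.
have It : `[0, T]%classic t by rewrite /= in_itv.
apply/eqP; rewrite -subr_eq0 -normr_le0; apply/ler_addgt0Pl => e e0; rewrite addr0.
have e2 : 0 < e / 2 by rewrite divr_gt0.
have /cvgrPdist_le/(_ _ e2)/nbhs_ballP[r1 /= r10 h1] := cc t It.
have /cvgrPdist_le/(_ _ e2)/nbhs_ballP[r2 /= r20 h2] := cc' t It.
have r0 : 0 < Num.min r1 r2 by rewrite lt_min r10.
have [a [aT ac]] := ae_dense aec tT r0.
rewrite lt_min => /andP[ar1 ar2].
have Ia : `[0, T]%classic a by move: aT => /andP[a0 aT]; rewrite /= in_itv/= !ltW.
have k1 : `|c t - c a| <= e / 2 by apply: h1 => //; rewrite -ball_normE/= distrC.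
have k2 : `|c' t - c' a| <= e / 2 by apply: h2 => //; rewrite -ball_normE/= distrC.
rewrite (splitr e) -(subrKA (c a)) (le_trans (ler_normD _ _))// lerD//.
by rewrite ac distrC.
Qed.

Hypothesis sepV : separable V.

(** The good times are dense in [0, T] and the embedded trajectory is uniformly continuous along
    them, so it extends continuously. The energy identity is returned on the same good times for
    later use. *)
Lemma lions (u : R -> V) (w : R -> dual V) : in_L2 I u -> in_L2 I w ->
  is_weak_derivative G T u w ->
  exists (c : R -> H) (good : R -> Prop),
  [/\ {within `[0, T], continuous c}, {ae leb, forall t, t \in `]0, T[ -> good t},
    forall t, t \in `]0, T[ -> good t -> emb G (u t) = c t &
    forall a b : R, 0 < a -> a < b -> b < T -> good a -> good b ->
      `|emb G (ext0 I u b)| ^+ 2 - `|emb G (ext0 I u a)| ^+ 2 =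
      2 * (\int[leb]_t (\1_(`]a, b[%classic) t * ext0 I w t (ext0 I u t)))%R].
Proof.
move=> uL2 wL2 wd.
have [su u2 u1] := in_L2_itv uL2; have [sw w2 w1] := in_L2_itv wL2.
have [good [ae_good good_inc]] := good_points T_gt0 sepV uL2 wL2 wd.
have [good' [ae_good' good'P good_en]] := energy_identity su sw u2 w2 w1 ae_good good_inc.
have inc' a b v : good' a -> good' b -> _ := fun ga gb => good_inc a b v (good'P a ga) (good'P b gb).
pose N t := (0 < t < T) /\ good' t.
have [c [cc cN]] : exists c : R -> H, {within `[0, T], continuous c} /\
    forall t, 0 <= t <= T -> N t -> c t = emb G (ext0 I u t).
  apply: uniform_extension; first exact: ae_dense.
  move=> e e0; have [dlt d0 hd] := dist_unif su sw u2 w2 w1 ae_good' inc' good_en e0.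
  by exists dlt => // a b [aT ga] [bT gb]; exact: hd.
exists c, good'; split => // t tI gt.
have tT : 0 < t < T by move: tI; rewrite in_itv.
by rewrite cN// ?ext0E//; move: tT => /andP[t0 tT]; rewrite !ltW.
Qed.

Lemma dtP (u : R -> V) : in_W G T u -> is_dt G T u (dt G T u).
Proof. by move=> [_ [w wP]]; rewrite /dt; case: xgetP => // /(_ w). Qed.

Lemma crepP (u : R -> V) : in_W G T u ->
  {within `[0, T], continuous (crep G T u)} /\
  {ae leb, forall t, t \in `]0, T[ -> emb G (u t) = crep G T u t}.
Proof.
move=> uW; have [wL2 wd] := dtP uW.
have [c [good [cc ae_good cE _]]] := lions uW.1 wL2 wd.
rewrite /crep; case: xgetP => [c' _ //|/(_ c)[]].
by split => //; apply: aeS ae_good => t gt tI; exact: cE (gt tI).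
Qed.

Lemma crep_unique (u : R -> V) (c : R -> H) : in_W G T u ->
  {within `[0, T], continuous c} -> {ae leb, forall t, t \in `]0, T[ -> emb G (u t) = c t} ->
  forall t, 0 <= t <= T -> crep G T u t = c t.
Proof.
move=> uW cc aec; have [cu aeu] := crepP uW.
apply: continuous_ae_uniq => //.
by apply: aeS (aeI aeu aec) => t [h1 h2] tI; rewrite -h1// h2.
Qed.

Lemma dt_unique (u : R -> V) (w : R -> dual V) : in_W G T u -> is_dt G T u w ->
  {ae leb, forall t, t \in `]0, T[ -> dt G T u t = w t}.
Proof.
move=> uW [wL2 wd]; have [wL2' wd'] := dtP uW.
exact: (weak_derivative_uniq sepV uW.1 wL2' wL2 wd' wd).
Qed.

Lemma in_L2B (X : normedModType R) (f g : R -> X) : in_L2 I f -> in_L2 I g ->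
  in_L2 I (f \- g).
Proof.
move=> fL2 gL2; have [sf f2 _] := in_L2_itv fL2; have [sg g2 _] := in_L2_itv gL2.
have sfg : strongly_measurable I (f \- g).
  by apply: sm_sub_fun; [exact: fL2.1|exact: gL2.1].
split => //; apply: poweR_lty.
have mI : measurable I by exact: measurable_itv.
have fg2 := sq_integrableB sf sg f2 g2.
apply: le_lt_trans (integrable_lty mI (integrable_sub mI fg2)).
rewrite le_eqVlt; apply/orP; left; apply/eqP; apply: eq_integral => t tI.
by rewrite /= !ext0E//; exact: set_mem.
Qed.

Lemma is_dtB (u u' : R -> V) (w w' : R -> dual V) : in_L2 I u -> in_L2 I u' ->
  is_dt G T u w -> is_dt G T u' w' -> is_dt G T (u \- u') (w \- w').
Proof.
move=> uL2 u'L2 [wL2 wd] [w'L2 wd']; split; first exact: in_L2B.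
move=> phi tphi; apply: dual_ext => v.
have uu'L2 := in_L2B uL2 u'L2; have ww'L2 := in_L2B wL2 w'L2.
have td := test_derive tphi.
have e1 := bochner_test_dual v td (toDual_in_L2 G uu'L2).
have e2 := bochner_test_dual v tphi ww'L2.
have [M hM] := test_bounded tphi; have [M' hM'] := test_bounded td.
have mphi := test_measurable tphi; have mdphi := test_measurable td.
have bi (l : R -> dual V) : in_L2 I l -> integrable (fun t => ext0 I l t v).
  by move=> lL2; have [sl _ l1] := in_L2_itv lL2; exact: (dual_integrable measurableT v sl l1).
have i1 := integrable_bdd_mul mphi hM (bi _ wL2).
have i2 := integrable_bdd_mul mphi hM (bi _ w'L2).
have j1 := integrable_bdd_mul mdphi hM' (bi _ (toDual_in_L2 G uL2)).
have j2 := integrable_bdd_mul mdphi hM' (bi _ (toDual_in_L2 G u'L2)).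
have h (a : R -> V) (l : R -> dual V) : in_L2 I a -> in_L2 I l -> is_weak_derivative G T a l ->
    (\int[leb]_t (derive1 phi t * ext0 I (fun t => toDual G (a t)) t v))%R =
    - (\int[leb]_t (phi t * ext0 I l t v))%R.
  move=> aL2 lL2 al.
  have k : bochner leb I (fun t => derive1 phi t *: toDual G (a t)) v =
      - bochner leb I (fun t => phi t *: l t) v.
    exact: (congr1 (fun l : dual V => l v) (al phi tphi)).
  have f1 := bochner_test_dual v td (toDual_in_L2 G aL2).
  have f2 := bochner_test_dual v tphi lL2.
  exact: (etrans (esym f1) (etrans k (congr1 -%R f2))).
apply: (etrans e1); apply: (etrans _ (congr1 -%R (esym e2))).
transitivity (\int[leb]_t (derive1 phi t * ext0 I (fun t => toDual G (u t)) t v -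
    derive1 phi t * ext0 I (fun t => toDual G (u' t)) t v))%R.
  apply: eq_Rintegral => t _; rewrite /ext0; case: ifP => _; last by rewrite !dual0E !mulr0 subrr.
  by rewrite !toDualE raddfB innerBl mulrBr.
transitivity (- (\int[leb]_t (phi t * ext0 I w t v - phi t * ext0 I w' t v))%R); last first.
  congr (- _); apply: eq_Rintegral => t _; rewrite /ext0.
  by case: ifP => _; [rewrite -mulrBr|rewrite !dual0E !mulr0 subrr].
rewrite (RintegralB measurableT j1 j2) (RintegralB measurableT i1 i2).
by rewrite (h u w)// (h u' w')// opprB opprK addrC.
Qed.

Lemma in_WB (u u' : R -> V) : in_W G T u -> in_W G T u' -> in_W G T (u \- u').
Proof.
move=> uW u'W; split; first exact: (in_L2B uW.1 u'W.1).
by exists (dt G T u \- dt G T u'); apply: is_dtB; [exact: uW.1|exact: u'W.1|exact: dtP|exact: dtP].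
Qed.

Lemma crepB (u u' : R -> V) : in_W G T u -> in_W G T u' ->
  forall t, 0 <= t <= T -> crep G T (u \- u') t = crep G T u t - crep G T u' t.
Proof.
move=> uW u'W; have [c1 a1] := crepP uW; have [c2 a2] := crepP u'W.
apply: (@crep_unique (u \- u') (fun t => crep G T u t - crep G T u' t) (in_WB uW u'W)).
- by move=> t; apply: cvgB; [exact: c1|exact: c2].
- apply: aeS (aeI a1 a2) => t [h1 h2] tI; rewrite -(h1 tI) -(h2 tI); exact: raddfB.
Qed.

End representatives.

(** * Convolution with a measure *)

Section convolution.
Context {R : realType}.
Local Notation leb := (@lebesgue_measure R).
Local Notation mR := (measurableTypeR R).
Variables (M : {finite_measure set mR -> \bar R}) (K : set mR).
Hypothesis mK : measurable K.
Variables (p q : R -> R).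
Hypotheses (mp : measurable_fun (setT : set mR) p) (mq : measurable_fun (setT : set mR) q).
Hypotheses (p0 : forall s, 0 <= p s) (q0 : forall t, 0 <= q t).

Let Q (z : mR * mR) : \bar R := (\1_K z.2 * (p z.2 * q (z.1 - z.2)))%:E.

Let mQ : measurable_fun setT Q.
Proof.
apply/measurable_EFinP; apply: measurable_funM.
  by apply: (measurableT_comp (f := (\1_K : mR -> R))) => //.
apply: measurable_funM; first exact: (measurableT_comp mp).
apply: (measurableT_comp mq).
by apply: measurable_funB; [exact: measurable_fst|exact: measurable_snd].
Qed.

Let Q0 z : (0 <= Q z)%E.
Proof. by rewrite lee_fin mulr_ge0// mulr_ge0. Qed.

Let QE : (fun t => \int[M]_(s in K) (p s * q (t - s))%:E)%E = fubini_F M Q.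
Proof.
apply/funext => t; rewrite /fubini_F [LHS]integral_mkcond.
apply: eq_integral => s _; rewrite /Q /patch indicE /=.
by case: (s \in K); rewrite ?mul1r ?mul0r.
Qed.

Lemma convolution_measurable :
  measurable_fun (setT : set mR) (fun t => \int[M]_(s in K) (p s * q (t - s))%:E)%E.
Proof. by rewrite QE; apply: measurable_fun_fubini_tonelli_F. Qed.

(** Tonelli brings the time integral inside, where translation invariance removes the shift by
    [s]. *)
Lemma convolution_integral :
  (\int[leb]_t \int[M]_(s in K) (p s * q (t - s))%:E =
   (\int[M]_(s in K) (p s)%:E) * \int[leb]_t (q t)%:E)%E.
Proof.
have -> : (\int[leb]_t \int[M]_(s in K) (p s * q (t - s))%:E)%E = (\int[leb]_t fubini_F M Q t)%E.
  by apply: eq_integral => t _; rewrite -QE.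
have mqE : measurable_fun (setT : set mR) (EFin \o q) by apply/measurable_EFinP.
rewrite fubini_tonelli// -ge0_integralZr//; first last.
- by apply: integral_ge0 => t _; rewrite lee_fin.
- by move=> s _; rewrite lee_fin.
- by apply/measurable_EFinP; exact: (measurable_funS measurableT).
rewrite [RHS]integral_mkcond.
apply: eq_integral => s _; rewrite /fubini_G /patch /=.
under eq_integral => t _ do rewrite /Q /= indicE.
case: (s \in K) => /=; last by under eq_integral do rewrite mul0r; rewrite integral0.
under eq_integral do rewrite mul1r EFinM.
rewrite ge0_integralZl//; first last.
- by rewrite lee_fin.
- by move=> t _; rewrite lee_fin.
- by apply/measurable_EFinP; apply: (measurableT_comp mq); apply: measurable_funB => //; exact: measurable_cst.
congr (_ * _)%E.
by have := @ge0_integral_shift R (- s) (EFin \o q) mqE (fun t => q0 t : (0 <= (q t)%:E)%E).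
Qed.

End convolution.

Section bochner_convolution.
Context {R : realType} {V : normedModType R}.
Local Notation mR := (measurableTypeR R).
Variables (m : {finite_measure set mR -> \bar R}) (K : set mR).
Hypothesis mK : measurable K.
Implicit Types (F s : R -> dual V).

Let mS : measurable_fun setT (fun z : mR * mR => z.1 - z.2 : mR).
Proof. by apply: measurable_funB; [exact: measurable_fst|exact: measurable_snd]. Qed.

Lemma reflect_measurable (t : R) : measurable_fun (setT : set mR) (fun r : mR => t - r : mR).
Proof. by apply: measurable_funB => //; exact: measurable_cst. Qed.

Lemma sm_reflect (X : normedModType R) (F : R -> X) t :
  strongly_measurable (setT : set mR) F -> strongly_measurable K (fun r => F (t - r)).
Proof. by move=> sF; apply: (sm_precomp (reflect_measurable t) _ sF). Qed.

Lemma sm_sum (X : normedModType R) (I : Type) (r : seq I) (f : I -> R -> X) :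
  (forall i, strongly_measurable (setT : set mR) (f i)) ->
  strongly_measurable (setT : set mR) (fun t => \sum_(i <- r) f i t).
Proof.
move=> sf; elim: r => [|i r IH].
  by apply: (sm_eq (f := cst 0)); [move=> t _; rewrite big_nil|exact: sm_cst].
by apply: (sm_eq (f := fun t => f i t + \sum_(j <- r) f j t)); [move=> t _; rewrite big_cons|apply: sm_add => //; exact: sf].
Qed.

(** Reflection and translation do not change the range of [s], so the sum has the same finite index
    set for all [t]. Its coefficients are measures of sections of a measurable plane set, hence
    measurable in [t]. *)
Lemma sm_simple_convolution s : simple_fun (s : mR -> dual V) ->
  strongly_measurable (setT : set mR) (fun t => simple_integral m K (fun r => s (t - r))).
Proof.
move=> [fs ms].
have rE t : range (fun r => s (t - r)) = range s.
  apply/seteqP; split => [_ [r _ <-]|_ [r _ <-]]; first by exists (t - r).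
  by exists (t - r) => //; congr s; rewrite opprB addrC subrK.
pose A (x : dual V) : set (mR * mR) := [set z | K z.2 /\ s (z.1 - z.2) = x].
have mA x : measurable (A x).
  have -> : A x = (snd @^-1` K) `&` ((fun z : mR * mR => z.1 - z.2 : mR) @^-1` (s @^-1` [set x])) by [].
  apply: measurableI.
    by rewrite -[X in measurable X]setTI; exact: measurable_snd.
  by rewrite -[X in measurable X]setTI; exact: mS.
apply: (sm_eq (f := fun t => \sum_(x <- fset_set (range s)) fine (m (xsection (A x) t)) *: x)).
  move=> t _; rewrite /simple_integral rE fsbig_finite//; apply: eq_bigr => x _.
  by congr (fine (m _) *: _); apply/seteqP; split => r; rewrite /xsection /= ?inE; [move=> /set_mem|move=> ?; apply/mem_set].
apply: sm_sum => x; apply: sm_scale; last exact: sm_cst.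
apply: measurable_sm => //; apply: measurableT_comp => //.
exact: measurable_fun_xsection.
Qed.

Lemma simple_convolution_cvg F (s : nat -> R -> dual V) t :
  strongly_measurable (setT : set mR) F -> (forall n, simple_fun (s n : mR -> dual V)) ->
  (forall t, s n t @[n --> \oo] --> F t) ->
  (forall n t, `|s n t| <= 2 * `|F t| /\ `|F t - s n t| <= `|F t|) ->
  m.-integrable K (EFin \o (fun r => `|F (t - r)|)) ->
  simple_integral m K (fun r => s n (t - r)) @[n --> \oo] --> bochner m K (fun r => F (t - r)).
Proof.
move=> sF ss cs bs iF.
have sFt := sm_reflect t sF.
have sst n : simple_fun (fun r : mR => s n (t - r)) by exact: (simple_precomp (reflect_measurable t)).
have smst n : strongly_measurable (setT : set mR) (fun r => s n (t - r)).
  by exists (fun _ => fun r => s n (t - r)) => // r _; exact: cvg_cst.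
have ist n : m.-integrable K (EFin \o (fun r => `|s n (t - r)|)).
  apply: (integrable_dom mK (g := fun r => 2 * `|F (t - r)|)).
  - by apply: sm_norm => //; apply: sm_sub (smst n).
  - by move=> r _; rewrite normr_id; have [] := bs n (t - r).
  - exact: integrableZlR.
have md n : measurable_fun K (fun r : mR => `|F (t - r) - s n (t - r)|).
  by apply: sm_norm => //; apply: sm_sub_fun => //; apply: sm_sub (smst n).
have id n : m.-integrable K (EFin \o (fun r => `|F (t - r) - s n (t - r)|)).
  apply: (integrable_dom mK _ _ iF) => //.
  by move=> r _; rewrite normr_id; have [] := bs n (t - r).
have d0 : (\int[m]_(r in K) `|F (t - r) - s n (t - r)|)%R @[n --> \oo] --> (0 : R).
  have := @Rintegral_cvg_dom _ _ _ m _ mK (fun n r => `|F (t - r) - s n (t - r)|) (fun _ => 0) _ md.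
  have -> : (\int[m]_(x in K) 0)%R = (0 : R) by rewrite /Rintegral integral0_eq.
  apply; [|exact: iF|by move=> n r _; rewrite normr_id; have [] := bs n (t - r)].
  move=> r _; have h : F (t - r) - s n (t - r) @[n --> \oo] --> F (t - r) - F (t - r).
    by apply: cvgB; [exact: cvg_cst|exact: cs].
  have := cvg_norm h; rewrite subrr normr0; apply.
apply/cvgrPdist_le => e e0.
move/cvgrPdist_le : d0 => /(_ _ e0); apply: filterS => n.
rewrite sub0r normrN => /(le_trans (ler_norm _)); apply: le_trans.
apply: dual_norm_leP; first by apply: Rintegral_ge0 => r _.
move=> v.
have E : (bochner m K (fun r => F (t - r)) - simple_integral m K (fun r => s n (t - r))) v =
    (\int[m]_(r in K) ((F (t - r) - s n (t - r)) v))%R.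
  apply: etrans (dualB _ _ _) _.
  apply: etrans (congr2 (fun x y => x - y) (bochnerE mK v sFt iF) (simple_integral_dual mK v (sst n) (ist n))) _.
  rewrite -RintegralB//; first last.
  - by apply: dual_integrable => //; apply: sm_sub (smst n).
  - exact: dual_integrable.
rewrite (congr1 (fun x : R => `|x|) E) mulrC -RintegralZl//.
apply: le_Rintegral_norm => //.
- by apply: dual_integrable => //; apply: sm_sub_fun => //; apply: sm_sub (smst n).
- exact: integrableZlR.
- by move=> r _; rewrite mulrC; exact: dual_le.
Qed.

(** On the measurable set [Fin] of times with integrable integrand, the convolution is a pointwise
    limit of simple ones. Outside, the Bochner integral has its default value 0, so the approximants
    are set to 0 there too. *)
Lemma sm_bochner_convolution F : strongly_measurable (setT : set mR) F ->
  strongly_measurable (setT : set mR) (fun t => bochner m K (fun r => F (t - r))).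
Proof.
move=> sF.
have mF : measurable_fun (setT : set mR) (fun t => `|F t|) by exact: sm_norm.
pose Fin : set mR := [set t | (\int[m]_(r in K) `|F (t - r)|%:E < +oo)%E].
have mFin : measurable Fin.
  have := @convolution_measurable R m K mK (fun _ => 1) (fun t => `|F t|) (measurable_cst _) mF (fun _ => ler01) (fun t => normr_ge0 _).
  under eq_fun do under eq_integral do rewrite mul1r.
  by move=> mc; have := emeasurable_fun_infty_o measurableT mc +oo%E; rewrite setTI.
have FinP t : Fin t <-> m.-integrable K (EFin \o (fun r => `|F (t - r)|)).
  have mFt : measurable_fun K (fun r : mR => `|F (t - r)|) by apply: sm_norm => //; exact: sm_reflect.
  split => [h|/integrableP[_]]; first exact: ge0_integrable.
  by under eq_integral do rewrite /= normr_id.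
have [s [ss _ cs bs]] := sm_dominated measurableT sF.
apply: (sm_lim measurableT (f := fun n t => if t \in Fin then simple_integral m K (fun r => s n (t - r)) else 0)).
  move=> n; rewrite -(setUT Fin); apply: sm_patch => //; last exact: sm_cst.
  by apply: (sm_sub (D := setT)) => //; apply: sm_simple_convolution.
move=> t _; have [tF|tF] := boolP (t \in Fin).
  apply: simple_convolution_cvg => //; [by move=> r; exact: cs|by move=> n r; exact: bs|].
  by apply/FinP; exact: set_mem tF.
rewrite bochner_nonintegrable//; first exact: cvg_cst.
by move=> h; move/negP: tF; apply; apply/mem_set/FinP.
Qed.

End bochner_convolution.

Section total_variation_measure.
Context {R : realType} d (T : measurableType d).
Variable sigma : {charge set T -> \bar R}.

Let tv_fin : fin_num_fun (charge_variation (hahnP sigma)).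
Proof. by move=> A mA; apply: (fin_num_measure (charge_variation (hahnP sigma))). Qed.

(** The total variation packaged together with its finiteness, the form in which Tonelli can be
    applied. *)
Definition tv_measure : {finite_measure set T -> \bar R} :=
  HB.pack (charge_variation (hahnP sigma))
    (Measure_isFinite.Build _ _ _ (charge_variation (hahnP sigma)) tv_fin).

Lemma ge0_integral_tv (D : set T) (f : T -> \bar R) : measurable D ->
  measurable_fun D f -> (forall x, D x -> 0 <= f x)%E ->
  (\int[tv_measure]_(x in D) f x = \int[jordan_pos (hahnP sigma)]_(x in D) f x +
     \int[jordan_neg (hahnP sigma)]_(x in D) f x)%E.
Proof.
move=> mD mf f0; rewrite -ge0_integral_measure_add//; apply: eq_measure_integral => A mA _.
by rewrite /= /msum !big_ord_recl big_ord0 adde0.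
Qed.

End total_variation_measure.

(** * Young's inequality for convolution with a measure *)

Section young.
Context {R : realType}.
Local Notation leb := (@lebesgue_measure R).
Local Notation mR := (measurableTypeR R).
Local Notation integrable f := (leb.-integrable setT (EFin \o f)).

(** The quadratic c^2 k - 2 c n + q is evaluated at its minimiser c = n / k. If k = 0 < n, the value
    c = (q + 1) / n contradicts the hypothesis. *)
Lemma discriminant_le (n k q : R) : 0 <= k -> 0 <= q -> 0 <= n ->
  (forall c : R, 0 < c -> 2 * c * n <= c ^+ 2 * k + q) -> n ^+ 2 <= k * q.
Proof.
move=> k0 q0 n0 H; have [->|nn] := eqVneq n 0; first by rewrite expr0n mulr_ge0.
have np : 0 < n by rewrite lt_neqAle eq_sym nn.
have [k00|kn] := eqVneq k 0.
  have := H ((q + 1) / n) (divr_gt0 (ltr_wpDl q0 ltr01) np).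
  rewrite k00 mulr0 add0r => h; exfalso; move: h; apply/negP; rewrite -ltNge.
  by rewrite -mulrA mulfVK//; lra.
have kp : 0 < k by rewrite lt_neqAle eq_sym kn.
have := H (n / k) (divr_gt0 np kp).
have -> : (n / k) ^+ 2 * k = n ^+ 2 / k by field.
have -> : 2 * (n / k) * n = n ^+ 2 / k + n ^+ 2 / k by field.
by rewrite lerD2l ler_pdivrMr// mulrC.
Qed.

Lemma weighted_young (c p h : R) : 0 <= p -> 2 * c * (p * h) <= c ^+ 2 * p + p * h ^+ 2.
Proof. by move=> p0; have := mulr_ge0 p0 (sqr_ge0 (c - h)); nra. Qed.

Variables (M : {finite_measure set mR -> \bar R}) (K : set mR).
Hypothesis mK : measurable K.
Variables (p h n : R -> R) (k : R).
Hypotheses (mp : measurable_fun (setT : set mR) p) (p0 : forall s, 0 <= p s).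
Hypothesis ip : (\int[M]_(s in K) (p s)%:E = k%:E)%E.
Hypotheses (mh : measurable_fun (setT : set mR) h) (h0 : forall t, 0 <= h t).
Hypothesis ih : integrable (fun t => h t ^+ 2).
Hypotheses (mn : measurable_fun (setT : set mR) n) (n0 : forall t, 0 <= n t).
Hypothesis nle : forall t, ((n t)%:E <= \int[M]_(s in K) (p s * h (t - s))%:E)%E.

Let mh2 : measurable_fun (setT : set mR) (fun t => h t ^+ 2).
Proof. exact: measurable_funX. Qed.

Let Q t := (\int[M]_(s in K) (p s * h (t - s) ^+ 2)%:E)%E.

Let Q0 t : (0 <= Q t)%E.
Proof. by apply: integral_ge0 => s _; rewrite lee_fin mulr_ge0// sqr_ge0. Qed.

Let mpK : measurable_fun K p.
Proof. exact: (measurable_funS measurableT). Qed.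

Let mhK t : measurable_fun K (fun s : mR => h (t - s)).
Proof.
by apply: (measurable_funS measurableT) => //; exact: (measurableT_comp mh (reflect_measurable t)).
Qed.

Let k0 : 0 <= k.
Proof. by rewrite -lee_fin -ip; apply: integral_ge0 => s _; rewrite lee_fin. Qed.

Let young_pointwise t c : 0 < c -> ((2 * c * n t)%:E <= (c ^+ 2 * k)%:E + Q t)%E.
Proof.
move=> c0; apply: (@le_trans _ _ (\int[M]_(s in K) (2 * c * (p s * h (t - s)))%:E)%E).
  have mph : measurable_fun K (fun s : mR => (p s * h (t - s))%:E).
    by apply/measurable_EFinP; exact: measurable_funM.
  under eq_integral do rewrite EFinM.
  rewrite ge0_integralZl//; first last.
  - by rewrite lee_fin mulr_ge0// ltW.
  - by move=> s _; rewrite lee_fin mulr_ge0.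
  by rewrite EFinM lee_wpmul2l// lee_fin mulr_ge0// ltW.
have -> : ((c ^+ 2 * k)%:E + Q t = \int[M]_(s in K) ((c ^+ 2 * p s)%:E + (p s * h (t - s) ^+ 2)%:E))%E.
  rewrite ge0_integralD//; first last.
  - by apply/measurable_EFinP; apply: measurable_funM => //; exact: measurable_funX.
  - by move=> s _; rewrite lee_fin mulr_ge0// sqr_ge0.
  - by apply/measurable_EFinP; exact: measurable_funM.
  - by move=> s _; rewrite lee_fin mulr_ge0// sqr_ge0.
  congr (_ + _)%E; under eq_integral do rewrite EFinM.
  rewrite ge0_integralZl//; first by rewrite ip.
  - exact/measurable_EFinP.
  - by move=> s _; rewrite lee_fin.
  - by rewrite lee_fin sqr_ge0.
apply: ge0_le_integral => //.
- by move=> s _; rewrite lee_fin !mulr_ge0// ltW.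
- apply/measurable_EFinP; apply: measurable_funM => //; exact: measurable_funM.
- apply: emeasurable_funD; apply/measurable_EFinP; apply: measurable_funM => //.
  exact: measurable_funX.
- move=> s _; rewrite -EFinD lee_fin.
  exact: weighted_young.
Qed.

(** Cauchy-Schwarz for the measure with density [p]. The positive factor k + e makes the product
    infinite when [Q t] is, even for k = 0. *)
Let sq_le t e : 0 < e -> ((n t ^+ 2)%:E <= (k + e)%:E * Q t)%E.
Proof.
move=> e0; case: (Q t) (Q0 t) (young_pointwise t) => [q| |]// q0 H; last first.
  by rewrite gt0_muley ?leey// lte_fin ltr_wpDl.
rewrite -EFinM lee_fin; apply: (@le_trans _ _ (k * q)).
  by apply: discriminant_le => // c c0; have := H c c0; rewrite -EFinD lee_fin.
by apply: ler_wpM2r => //; rewrite lerDl ltW.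
Qed.

(** Integrating the pointwise Cauchy-Schwarz bound gives one factor [k + e]; the convolution of [p]
    with [h^2] has integral [k] times that of [h^2], the second factor. Then e tends to 0. *)
Lemma young_inequality : integrable (fun t => n t ^+ 2) /\
  (\int[leb]_t (n t ^+ 2))%R <= k ^+ 2 * (\int[leb]_t (h t ^+ 2))%R.
Proof.
have mn2 : measurable_fun (setT : set mR) (fun t => n t ^+ 2) by exact: measurable_funX.
set S := (\int[leb]_t (h t ^+ 2))%R.
have SE : (\int[leb]_t (h t ^+ 2)%:E)%E = S%:E by rewrite /S EFin_Rintegral.
have B e : 0 < e -> (\int[leb]_t (n t ^+ 2)%:E <= ((k + e) * (k * S))%:E)%E.
  move=> e0; apply: (@le_trans _ _ (\int[leb]_t ((k + e)%:E * Q t))%E).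
    apply: ge0_le_integral => //.
    - by move=> t _; rewrite lee_fin sqr_ge0.
    - exact/measurable_EFinP.
    - by apply: emeasurable_funM => //; apply: (convolution_measurable M mK mp mh2) => // t; exact: sqr_ge0.
    - by move=> t _; exact: sq_le.
  rewrite ge0_integralZl//; first last.
  - by rewrite lee_fin addr_ge0// ltW.
  - by apply: (convolution_measurable M mK mp mh2) => // t; exact: sqr_ge0.
  rewrite (@convolution_integral R M K mK p _ mp mh2 p0 (fun t => sqr_ge0 _)).
  by rewrite ip SE -!EFinM.
have inn : integrable (fun t => n t ^+ 2).
  apply: ge0_integrable => //; first by move=> t _; exact: sqr_ge0.
  by apply: (le_lt_trans (B 1 ltr01)); rewrite ltry.
split=> //; rewrite expr2 -mulrA.
have S0 : 0 <= k * S by rewrite mulr_ge0//; apply: Rintegral_ge0 => t _; exact: sqr_ge0.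
apply/ler_addgt0Pr => e e0.
have e1 : 0 < e / (k * S + 1) by rewrite divr_gt0// ltr_wpDl.
have := B _ e1; rewrite -EFin_Rintegral// lee_fin => /le_trans; apply.
rewrite mulrDl lerD2l mulrAC ler_pdivrMr ?ltr_wpDl//.
by apply: ler_wpM2l; [exact: ltW|rewrite lerDl].
Qed.

End young.

(** * The delay operator *)

Lemma exp_weight_sq {R : realType} (beta t x : R) :
  (expR (- (beta * t)) * x) ^+ 2 = expR (- (2 * beta * t)) * x ^+ 2.
Proof. by rewrite exprMn expr2 -expRD -mulrA mulrDl mul1r opprD. Qed.

Section delay_operator.
Context {R : realType} {V : hilbertType R}.
Local Notation leb := (@lebesgue_measure R).
Local Notation mR := (measurableTypeR R).
Local Notation integrable f := (leb.-integrable setT (EFin \o f)).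
Local Notation sm f := (strongly_measurable (setT : set (measurableTypeR R)) f).
Variables (tau L1 : R) (A1 : V -> dual V).
Hypothesis L1_ge0 : 0 <= L1.
Hypothesis A1B : forall u v, A1 (u - v) = A1 u - A1 v.
Hypothesis A1_le : forall u, `|A1 u| <= L1 * `|u|.
Local Notation K := (`[0%R, tau]%classic : set mR).
Implicit Types (g : R -> V) (sigma mu nu : {charge set mR -> \bar R}).

Let mK : measurable K. Proof. exact: measurable_itv. Qed.

Lemma A1_sm g : sm g -> sm (fun t => A1 (g t)).
Proof.
apply: sm_comp => u; apply/cvgrPdist_le => e e0.
have e1 : 0 < e / (L1 + 1) by rewrite divr_gt0// ltr_wpDl.
have uu : x @[x --> u] --> u by exact: cvg_id.
move/cvgrPdist_le : uu => /(_ _ e1); apply: filterS => v h.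
rewrite -A1B; apply: (le_trans (A1_le _)).
apply: (le_trans (ler_wpM2l L1_ge0 h)).
by rewrite mulrCA -{2}(mulr1 e) ler_wpM2l ?(ltW e0)// ler_pdivrMr ?ltr_wpDl// mul1r lerDl.
Qed.

Lemma sm_delay sigma g : sm g -> sm (delay_op tau A1 sigma g).
Proof.
move=> sg; apply: sm_sub_fun.
  exact: (@sm_bochner_convolution R V (jordan_pos (hahnP sigma)) K mK _ (A1_sm sg)).
exact: (@sm_bochner_convolution R V (jordan_neg (hahnP sigma)) K mK _ (A1_sm sg)).
Qed.

Let mnF g t : sm g -> measurable_fun K (fun s : mR => `|A1 (g (t - s))|).
Proof. by move=> /A1_sm sF; apply: sm_norm => //; exact: (sm_reflect K t sF). Qed.

(** The two Jordan parts are bounded separately, and their sum is the total variation. *)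
Lemma delay_norm_le sigma g t : sm g ->
  (`|delay_op tau A1 sigma g t|%:E <= \int[tv_measure sigma]_(s in K) `|A1 (g (t - s))|%:E)%E.
Proof.
move=> sg; rewrite ge0_integral_tv//; last by apply/measurable_EFinP; exact: mnF.
have sF := sm_reflect K t (A1_sm sg).
apply: (@le_trans _ _ (`|bochner (jordan_pos (hahnP sigma)) K (fun s => A1 (g (t - s)))|%:E +
   `|bochner (jordan_neg (hahnP sigma)) K (fun s => A1 (g (t - s)))|%:E)%E).
  by rewrite -EFinD lee_fin; exact: ler_normB.
by apply: leeD; exact: (bochner_norm _ mK sF).
Qed.

(** The exponential weight is multiplicative: e^{-beta t} = e^{-beta s} e^{-beta (t - s)}. The first
    factor becomes the density [p], of total mass kappa, and the second joins [L1 |g|] to form the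
    function [h] that is convolved. *)
Lemma delay_young sigma g beta : 0 <= beta -> sm g ->
  integrable (fun t => (expR (- (beta * t)) * `|g t|) ^+ 2) ->
  integrable (fun t => (expR (- (beta * t)) * `|delay_op tau A1 sigma g t|) ^+ 2) /\
  (\int[leb]_t (expR (- (beta * t)) * `|delay_op tau A1 sigma g t|) ^+ 2)%R <=
  (L1 * kappa tau sigma beta) ^+ 2 * (\int[leb]_t (expR (- (beta * t)) * `|g t|) ^+ 2)%R.
Proof.
move=> b0 sg ig.
have me : measurable_fun (setT : set mR) (fun t : mR => expR (- (beta * t))).
  apply: measurableT_comp; first exact: measurable_expR.
  apply: measurableT_comp; first exact: oppr_measurable.
  by apply: measurable_funM; [exact: measurable_cst|exact: measurable_id].
pose h t := L1 * (expR (- (beta * t)) * `|g t|).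
have mg : measurable_fun (setT : set mR) (fun t => `|g t|) by exact: sm_norm.
have mh : measurable_fun (setT : set mR) h.
  by apply: measurable_funM; [exact: measurable_cst|exact: measurable_funM].
have h2 t : h t ^+ 2 = L1 ^+ 2 * (expR (- (beta * t)) * `|g t|) ^+ 2 by rewrite /h exprMn.
have h0 t : 0 <= h t by rewrite !mulr_ge0// expR_ge0.
have ih : integrable (fun t => h t ^+ 2) by under eq_fun do rewrite h2; exact: integrableZlR.
have mn : measurable_fun (setT : set mR) (fun t => expR (- (beta * t)) * `|delay_op tau A1 sigma g t|).
  by apply: measurable_funM => //; apply: sm_norm => //; exact: sm_delay.
(* [kappa] is the [fine] part of this integral; the two agree since the weight is at most 1 on
   [0, tau] and the total variation is finite. *)
have ip : (\int[tv_measure sigma]_(s in K) (expR (- (beta * s)))%:E = (kappa tau sigma beta)%:E)%E.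
  rewrite /kappa -(@EFin_Rintegral _ _ _ (tv_measure sigma))//.
  apply: ge0_integrable => //; first exact: (measurable_funS measurableT).
  apply: (@le_lt_trans _ _ (\int[tv_measure sigma]_(s in K) (cst 1%:E s))%E).
    apply: ge0_le_integral => //.
    - by apply/measurable_EFinP; exact: (measurable_funS measurableT).
    - move=> s; rewrite /= in_itv /= => /andP[s0 _].
      by rewrite lee_fin -expR0 ler_expR oppr_le0 mulr_ge0.
  by rewrite integral_cst// mul1e -ge0_fin_numE// fin_num_measure.
have nle t : ((expR (- (beta * t)) * `|delay_op tau A1 sigma g t|)%:E <=
    \int[tv_measure sigma]_(s in K) (expR (- (beta * s)) * h (t - s))%:E)%E.
  rewrite EFinM; apply: (@le_trans _ _ ((expR (- (beta * t)))%:E *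
      \int[tv_measure sigma]_(s in K) `|A1 (g (t - s))|%:E)%E).
    by apply: lee_wpmul2l; [rewrite lee_fin expR_ge0|exact: delay_norm_le].
  rewrite -ge0_integralZl//; first last.
  - by apply/measurable_EFinP; exact: mnF.
  apply: ge0_le_integral => //.
  - by apply: emeasurable_funM => //; apply/measurable_EFinP; exact: mnF.
  - apply/measurable_EFinP; apply: measurable_funM; first exact: (measurable_funS measurableT).
    by apply: (measurable_funS measurableT) => //; exact: (measurableT_comp mh (reflect_measurable t)).
  - move=> s _; rewrite -EFinM lee_fin /h.
    rewrite [leRHS](_ : _ = expR (- (beta * t)) * (L1 * `|g (t - s)|)).
      by apply: ler_wpM2l; [exact: expR_ge0|exact: A1_le].
    rewrite mulrCA [X in _ * X]mulrA -expRD [RHS]mulrCA; congr (_ * (expR _ * _)); ring.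
have [i1 i2] := young_inequality mK me (fun s => expR_ge0 _) ip mh h0 ih mn
  (fun t => mulr_ge0 (expR_ge0 _) (normr_ge0 _)) nle.
split=> //; apply: (le_trans i2).
have -> : (\int[leb]_t (h t ^+ 2))%R = L1 ^+ 2 * (\int[leb]_t (expR (- (beta * t)) * `|g t|) ^+ 2)%R.
  by rewrite -RintegralZl//; apply: eq_Rintegral => t _; exact: h2.
by rewrite mulrA exprMn [L1 ^+ 2 * _]mulrC.
Qed.

(** The convolution has a finite integral over the line, hence is finite at almost every time. *)
Lemma convolution_integrable_ae (m : {finite_measure set mR -> \bar R}) (f : R -> R) :
  (forall t, 0 <= f t) -> integrable f ->
  {ae leb, forall t, m.-integrable K (EFin \o (fun s => f (t - s)))}.
Proof.
move=> f0 fi; have mf := integrable_measurable fi.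
have m1 := @measurable_cst _ _ mR R setT (1 : R).
have mC := convolution_measurable m mK m1 mf (fun _ => ler01) f0.
have iC : leb.-integrable setT (fun t => (\int[m]_(s in K) (1 * f (t - s))%:E)%E).
  apply/integrableP; split => //.
  have absE t : (`|\int[m]_(s in K) (1 * f (t - s))%:E| = \int[m]_(s in K) (1 * f (t - s))%:E)%E.
    by rewrite gee0_abs//; apply: integral_ge0 => s _; rewrite lee_fin mul1r.
  under eq_integral do rewrite absE.
  rewrite (convolution_integral m mK m1 mf (fun _ => ler01) f0).
  have f0E : (0 <= \int[leb]_t (f t)%:E)%E by apply: integral_ge0 => t _; rewrite lee_fin.
  have -> : (\int[m]_(s in K) 1%:E = m K)%E by rewrite (integral_cst m mK 1%E) mul1e.
  rewrite -EFin_Rintegral// lte_mul_pinfty//; first exact: fin_num_measure.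
  exact: ltry.
move/(integrable_ae measurableT) : iC; apply: aeS => t /(_ Logic.I).
have mft : measurable_fun K (fun s : mR => f (t - s)).
  by apply: (measurable_funS measurableT) => //; exact: (measurableT_comp mf (reflect_measurable t)).
under eq_integral do rewrite mul1r.
move=> ft; apply: ge0_integrable => //; rewrite -ge0_fin_numE//.
by apply: integral_ge0 => s _; rewrite lee_fin.
Qed.

End delay_operator.

Section measure_sums.
Context d (T : measurableType d) (R : realType).
Implicit Types (m : {measure set T -> \bar R}) (f : T -> R).
Variables (D : set T).
Hypothesis mD : measurable D.

Lemma integrable_measure_add m1 m2 f : m1.-integrable D (EFin \o f) ->
  m2.-integrable D (EFin \o f) -> (measure_add m1 m2).-integrable D (EFin \o f).
Proof.
move=> /integrableP[mf f1] /integrableP[_ f2]; apply/integrableP; split=> //.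
by rewrite ge0_integral_measure_add//; [exact: lte_add_pinfty|exact: measurableT_comp].
Qed.

Lemma Rintegral_measure_add m1 m2 f : m1.-integrable D (EFin \o f) ->
  m2.-integrable D (EFin \o f) ->
  (\int[measure_add m1 m2]_(x in D) f x)%R = (\int[m1]_(x in D) f x)%R + (\int[m2]_(x in D) f x)%R.
Proof.
move=> f1 f2; apply: EFin_inj; rewrite EFinD !EFin_Rintegral//; last exact: integrable_measure_add.
by rewrite integral_measure_add//; exact: measurable_int f1.
Qed.

Lemma Rintegral_sum3_eq (m1 m2 m3 n1 n2 n3 : {measure set T -> \bar R}) f :
  (forall A, measurable A -> (m1 A + m2 A + m3 A = n1 A + n2 A + n3 A)%E) ->
  m1.-integrable D (EFin \o f) -> m2.-integrable D (EFin \o f) -> m3.-integrable D (EFin \o f) ->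
  n1.-integrable D (EFin \o f) -> n2.-integrable D (EFin \o f) -> n3.-integrable D (EFin \o f) ->
  (\int[m1]_(x in D) f x)%R + (\int[m2]_(x in D) f x)%R + (\int[m3]_(x in D) f x)%R =
  (\int[n1]_(x in D) f x)%R + (\int[n2]_(x in D) f x)%R + (\int[n3]_(x in D) f x)%R.
Proof.
move=> mn i1 i2 i3 j1 j2 j3.
rewrite -!Rintegral_measure_add//; try exact: integrable_measure_add.
congr fine; apply: eq_measure_integral => A mA _.
have addE (x y : {measure set T -> \bar R}) : measure_add x y A = (x A + y A)%E.
  exact: measure_addE.
exact: etrans (etrans (addE _ _) (congr1 (fun z => z + _)%E (addE _ _)))
  (etrans (mn A mA) (esym (etrans (addE _ _) (congr1 (fun z => z + _)%E (addE _ _))))).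
Qed.

End measure_sums.

(** * Linearity of the delay operator *)

Section delay_linear.
Context {R : realType} {V : hilbertType R}.
Local Notation leb := (@lebesgue_measure R).
Local Notation mR := (measurableTypeR R).
Local Notation integrable f := (leb.-integrable setT (EFin \o f)).
Local Notation sm f := (strongly_measurable (setT : set (measurableTypeR R)) f).
Implicit Types (sigma mu nu : {charge set mR -> \bar R}).

Lemma cross_sub (a b c a' b' c' : R) : a + b + c = a' + b' + c' -> a - a' = b' - b - (c - c').
Proof. by move=> h; lra. Qed.

Lemma fin_num_cross (p n p1 n1 p2 n2 : \bar R) :
  p \is a fin_num -> n \is a fin_num -> p1 \is a fin_num -> n1 \is a fin_num ->
  p2 \is a fin_num -> n2 \is a fin_num ->
  (p - n = (p1 - n1) - (p2 - n2) -> p + n1 + p2 = n + p1 + n2)%E.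
Proof.
move: p n p1 n1 p2 n2 => [p| |]// [n| |]// [p1| |]// [n1| |]// [p2| |]// [n2| |]// _ _ _ _ _ _ [] h.
by congr (_%:E); lra.
Qed.

(** The Hahn sets of mu, nu and mu - nu are unrelated, so their Jordan parts cannot be compared one
    by one. Moving the negative terms across gives an identity between sums of measures, against
    which functions can be integrated. *)
Lemma cadd_copp_jordan mu nu (A : set mR) : measurable A ->
  (jordan_pos (hahnP (cadd mu (copp nu))) A + jordan_neg (hahnP mu) A + jordan_pos (hahnP nu) A =
   jordan_neg (hahnP (cadd mu (copp nu))) A + jordan_pos (hahnP mu) A + jordan_neg (hahnP nu) A)%E.
Proof.
move=> mA.
have JD sigma : sigma A = (jordan_pos (hahnP sigma) A - jordan_neg (hahnP sigma) A)%E.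
  by rewrite (jordan_decomp (hahnP sigma) mA) /cadd /= cscaleN1.
have : cadd mu (copp nu) A = (mu A - nu A)%E by [].
rewrite (JD (cadd mu (copp nu))) (JD mu) (JD nu).
have fm (m : {finite_measure set mR -> \bar R}) : m A \is a fin_num by exact: fin_num_measure.
exact: fin_num_cross.
Qed.

Variables (tau L1 : R) (A1 : V -> dual V).
Hypothesis L1_ge0 : 0 <= L1.
Hypothesis A1B : forall u v, A1 (u - v) = A1 u - A1 v.
Hypothesis A1_le : forall u, `|A1 u| <= L1 * `|u|.
Local Notation K := (`[0%R, tau]%classic : set mR).
Implicit Types (g : R -> V).

Let mK : measurable K. Proof. exact: measurable_itv. Qed.

Lemma charge_bochner_dual sigma (f : R -> dual V) v : strongly_measurable K f ->
  (jordan_pos (hahnP sigma)).-integrable K (EFin \o (fun t => `|f t|)) ->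
  (jordan_neg (hahnP sigma)).-integrable K (EFin \o (fun t => `|f t|)) ->
  charge_bochner sigma K f v = (\int[jordan_pos (hahnP sigma)]_(t in K) f t v)%R -
    (\int[jordan_neg (hahnP sigma)]_(t in K) f t v)%R.
Proof.
move=> sf f1 f2; apply: etrans (dualB _ _ _) _.
exact: (congr2 (fun x y => x - y) (bochnerE mK v sf f1) (bochnerE mK v sf f2)).
Qed.

Let A1_integrable g : sm g -> integrable (fun t => `|g t|) -> integrable (fun t => `|A1 (g t)|).
Proof.
move=> sg ig; apply: (@integrable_dom _ mR R leb setT measurableT _ (fun t => L1 * `|g t|)).
- by apply: sm_norm => //; exact: (A1_sm L1_ge0 A1B A1_le sg).
- by move=> t _; rewrite normr_id.
- exact: integrableZlR.
Qed.

Let ae_int (m : {finite_measure set mR -> \bar R}) g : sm g -> integrable (fun t => `|g t|) ->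
  {ae leb, forall t, m.-integrable K (EFin \o (fun s => `|A1 (g (t - s))|))}.
Proof.
move=> sg ig.
exact: (convolution_integrable_ae tau m (fun t => normr_ge0 _) (A1_integrable sg ig)).
Qed.

(** The Bochner integral is additive only where both integrands are integrable for both Jordan
    parts, which holds at almost every time. *)
Lemma delayB sigma g g' : sm g -> sm g' ->
  integrable (fun t => `|g t|) -> integrable (fun t => `|g' t|) ->
  {ae leb, forall t, delay_op tau A1 sigma (fun t => g t - g' t) t =
    delay_op tau A1 sigma g t - delay_op tau A1 sigma g' t}.
Proof.
move=> sg sg' ig ig'.
have := aeI (aeI (ae_int (jordan_pos (hahnP sigma)) sg ig) (ae_int (jordan_neg (hahnP sigma)) sg ig))
  (aeI (ae_int (jordan_pos (hahnP sigma)) sg' ig') (ae_int (jordan_neg (hahnP sigma)) sg' ig')).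
apply: aeS => t [[p1 n1] [p2 n2]].
have s1 := sm_reflect K t (A1_sm L1_ge0 A1B A1_le sg).
have s2 := sm_reflect K t (A1_sm L1_ge0 A1B A1_le sg').
have E : (fun s => A1 (g (t - s) - g' (t - s))) = (fun s => A1 (g (t - s)) - A1 (g' (t - s))).
  by apply/funext => s; exact: A1B.
have i12 (m : {finite_measure set mR -> \bar R}) :
    m.-integrable K (EFin \o (fun s => `|A1 (g (t - s))|)) ->
    m.-integrable K (EFin \o (fun s => `|A1 (g' (t - s))|)) ->
    m.-integrable K (EFin \o (fun s => `|A1 (g (t - s)) - A1 (g' (t - s))|)).
  move=> i1 i2; apply: (integrable_dom mK _ _ (integrableDR mK i1 i2)).
    by apply: sm_norm => //; exact: sm_sub_fun.
  by move=> s _; rewrite normr_id; exact: ler_normB.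
have d12 (m : {finite_measure set mR -> \bar R}) v :
    m.-integrable K (EFin \o (fun s => `|A1 (g (t - s))|)) ->
    m.-integrable K (EFin \o (fun s => `|A1 (g' (t - s))|)) ->
    (\int[m]_(s in K) ((A1 (g (t - s)) - A1 (g' (t - s))) v))%R =
    (\int[m]_(s in K) (A1 (g (t - s)) v))%R - (\int[m]_(s in K) (A1 (g' (t - s)) v))%R.
  by move=> i1 i2; rewrite -RintegralB//; apply: dual_integrable.
rewrite /delay_op E; apply: dual_ext => v.
apply: etrans (charge_bochner_dual v (sm_sub_fun s1 s2) (i12 _ p1 p2) (i12 _ n1 n2)) _.
rewrite !d12//; apply: etrans (esym (dualB _ _ _)).
apply: etrans (esym (congr2 (fun x y => x - y) (charge_bochner_dual v s1 p1 n1) (charge_bochner_dual v s2 p2 n2))).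
by ring.
Qed.

Lemma delay_kernelB mu nu g : sm g -> integrable (fun t => `|g t|) ->
  {ae leb, forall t, delay_op tau A1 (cadd mu (copp nu)) g t =
    delay_op tau A1 mu g t - delay_op tau A1 nu g t}.
Proof.
move=> sg ig.
have ae1 sigma := aeI (ae_int (jordan_pos (hahnP sigma)) sg ig) (ae_int (jordan_neg (hahnP sigma)) sg ig).
have := aeI (ae1 (cadd mu (copp nu))) (aeI (ae1 mu) (ae1 nu)).
apply: aeS => t [[p0 n0] [[p1 n1] [p2 n2]]].
have sF := sm_reflect K t (A1_sm L1_ge0 A1B A1_le sg).
apply: dual_ext => v; apply: etrans (charge_bochner_dual v sF p0 n0) _.
apply: etrans (esym (dualB _ _ _)).
apply: etrans (esym (congr2 (fun x y => x - y) (charge_bochner_dual v sF p1 n1) (charge_bochner_dual v sF p2 n2))).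
apply: cross_sub.
exact: (@Rintegral_sum3_eq _ _ _ _ mK _ _ _ _ _ _ (fun s => A1 (g (t - s)) v) (@cadd_copp_jordan mu nu)
  (dual_integrable mK v sF p0) (dual_integrable mK v sF n1) (dual_integrable mK v sF p2)
  (dual_integrable mK v sF n0) (dual_integrable mK v sF p1) (dual_integrable mK v sF n2)).
Qed.

End delay_linear.

(** * Stability *)

Section master_inequality.
Context {R : realType}.
Local Notation leb := (@lebesgue_measure R).
Local Notation mR := (measurableTypeR R).
Local Notation integrable f := (leb.-integrable setT (EFin \o f)).

Lemma ae_le_Rintegral_signed (f g : R -> R) : integrable f -> integrable g ->
  {ae leb, forall t, f t <= g t} -> (\int[leb]_t f t)%R <= (\int[leb]_t g t)%R.
Proof.
move=> fi gi fg; rewrite -subr_ge0 -RintegralB//.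
have gfi := integrableBR measurableT gi fi.
have agfi : integrable (fun t => `|g t - f t|).
  by apply: (@integrable_dom _ mR R leb setT measurableT _ (fun t => `|g t - f t|));
    [exact: measurableT_comp (integrable_measurable gfi)|move=> t _; rewrite normr_id|
     move/integrable_norm : gfi; apply: eq_integrable].
rewrite (ae_eq_Rintegral gfi agfi); first by apply: Rintegral_ge0 => t _.
by apply: aeS fg => t h; rewrite ger0_norm// subr_ge0.
Qed.

Lemma young_split (x y e : R) : 0 < e -> x * y <= e / 2 * y ^+ 2 + (2 * e)^-1 * x ^+ 2.
Proof.
move=> e0; have := sqr_ge0 (x / e - y) => h.
have := mulr_ge0 (ltW e0) h.
rewrite (_ : e * (x / e - y) ^+ 2 = x ^+ 2 / e - 2 * (x * y) + e * y ^+ 2); last by field; lra.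
rewrite invfM => h2; lra.
Qed.

(** The delay term costs (k + eta)/2 from Young and k^2 / (2 (k + eta)) <= k/2 from its own norm;
    the residual costs d/2. Doubling the sum with -alpha leaves -d + eta in front of [S]. The
    parameter eta keeps the division meaningful when k = 0. *)
Lemma master_arith (alpha k d eta E S P N I : R) : 0 <= k -> 0 < eta -> d = alpha - k -> 0 < d ->
  0 <= S -> N <= k ^+ 2 * S -> E <= 2 * I ->
  I <= (- alpha + (k + eta) / 2 + d / 2) * S + (2 * (k + eta))^-1 * N + (2 * d)^-1 * P ->
  E + d * S <= d^-1 * P + eta * S.
Proof.
move=> k0 e0 -> d0 S0 NS EI IS.
have ke : 0 < k + eta by lra.
have h1 : (2 * (k + eta))^-1 * N <= k / 2 * S.
  apply: (@le_trans _ _ ((2 * (k + eta))^-1 * (k ^+ 2 * S))).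
    by apply: ler_wpM2l => //; rewrite invr_ge0; lra.
  rewrite mulrA; apply: ler_wpM2r => //.
  rewrite mulrC ler_pdivrMr; last by lra.
  by nra.
have h2 : (2 * (alpha - k))^-1 * P = (alpha - k)^-1 * P / 2 by rewrite invfM; ring.
rewrite h2 in IS; move: IS h1; set Q := (alpha - k)^-1 * P; set M := (2 * (k + eta))^-1 * N.
by move=> IS h1; lra.
Qed.

(** Here [h], [n] and [rho] stand for the weighted norms of the difference, the delay term and the
    residual, and [q] for the weighted pairing. The norm of [n] on the whole line is controlled by
    [h] on (0, b) alone, which is what allows absorption. *)
Lemma master_inequality (beta alpha k b E : R) (q h n rho : R -> R) :
  0 <= k -> 0 < alpha - k -> (forall t, 0 <= h t) ->
  integrable q -> integrable (fun t => h t ^+ 2) -> integrable (fun t => n t ^+ 2) ->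
  integrable (fun t => rho t ^+ 2) ->
  {ae leb, forall t, t \in `]0, b[ -> q t <= - alpha * h t ^+ 2 + n t * h t + rho t * h t} ->
  (\int[leb]_t (n t ^+ 2))%R <= k ^+ 2 * (\int[leb]_t (\1_(`]0, b[%classic) t * h t ^+ 2))%R ->
  E <= 2 * (\int[leb]_t (\1_(`]0, b[%classic) t * q t))%R ->
  E + (alpha - k) * (\int[leb]_t (\1_(`]0, b[%classic) t * h t ^+ 2))%R <=
  (alpha - k)^-1 * (\int[leb]_t (rho t ^+ 2))%R.
Proof.
move=> k0 d0 h0 qi hi ni ri qle nle Ele.
set d := alpha - k.
set S := (\int[leb]_t (\1_(`]0, b[%classic) t * h t ^+ 2))%R in nle *.
have mI : measurable (`]0, b[%classic : set mR) by exact: measurable_itv.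
have hbi := indic_mul_integrable mI hi.
have S0 : 0 <= S by apply: Rintegral_ge0 => t _; rewrite mulr_ge0// sqr_ge0.
suff H eta : 0 < eta -> E + d * S <= d^-1 * (\int[leb]_t (rho t ^+ 2))%R + eta * S.
  apply/ler_addgt0Pr => e e0.
  have e1 : 0 < e / (S + 1) by rewrite divr_gt0// ltr_wpDl.
  apply: (le_trans (H _ e1)); rewrite lerD2l mulrAC ler_pdivrMr ?ltr_wpDl//.
  by apply: ler_wpM2l; [exact: ltW|rewrite lerDl].
move=> e0; apply: (master_arith k0 e0 (erefl d) d0 S0 nle Ele).
have ke : 0 < k + eta by rewrite ltr_wpDl.
have i1 := integrableZlR measurableT (- alpha + (k + eta) / 2 + d / 2) hbi.
have i2 := integrableZlR measurableT ((2 * (k + eta))^-1) ni.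
have i3 := integrableZlR measurableT ((2 * d)^-1) ri.
rewrite -!RintegralZl//.
rewrite -RintegralD// -RintegralD//; last exact: integrableDR.
apply: ae_le_Rintegral_signed.
- exact: indic_mul_integrable.
- by apply: integrableDR => //; exact: integrableDR.
apply: aeS qle => t qt; rewrite indicE; case: (boolP (t \in _)) => tI /=; last first.
  rewrite !mul0r mulr0 add0r; have pos (c x : R) : 0 < c -> 0 <= (2 * c)^-1 * x ^+ 2.
    by move=> c0; rewrite mulr_ge0 ?sqr_ge0// invr_ge0 mulr_ge0// (ltW c0).
  by apply: addr_ge0; exact: pos.
have tI' : t \in `]0, b[ by exact: set_mem tI.
rewrite !mul1r; apply: (le_trans (qt tI')).
have y1 := young_split (n t) (h t) ke.
have y2 := young_split (rho t) (h t) d0.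
move: y1 y2; rewrite -/d; set x1 := n t * h t; set x2 := rho t * h t.
set x3 := (2 * (k + eta))^-1 * _; set x4 := (2 * d)^-1 * _.
move: (h t ^+ 2) => z; clearbody x1 x2 x3 x4 d; clear -x1; by move=> *; lra.
Qed.

End master_inequality.

Section bochner_locality.
Context d (T : measurableType d) (R : realType) (X : normedModType R).

(** Approximation is required at every point of [D], so integrands are exchanged under equality on
    all of [D]. *)
Lemma eq_bochner (m : {measure set T -> \bar R}) (D : set T) (f g : T -> X) :
  (forall t, D t -> f t = g t) -> bochner m D f = bochner m D g.
Proof.
move=> fg; congr xget; apply/funext => I; apply/propext.
suff H (f' g' : T -> X) : (forall t, D t -> f' t = g' t) ->
    is_bochner_integral m D f' I -> is_bochner_integral m D g' I.
  by split; apply: H => // t Dt; rewrite fg.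
move=> fg' [s [s1 s2 s3 s4]]; exists s; split => //.
  by move=> t Dt; rewrite -fg'//; exact: s2.
apply: cvg_trans s3; apply: near_eq_cvg; near=> n.
by apply: eq_integral => t /set_mem Dt; rewrite fg'.
Unshelve. all: by end_near. Qed.

End bochner_locality.

(** * Trajectories joined with their history, on the whole line *)

Section history.
Context {R : realType} {V : hilbertType R}.
Local Notation leb := (@lebesgue_measure R).
Local Notation mR := (measurableTypeR R).
Local Notation integrable f := (leb.-integrable setT (EFin \o f)).
Local Notation sm f := (strongly_measurable (setT : set (measurableTypeR R)) f).
Variables (tau T : R) (A1 : V -> dual V).
Hypothesis (tau_gt0 : 0 < tau) (T_gt0 : 0 < T).
Local Notation I := (`]0%R, T[%classic : set mR).
Local Notation J := (`](- tau)%R, 0%R[%classic : set mR).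
Implicit Types (g psi u : R -> V) (sigma : {charge set mR -> \bar R}).

Lemma eq_delay sigma g g' t : (forall s, 0 <= s <= tau -> g (t - s) = g' (t - s)) ->
  delay_op tau A1 sigma g t = delay_op tau A1 sigma g' t.
Proof.
move=> gg; rewrite /delay_op /charge_bochner.
have E (m : {measure set mR -> \bar R}) :
    bochner m `[0, tau] (fun s => A1 (g (t - s))) = bochner m `[0, tau] (fun s => A1 (g' (t - s))).
  by apply: eq_bochner => s; rewrite /= in_itv /= => /gg ->.
by rewrite !E.
Qed.

(* the value at the single time 0 matters, since the kernel may have atoms *)
Definition history psi u : R -> V :=
  fun t => ext0 J psi t + ext0 (`[0%R, 0%R]%classic) (cst (u 0)) t + ext0 I u t.

Lemma history_joined psi u t : - tau < t < T -> history psi u t = joined psi u t.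
Proof.
move=> /andP[t1 t2]; rewrite /history /joined /ext0 !mem_setE !in_itv /= t1 t2 -eq_le andbT eq_sym.
by case: (ltgtP t 0) => /= t0; rewrite ?addr0 ?add0r // t0.
Qed.

Lemma history_out psi u t : t \notin `](- tau), T[ -> history psi u t = 0.
Proof.
rewrite in_itv /= /history /ext0 !mem_setE !in_itv /= -eq_le => h.
have [t0|t0] := eqVneq t 0; first by move: h; rewrite t0 oppr_lt0 tau_gt0 T_gt0.
rewrite addr0; move: h; case: (ltP (- tau) t) => /= t1.
  rewrite -leNgt => t2; rewrite [t < T]ltNge t2 andbF addr0.
  by rewrite ltNge (le_trans (ltW T_gt0) t2).
have t2 : t <= 0 by rewrite (le_trans t1)// oppr_le0 ltW.
by rewrite [0 < t]ltNge t2 add0r.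
Qed.

Lemma sq_integrableD (f g : R -> V) : sm f -> sm g -> integrable (fun t => `|f t| ^+ 2) ->
  integrable (fun t => `|g t| ^+ 2) -> integrable (fun t => `|f t + g t| ^+ 2).
Proof.
move=> sf sg fi gi.
have sN : sm (fun t => - g t) by apply: (sm_comp (g := -%R)) => //; exact: opp_continuous.
have -> : (fun t => `|f t + g t| ^+ 2) = (fun t => `|f t - (- g t)| ^+ 2).
  by apply/funext => t; rewrite opprK.
by apply: sq_integrableB => //; under eq_fun do rewrite normrN.
Qed.

Lemma history_L2 psi u : in_L2 J psi -> in_L2 I u ->
  [/\ sm (history psi u), integrable (fun t => `|history psi u t| ^+ 2) &
      integrable (fun t => `|history psi u t|)].
Proof.
move=> pL2 uL2.
have mJ : measurable J by exact: measurable_itv.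
have mI : measurable I by exact: measurable_itv.
have m0 : measurable (`[0%R, 0%R]%classic : set mR) by exact: measurable_itv.
have [sp ip] := in_L2_ext0 mJ pL2.
have [su iu _] := in_L2_itv uL2.
have s0 : sm (ext0 (`[0%R, 0%R]%classic) (cst (u 0))) by apply: sm_ext0 => //; exact: sm_cst.
have i0 : integrable (fun t => `|ext0 (`[0%R, 0%R]%classic) (cst (u 0)) t| ^+ 2).
  apply: ext0_sq_integrable => //; first exact: sm_cst.
  have -> : (\int[leb]_(t in `[0%R, 0%R]) (`|cst (u 0) t| ^+ 2)%:E = (`|u 0| ^+ 2)%:E * leb `[0%R, 0%R])%E.
    exact: (@integral_cst _ mR R leb _ m0 (`|u 0| ^+ 2)%:E).
  by rewrite set_itv1 lebesgue_measure_set1 mule0.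
have s1 := sm_add sp s0; have s2 := sm_add s1 su.
have i2 : integrable (fun t => `|history psi u t| ^+ 2).
  by apply: sq_integrableD => //; exact: sq_integrableD.
split=> //; apply: (norm_integrable_of_sq s2 i2); exact: history_out.
Qed.

Lemma delay_history sigma psi u t : 0 < t < T ->
  delay_op tau A1 sigma (joined psi u) t = delay_op tau A1 sigma (history psi u) t.
Proof.
move=> /andP[t0 tT]; apply: eq_delay => s /andP[s0 st]; rewrite history_joined//.
by apply/andP; split; lra.
Qed.

(** The common past cancels. At t = 0 the histories carry the values of the trajectories, whereas
    the extension by zero vanishes. *)
Lemma historyB psi u u' t : t != 0 ->
  history psi u t - history psi u' t = ext0 I (u \- u') t.
Proof.
move=> t0; rewrite /history [ext0 _ (cst (u 0)) t]ext0_out ?[ext0 _ (cst (u' 0)) t]ext0_out; last 2 first.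
- by rewrite set_itv1 => /eqP; apply/negP.
- by rewrite set_itv1 => /eqP; apply/negP.
rewrite !addr0 opprD addrACA subrr add0r /ext0; case: ifP => _ //; exact: subrr.
Qed.

End history.

(** * Weighted norms as real numbers *)

Section weighted_norms.
Context {R : realType}.
Local Notation leb := (@lebesgue_measure R).
Local Notation mR := (measurableTypeR R).
Local Notation integrable f := (leb.-integrable setT (EFin \o f)).
Local Notation sm f := (strongly_measurable (setT : set (measurableTypeR R)) f).

Lemma sqrt_le_scale (a x y : R) : 0 <= a -> x <= a ^+ 2 * y -> Num.sqrt x <= a * Num.sqrt y.
Proof.
move=> a0 h; apply: (le_trans (ler_wsqrtr h)).
by rewrite sqrtrM ?sqr_ge0// sqrtr_sqr (ger0_norm a0).
Qed.

Lemma poweR_half_EFin (x : R) : 0 <= x -> (x%:E `^ 2^-1 = (Num.sqrt x)%:E)%E.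
Proof. by move=> x0; rewrite poweR_EFin powR12_sqrt. Qed.

Lemma measurable_exp_weight (beta : R) :
  measurable_fun (setT : set mR) (fun t : mR => expR (- (beta * t))).
Proof.
apply: measurableT_comp; first exact: measurable_expR.
apply: measurableT_comp; first exact: oppr_measurable.
by apply: measurable_funM; [exact: measurable_cst|exact: measurable_id].
Qed.

Context {X : normedModType R}.
Implicit Types g : R -> X.

Lemma L2norm_wE beta (D : set R) g :
  integrable (fun t => (expR (- (beta * t)) * `|ext0 D g t|) ^+ 2) ->
  L2norm_w beta D g = (Num.sqrt (\int[leb]_t (expR (- (beta * t)) * `|ext0 D g t|) ^+ 2)%R)%:E.
Proof.
move=> ig; rewrite /L2norm_w.
rewrite (@ge0_integral_ext0 R X D g (fun t x => (expR (- (2 * beta * t)) * `|x| ^+ 2)%:E)); last first.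
  by move=> t; rewrite normr0 expr0n mulr0.
under eq_integral do rewrite -exp_weight_sq.
rewrite -EFin_Rintegral// poweR_half_EFin//.
by apply: Rintegral_ge0 => t _; exact: sqr_ge0.
Qed.

Lemma L2normE (D : set R) g : integrable (fun t => `|ext0 D g t| ^+ 2) ->
  L2norm D g = (Num.sqrt (\int[leb]_t `|ext0 D g t| ^+ 2)%R)%:E.
Proof.
move=> ig; rewrite /L2norm.
rewrite (@ge0_integral_ext0 R X D g (fun t x => (`|x| ^+ 2)%:E)); last first.
  by move=> t; rewrite normr0 expr0n.
rewrite -EFin_Rintegral// poweR_half_EFin//.
by apply: Rintegral_ge0 => t _; exact: sqr_ge0.
Qed.

Lemma measurable_weighted beta g : sm g ->
  measurable_fun (setT : set mR) (fun t => (expR (- (beta * t)) * `|g t|) ^+ 2).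
Proof.
move=> sg; apply: measurable_funX; apply: measurable_funM; first exact: measurable_exp_weight.
exact: sm_norm.
Qed.

(** The weight grows at minus infinity, but on the support it is at most e^{beta c}. *)
Lemma exp_weight_integrable beta (c : R) g : 0 <= beta -> sm g ->
  integrable (fun t => `|g t| ^+ 2) -> (forall t, t <= - c -> g t = 0) ->
  integrable (fun t => (expR (- (beta * t)) * `|g t|) ^+ 2).
Proof.
move=> b0 sg ig g0.
apply: (@integrable_dom _ mR R leb setT measurableT _ (fun t => expR (beta * c) ^+ 2 * `|g t| ^+ 2)).
- exact: measurable_weighted.
- move=> t _; rewrite ger0_norm ?sqr_ge0// exprMn.
  have [tc|tc] := leP t (- c); first by rewrite (g0 t tc) normr0 expr0n !mulr0.
  apply: ler_wpM2r; first exact: sqr_ge0.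
  rewrite ler_sqr ?nnegrE ?expR_ge0// ler_expR -mulrN; apply: ler_wpM2l => //.
  by rewrite lerNl ltW.
- exact: integrableZlR.
Qed.

Lemma unweighted_le beta (b : R) (g : R -> X) : 0 <= beta -> 0 <= b ->
  (forall t, t \notin `]0, b[ -> g t = 0) ->
  integrable (fun t => `|g t| ^+ 2) ->
  integrable (fun t => (expR (- (beta * t)) * `|g t|) ^+ 2) ->
  (\int[leb]_t `|g t| ^+ 2)%R <=
  expR (beta * b) ^+ 2 * (\int[leb]_t (expR (- (beta * t)) * `|g t|) ^+ 2)%R.
Proof.
move=> b0 c0 g0 i1 i2; rewrite -RintegralZl//; apply: le_Rintegral => //.
  exact: integrableZlR.
move=> t _; rewrite -exprMn mulrA -expRD.
have [tI|tI] := boolP (t \in `]0, b[); last by rewrite g0// normr0 mulr0 expr0n.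
move: tI; rewrite in_itv /= => /andP[t0 tb].
rewrite ler_sqr ?nnegrE ?mulr_ge0 ?expR_ge0//; apply: ler_peMl => //.
by rewrite -expR0 ler_expR -mulrBr mulr_ge0// subr_ge0 ltW.
Qed.

(** The weighted norm is continuous on [0, T], and the times at which the bound is known are dense
    there. *)
Lemma dense_weighted_bound beta (c : R -> X) (T M : R) : 0 < T ->
  {within `[0, T], continuous c} ->
  {ae leb, forall t, t \in `]0, T[ -> expR (- (beta * t)) * `|c t| <= M} ->
  forall t, 0 <= t <= T -> expR (- (beta * t)) * `|c t| <= M.
Proof.
move=> T0 /subspace_continuousP cc aec t tT.
have It : `[0, T]%classic t by rewrite /= in_itv.
apply/ler_addgt0Pl => e e0.
have ec : continuous (fun t : R => expR (- (beta * t))).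
  move=> x; apply: (@continuous_comp _ _ _ (fun t : R => - (beta * t)) expR); last exact: continuous_expR.
  by apply: cvgN; apply: cvgM; [exact: cvg_cst|exact: cvg_id].
have Fc : expR (- (beta * a)) * `|c a| @[a --> within `[0, T] (nbhs t)] --> expR (- (beta * t)) * `|c t|.
  have ect : expR (- (beta * a)) @[a --> within `[0, T] (nbhs t)] --> expR (- (beta * t)).
    by apply: cvg_within_filter; exact: ec.
  apply: cvgM; first exact: ect.
  exact: cvg_norm (cc t It).
have /cvgrPdist_le/(_ _ e0)/nbhs_ballP[r /= r0 h] := Fc.
have [a [aT ac]] := ae_dense T0 aec tT r0.
move=> ar; have Ia : `[0, T]%classic a by move: aT => /andP[a0 aT]; rewrite /= in_itv/= !ltW.
have k : `|expR (- (beta * t)) * `|c t| - expR (- (beta * a)) * `|c a| | <= e.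
  by apply: h => //; rewrite -ball_normE/= distrC.
have := le_trans (ler_norm _) k; rewrite lerBlDr => /le_trans; apply.
by rewrite lerD2l.
Qed.

End weighted_norms.

Lemma pairing_arith {R : realType} (e alpha z a b c K r : R) : 0 <= e -> alpha * z ^+ 2 <= a ->
  - b <= K * z -> - c <= r * z ->
  e ^+ 2 * (- a - b - c) <= - alpha * (e * z) ^+ 2 + (e * K) * (e * z) + (e * r) * (e * z).
Proof.
move=> e0 h1 h2 h3.
rewrite [leRHS](_ : _ = e ^+ 2 * (- alpha * z ^+ 2 + K * z + r * z)); last by ring.
by apply: ler_wpM2l; [exact: sqr_ge0|lra].
Qed.

(** Cauchy-Schwarz with weights; equality holds when x : y = l : m, so weights proportional to the
    known bounds lose nothing in the constant. *)
Lemma cauchy2 {R : realFieldType} (x y l m : R) : 0 < l -> 0 < m ->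
  (x + y) ^+ 2 <= (l + m) * (l^-1 * x ^+ 2 + m^-1 * y ^+ 2).
Proof.
move=> l0 m0; rewrite -subr_ge0.
have -> : (l + m) * (l^-1 * x ^+ 2 + m^-1 * y ^+ 2) - (x + y) ^+ 2 = (m * x - l * y) ^+ 2 / (l * m).
  by field; rewrite !gt_eqF.
by rewrite divr_ge0 ?sqr_ge0// mulr_ge0 ?ltW.
Qed.

Lemma dt_arith {R : realType} (L l d e x z K r : R) : 0 < L -> 0 < l -> 0 < d -> 0 <= e -> 0 <= x ->
  x <= L * z + K + r ->
  (e * x) ^+ 2 <= (L + l + d) *
    (L^-1 * L ^+ 2 * (e * z) ^+ 2 + l^-1 * (e * K) ^+ 2 + d^-1 * (e * r) ^+ 2).
Proof.
move=> L0 l0 d0 e0 x0 xle.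
have ex : e * x <= L * (e * z) + e * K + e * r.
  by have := ler_wpM2l e0 xle; rewrite !mulrDr mulrCA.
apply: (@le_trans _ _ ((L * (e * z) + e * K + e * r) ^+ 2)).
  by rewrite ler_sqr ?nnegrE// ?mulr_ge0// (le_trans _ ex)// mulr_ge0.
apply: (le_trans (cauchy2 _ _ (addr_gt0 L0 l0) d0)); apply: ler_wpM2l.
  by rewrite !addr_ge0// ltW.
rewrite lerD2r -mulrA -exprMn ler_pdivrMl ?addr_gt0//.
exact: cauchy2.
Qed.

(** Plays the part of the triangle inequality in L^2. The three norms are at most L, k and d times
    sqrt(P) / d, so the weights L, k + eta and d give the sum of the bounds up to eta, and d + k =
    alpha. *)
Lemma dt_bound_arith {R : realType} (alpha L k eta d S P N : R) : 0 <= k -> 0 < eta -> 0 < L ->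
  d = alpha - k -> 0 < d -> 0 <= S -> S <= d^-1 ^+ 2 * P -> N <= k ^+ 2 * S ->
  (L + (k + eta) + d) * (L^-1 * L ^+ 2 * S + (k + eta)^-1 * N + d^-1 * P) <=
  ((alpha + L + eta) / d) ^+ 2 * P.
Proof.
move=> k0 e0 L0 dE d0 S0 SP NS.
have ke : 0 < k + eta by lra.
have -> : alpha = d + k by rewrite dE subrK.
have -> : ((d + k + L + eta) / d) ^+ 2 * P = (L + (k + eta) + d) * ((L + (k + eta) + d) * (d^-1 ^+ 2 * P)).
  by rewrite exprMn; ring.
apply: ler_wpM2l; first lra.
have -> : L^-1 * L ^+ 2 * S = L * S by field; rewrite gt_eqF.
have h1 : (k + eta)^-1 * N <= (k + eta) * S.
  rewrite ler_pdivrMl// (le_trans NS)// mulrA; apply: ler_wpM2r => //.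
  by nra.
have h2 : d^-1 * P = d * (d^-1 ^+ 2 * P) by field; rewrite gt_eqF.
rewrite h2 !mulrDl; apply: lerD => //; apply: lerD; first by apply: ler_wpM2l => //; exact: ltW.
rewrite -mulrDl; apply: (le_trans h1); apply: ler_wpM2l => //; exact: ltW.
Qed.

(** * Estimates for the difference of two solutions *)

Section stability.
Context {R : realType} {V H : hilbertType R} (G : gelfandTriple V H).
Local Notation leb := (@lebesgue_measure R).
Local Notation mR := (measurableTypeR R).
Local Notation integrable f := (leb.-integrable setT (EFin \o f)).
Local Notation sm f := (strongly_measurable (setT : set (measurableTypeR R)) f).
Variables (T tau L0 L1 alpha beta : R) (A0 A1 : V -> dual V).
Variables (mu nu : {charge set mR -> \bar R}).
Variables (u0 : H) (f : R -> dual V) (psi umu unu : R -> V).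
Local Notation I := (`]0%R, T[%classic : set mR).
Hypothesis sepV : separable V.
Hypotheses (T_gt0 : 0 < T) (tau_gt0 : 0 < tau) (beta_ge0 : 0 <= beta).
Hypotheses (L0_gt0 : 0 < L0) (L1_ge0 : 0 <= L1).
Hypothesis A0B : forall u v, A0 (u - v) = A0 u - A0 v.
Hypothesis A1B : forall u v, A1 (u - v) = A1 u - A1 v.
Hypothesis A0_le : forall u, `|A0 u| <= L0 * `|u|.
Hypothesis A1_le : forall u, `|A1 u| <= L1 * `|u|.
Hypothesis A0_coercive : forall v, alpha * `|v| ^+ 2 <= A0 v v.
Hypothesis psiL2 : in_L2 (`](- tau)%R, 0%R[%classic : set mR) psi.
Hypothesis umu_sol : weak_solution G T tau A0 A1 mu u0 f psi umu.
Hypothesis unu_sol : weak_solution G T tau A0 A1 nu u0 f psi unu.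

Let z : R -> V := umu \- unu.
Let w : R -> dual V := dt G T umu \- dt G T unu.
Let hm := history tau T psi umu.
Let hn := history tau T psi unu.
(** It vanishes at negative times, the history being shared. At t = 0 it may differ from the zero
    extension of [z], with which it is compared only almost everywhere. *)
Let zt : R -> V := fun t => hm t - hn t.
Let Kz := delay_op tau A1 mu zt.
Let rn := delay_op tau A1 (cadd mu (copp nu)) hn.
Let k := L1 * kappa tau mu beta.
Let d := alpha - k.
Hypothesis d_gt0 : 0 < d.
Let h t := expR (- (beta * t)) * `|ext0 I z t|.
Let rho t := expR (- (beta * t)) * `|ext0 I rn t|.
Let P := (\int[leb]_t (rho t ^+ 2))%R.

Let mI : measurable I. Proof. exact: measurable_itv. Qed.
Let Wm : in_W G T umu. Proof. by case: umu_sol. Qed.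
Let Wn : in_W G T unu. Proof. by case: unu_sol. Qed.
Let zL2 : in_L2 I z. Proof. by apply: in_L2B; [case: Wm|case: Wn]. Qed.
Let wL2 : in_L2 I w.
Proof. by apply: in_L2B; [case: (dtP Wm)|case: (dtP Wn)]. Qed.
Let dtw : is_dt G T z w.
Proof. by apply: is_dtB; [case: Wm|case: Wn|exact: dtP|exact: dtP]. Qed.

Let hmP : [/\ sm hm, integrable (fun t => `|hm t| ^+ 2) & integrable (fun t => `|hm t|)].
Proof. by apply: history_L2 => //; case: Wm. Qed.
Let hnP : [/\ sm hn, integrable (fun t => `|hn t| ^+ 2) & integrable (fun t => `|hn t|)].
Proof. by apply: history_L2 => //; case: Wn. Qed.

Let k_ge0 : 0 <= k.
Proof. by apply: mulr_ge0 => //; apply: Rintegral_ge0 => s _; exact: expR_ge0. Qed.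

(** The two delay terms differ by K_mu (hm - hn) + K_{mu - nu} hn: linearity in the trajectory for
    the kernel mu, linearity in the kernel for the trajectory [hn]. *)
Lemma difference_equation : {ae leb, forall t, t \in `]0, T[ ->
  w t = - A0 (z t) - Kz t - rn t}.
Proof.
have [_ _ em] := umu_sol; have [_ _ en] := unu_sol.
have [sm1 _ im] := hmP; have [sn _ inn] := hnP.
have d1 := delayB tau L1_ge0 A1B A1_le mu sm1 sn im inn.
have d2 := delay_kernelB tau L1_ge0 A1B A1_le mu nu sn inn.
apply: aeS (aeI (aeI em en) (aeI d1 d2)) => t [[e1 e2] [e3 e4]] tI.
have tI' : 0 < t < T by move: tI; rewrite in_itv.
have {}e1 := e1 tI; have {}e2 := e2 tI.
rewrite (delay_history tau A1 mu psi umu tI') in e1.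
rewrite (delay_history tau A1 nu psi unu tI') in e2.
rewrite /Kz /rn e3 e4 /w /z /= A0B.
have -> : dt G T umu t = f t - delay_op tau A1 mu hm t - A0 (umu t).
  by rewrite -e1 /hm addrK addrK.
have -> : dt G T unu t = f t - delay_op tau A1 nu hn t - A0 (unu t).
  by rewrite -e2 /hn addrK addrK.
move: (f t) (delay_op tau A1 mu hm t) (delay_op tau A1 nu hn t) (delay_op tau A1 mu hn t) (A0 (umu t)) (A0 (unu t)).
move=> F a b c x y; apply: dual_ext => v.
have E1 : (F - a - x - (F - b - y)) v = F v - a v - x v - (F v - b v - y v) by [].
have E2 : (- (x - y) - (a - c) - (c - b)) v = - (x v - y v) - (a v - c v) - (c v - b v) by [].
by apply: etrans E1 (etrans _ (esym E2)); ring.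
Qed.

Lemma weighted_ext0_integrable (X : normedModType R) (g : R -> X) : sm g ->
  integrable (fun t => (expR (- (beta * t)) * `|g t|) ^+ 2) ->
  integrable (fun t => (expR (- (beta * t)) * `|ext0 I g t|) ^+ 2).
Proof.
move=> sg ig.
apply: (@integrable_dom _ mR R leb setT measurableT _ (fun t => (expR (- (beta * t)) * `|g t|) ^+ 2)) => //.
- by apply: measurable_weighted; apply: sm_ext0 => //; apply: sm_sub sg.
- move=> t _; rewrite ger0_norm ?sqr_ge0// /ext0; case: ifP => // _.
  by rewrite normr0 mulr0 expr0n sqr_ge0.
Qed.

Let hist_neg (p u : R -> V) t : t <= - tau -> history tau T p u t = 0.
Proof.
move=> tt; apply: (history_out tau_gt0 T_gt0).
by rewrite in_itv /= negb_and -leNgt tt.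
Qed.

Lemma residual_integrable : sm rn /\ integrable (fun t => rho t ^+ 2).
Proof.
have [sn i2 _] := hnP.
have srn : sm rn by exact: (sm_delay tau L1_ge0 A1B A1_le).
split=> //; apply: weighted_ext0_integrable => //.
exact: (delay_young tau L1_ge0 A1B A1_le _ beta_ge0 sn (exp_weight_integrable beta_ge0 sn i2 (hist_neg _ _))).1.
Qed.

Let ext0_neg (X : normedModType R) (g : R -> X) t : t <= - 0 -> ext0 I g t = 0.
Proof. by rewrite oppr0 => t0; apply: ext0_out; rewrite /= in_itv /= ltNge t0. Qed.

Lemma difference_weighted_integrable : integrable (fun t => h t ^+ 2).
Proof.
have [sz iz _] := in_L2_itv zL2.
by apply: (exp_weight_integrable beta_ge0 sz iz (c := 0)) => t; exact: ext0_neg.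
Qed.

(** The delay term at a time t < b uses only times up to [t], so it does not notice the truncation,
    while the norm of the truncation involves [z] on (0, b) only. *)
Let cut (b : R) : R -> V := fun t => if t < b then zt t else 0.

Let cutE b t : t != 0 -> b <= T -> `|cut b t| = (\1_(`]0, b[%classic) t : R) * `|ext0 I z t|.
Proof.
move=> t0 bT; rewrite /cut /zt historyB// indicE mem_setE in_itv /= -/z.
case: (ltP t b) => tb; last by rewrite andbF normr0 mul0r.
rewrite andbT; case: (ltP 0 t) => tp /=; first by rewrite mul1r.
by rewrite mul0r ext0_neg ?oppr0// normr0.
Qed.

Let neq0_ae : {ae leb, forall t : R, t != 0}.
Proof.
exists [set (0 : R)]; split; [exact: measurable_set1|exact: lebesgue_measure_set1|].
by move=> t /=; apply: contra_notP => /eqP.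
Qed.

Lemma cut_young b : b <= T ->
  integrable (fun t => (expR (- (beta * t)) * `|delay_op tau A1 mu (cut b) t|) ^+ 2) /\
  (\int[leb]_t (expR (- (beta * t)) * `|delay_op tau A1 mu (cut b) t|) ^+ 2)%R <=
  k ^+ 2 * (\int[leb]_t (\1_(`]0, b[%classic) t * h t ^+ 2))%R.
Proof.
move=> bT; have [sm1 i1 _] := hmP; have [sn i2 _] := hnP.
have sc : sm (cut b).
  apply: (sm_eq (f := ext0 (`]-oo, b[%classic) zt)).
    by move=> t _; rewrite /cut /ext0 mem_setE in_itv.
  by apply: sm_ext0; [exact: measurable_itv|apply: (sm_sub (D := setT)) => //; exact: sm_sub_fun].
have mb : measurable (`]0, b[%classic : set mR) by exact: measurable_itv.
have ih := indic_mul_integrable mb difference_weighted_integrable.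
have aeE : {ae leb, forall t, (expR (- (beta * t)) * `|cut b t|) ^+ 2 =
    \1_(`]0, b[%classic) t * h t ^+ 2}.
  apply: aeS neq0_ae => t t0; rewrite (cutE t0 bT) /h mulrCA exprMn; congr (_ * _).
  by rewrite indicE; case: (_ \in _); rewrite ?expr1n ?expr0n.
have ic : integrable (fun t => (expR (- (beta * t)) * `|cut b t|) ^+ 2).
  apply: (exp_weight_integrable beta_ge0 sc (c := tau)).
    apply: (@integrable_dom _ mR R leb setT measurableT _ (fun t => `|hm t - hn t| ^+ 2)).
    - exact: sm_sq_norm.
    - move=> t _; rewrite ger0_norm ?sqr_ge0// /cut; case: ifP => // _.
      by rewrite normr0 expr0n sqr_ge0.
    - exact: sq_integrableB.
  by move=> t tt; rewrite /cut /zt /hm /hn !hist_neg// subrr if_same.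
have [j1 j2] := delay_young tau L1_ge0 A1B A1_le mu beta_ge0 sc ic.
split=> //; apply: (le_trans j2).
by rewrite (ae_eq_Rintegral ic ih aeE).
Qed.

Let zW : in_W G T z. Proof. exact: in_WB. Qed.

Let crep_z t : 0 <= t <= T -> crep G T z t = crep G T umu t - crep G T unu t.
Proof. exact: (crepB T_gt0 sepV Wm Wn). Qed.

Let crep_z0 : crep G T z 0 = 0.
Proof.
have [_ e1 _] := umu_sol; have [_ e2 _] := unu_sol.
by rewrite crep_z ?lexx ?(ltW T_gt0)// e1 e2 subrr.
Qed.

(** Coercivity handles the [A0] term and the dual norm the other two; the weight e^{-2 beta t} is
    shared equally between the factors of each product. *)
Lemma pairing_bound b t : t \in `]0, b[ -> b <= T ->
  w t = - A0 (z t) - Kz t - rn t ->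
  expR (- (2 * beta * t)) * ext0 I w t (ext0 I z t) <=
  - alpha * h t ^+ 2 +
  (expR (- (beta * t)) * `|delay_op tau A1 mu (cut b) t|) * h t + rho t * h t.
Proof.
rewrite in_itv /= => /andP[t0 tb] bT E.
have It : I t by rewrite /= in_itv /= t0 (lt_le_trans tb).
rewrite /h /rho !(ext0E _ It) E.
have -> : delay_op tau A1 mu (cut b) t = Kz t.
  apply: eq_delay => s /andP[s0 _]; rewrite /cut ifT// (le_lt_trans _ tb)//.
  by rewrite gerBl.
have e2 : expR (- (2 * beta * t)) = expR (- (beta * t)) ^+ 2.
  by have := exp_weight_sq beta t 1; rewrite mulr1 expr1n mulr1.
rewrite e2.
have p1 : (- A0 (z t) - Kz t - rn t) (z t) = - A0 (z t) (z t) - Kz t (z t) - rn t (z t) by [].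
rewrite p1.
have q1 := A0_coercive (z t).
have nle (x y : R) : `|x| <= y -> - x <= y.
  by move=> xy; have := ler_norm (- x); rewrite normrN => /le_trans; apply.
have q2' := nle _ _ (dual_le (Kz t) (z t)).
have q3' := nle _ _ (dual_le (rn t) (z t)).
exact: pairing_arith (expR_ge0 _) q1 q2' q3'.
Qed.

(** The initial value of the difference is 0, and continuity at 0 supplies the smallness that starts
    the weighted energy inequality. The pointwise and the integral quantity are bounded together,
    and each later estimate drops one of them. *)
Lemma master_bound : exists good : R -> Prop,
  {ae leb, forall t, t \in `]0, T[ -> good t} /\
  forall b, 0 < b -> b < T -> good b ->
    (expR (- (beta * b)) * `|crep G T z b|) ^+ 2 +
    d * (\int[leb]_t (\1_(`]0, b[%classic) t * h t ^+ 2))%R <= d^-1 * P.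
Proof.
have [c [good [cc ae_good embc gen]]] := lions T_gt0 sepV zL2 wL2 dtw.2.
have [sz iz _] := in_L2_itv zL2; have [sw iw _] := in_L2_itv wL2.
have cE t : 0 <= t <= T -> crep G T z t = c t.
  apply: (crep_unique T_gt0 sepV zW cc).
  by apply: aeS ae_good => s gs sI; apply: embc => //; exact: gs.
have c0 : c 0 = 0 by rewrite -cE ?crep_z0// lexx ltW.
have ez t : 0 < t -> t < T -> good t -> emb G (ext0 I z t) = c t.
  move=> t0 tT gt; rewrite ext0E; last by rewrite /= in_itv /= t0.
  by apply: embc => //; rewrite in_itv /= t0.
exists good; split=> // b b0 bT gb.
have small (e : R) : 0 < e -> exists2 dlt : R, 0 < dlt &
    forall a, 0 < a -> a < dlt -> a < T -> good a -> `|emb G (ext0 I z a)| ^+ 2 <= e.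
  move=> e0; move: cc => /subspace_continuousP cc.
  have I0 : `[0, T]%classic (0 : R) by rewrite /= in_itv /= lexx ltW.
  have se : 0 < Num.sqrt e by rewrite sqrtr_gt0.
  have /cvgrPdist_le/(_ _ se)/nbhs_ballP[r /= r0 hr] := cc 0 I0.
  exists r => // a a0 ar aT ga; rewrite ez//.
  have : `|c 0 - c a| <= Num.sqrt e.
    apply: hr; last by rewrite /= in_itv /= !ltW.
    by rewrite -ball_normE /= sub0r normrN gtr0_norm.
  rewrite c0 sub0r normrN => hc; rewrite -(sqr_sqrtr (ltW e0)) ler_sqr ?nnegrE// sqrtr_ge0.
have en := weighted_energy_le sz sw iz iw ae_good gen small beta_ge0 b0 bT gb.
have [srn ir] := residual_integrable.
have [in_ nle] := cut_young (ltW bT).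
rewrite cE ?(ltW b0) ?(ltW bT)// exp_weight_sq -(ez b b0 bT gb).
apply: (@master_inequality R beta alpha k b _ (fun t => expR (- (2 * beta * t)) * ext0 I w t (ext0 I z t)) h
  (fun t => expR (- (beta * t)) * `|delay_op tau A1 mu (cut b) t|) rho) => //.
- by move=> t; rewrite mulr_ge0// expR_ge0.
- have pw := pairing_self_integrable sz sw iz iw.
  apply: (@integrable_dom _ mR R leb setT measurableT _ (fun t => `|ext0 I w t (ext0 I z t)|)).
  + apply: measurable_funM; last exact: integrable_measurable pw.
    by have := measurable_exp_weight (2 * beta).
  + move=> t _; rewrite normrM (ger0_norm (expR_ge0 _)).
    have [t0|t0] := leP t 0; first by rewrite [ext0 I w t]ext0_neg ?oppr0// dual0E normr0 mulr0.
    by apply: ler_piMl => //; rewrite -expR0 ler_expR oppr_le0 !mulr_ge0// ltW.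
  + by move/integrable_norm : pw; apply: eq_integrable.
- exact: difference_weighted_integrable.
- apply: aeS difference_equation => t E tb; apply: pairing_bound => //; first exact: ltW.
  by apply: E; move: tb; rewrite !in_itv /= => /andP[-> tb]; exact: lt_trans tb bT.
Qed.

Let P_ge0 : 0 <= P. Proof. by apply: Rintegral_ge0 => t _; exact: sqr_ge0. Qed.

Let h_out t : ~ I t -> h t = 0.
Proof. by move=> It; rewrite /h ext0_out// normr0 mulr0. Qed.

(** The energy bound is available only at good times below [T], so the whole interval is exhausted
    by good times [b n] tending to [T]. *)
Lemma difference_L2_bound : (\int[leb]_t (h t ^+ 2))%R <= d^-1 ^+ 2 * P.
Proof.
have [good [ae_good mb]] := master_bound.
have bex n : exists b : R, [/\ 0 < b, b < T, T - n.+1%:R^-1 < b & good b].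
  have lt : Num.max 0 (T - n.+1%:R^-1) < T by rewrite gt_max T_gt0 gtrBl invr_gt0 ltr0Sn.
  have [b [b1 b2 b3]] := ae_itv_exists lt ae_good.
  move: b1; rewrite gt_max => /andP[b0 b1]; exists b; split=> //.
  by apply: b3; rewrite in_itv /= b0.
have [b bP] := choice bex.
have ih := difference_weighted_integrable.
have mb_ n : measurable (`]0, b n[%classic : set mR) by exact: measurable_itv.
have cv : (\int[leb]_t (\1_(`]0, b n[%classic) t * h t ^+ 2))%R @[n --> \oo] --> (\int[leb]_t (h t ^+ 2))%R.
  apply: (@Rintegral_cvg_dom _ mR R leb setT measurableT _ _ (fun t => h t ^+ 2)) => //.
  - by move=> n; apply: integrable_measurable; exact: indic_mul_integrable.
  - move=> t _; have [It|It] := pselect (I t); last first.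
      by rewrite (h_out It) expr0n; under eq_fun do rewrite mulr0; exact: cvg_cst.
    move: (It); rewrite /= in_itv /= => /andP[t0 tT].
    have Tt : 0 < T - t by rewrite subr_gt0.
    apply: cvg_near_cst; have := near_infty_natSinv_lt (PosNum Tt); apply: filterS => n /= hn1.
    have [_ _ tb _] := bP n.
    rewrite indicE mem_set ?mul1r//= in_itv /= t0 /=; apply: lt_trans tb.
    by rewrite ltrBrDr -ltrBrDl.
  - move=> n t _; rewrite indicE; case: (_ \in _); rewrite ?mul1r ?mul0r ?normr0 ?sqr_ge0//.
    by rewrite ger0_norm ?sqr_ge0.
apply/ler_addgt0Pr => e e0; move/cvgrPdist_le : cv => /(_ e e0)[N _ /(_ N (leqnn N))] /=.
move=> /(le_trans (ler_norm _)); rewrite lerBlDl => /le_trans; apply; rewrite lerD2r.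
have [b0 bT _ gb] := bP N.
have := mb (b N) b0 bT gb; set S := (X in d * X) => hS.
have hd : d * S <= d^-1 * P by apply: le_trans hS; rewrite lerDr sqr_ge0.
by rewrite -(ler_pM2l d_gt0) (le_trans hd)// mulrA expr2 mulrA divff ?mul1r// gt_eqF.
Qed.

(** The energy bound gives d^{-1} P at good times, which is at most alpha d^{-2} P because d <=
    alpha; continuity carries it to all of [0, T]. *)
Lemma difference_sup_bound t : 0 <= t <= T ->
  expR (- (beta * t)) * `|crep G T z t| <= Num.sqrt alpha / d * Num.sqrt P.
Proof.
have [good [ae_good mb]] := master_bound.
have al : 0 < alpha by rewrite (lt_le_trans d_gt0)// gerBl.
have [cc _] := crepP T_gt0 sepV zW.
move: t; apply: (dense_weighted_bound T_gt0 cc).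
apply: aeS ae_good => t gt tI; have := tI; rewrite in_itv /= => /andP[t0 tT].
have m := mb t t0 tT (gt tI).
set x := expR _ * _; have x0 : 0 <= x by rewrite mulr_ge0// expR_ge0.
rewrite -(ger0_norm x0) -sqrtr_sqr; apply: sqrt_le_scale.
  by rewrite divr_ge0 ?sqrtr_ge0// ltW.
apply: (@le_trans _ _ (d^-1 * P)).
  apply: le_trans m; rewrite lerDl; apply: mulr_ge0; first exact: ltW.
  by apply: Rintegral_ge0 => s _; rewrite mulr_ge0// sqr_ge0.
apply: ler_wpM2r => //; rewrite exprMn sqr_sqrtr ?(ltW al)// expr2 mulrA.
by rewrite ler_peMl ?invr_ge0 ?(ltW d_gt0)// ler_pdivlMr// mul1r gerBl.
Qed.

Lemma difference_dt_bound :
  integrable (fun t => (expR (- (beta * t)) * `|ext0 I w t|) ^+ 2) /\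
  Num.sqrt (\int[leb]_t (expR (- (beta * t)) * `|ext0 I w t|) ^+ 2)%R <=
  (alpha + L0) / d * Num.sqrt P.
Proof.
have [sw iw _] := in_L2_itv wL2.
have iew : integrable (fun t => (expR (- (beta * t)) * `|ext0 I w t|) ^+ 2).
  by apply: (exp_weight_integrable beta_ge0 sw iw (c := 0)) => t; exact: ext0_neg.
split=> //.
have [_ ir] := residual_integrable.
have ih := difference_weighted_integrable.
(* Cutting at [T] itself leaves the delay term unchanged on all of (0, T). *)
have [in_ nle] := cut_young (lexx T).
set n := (fun t => expR (- (beta * t)) * `|delay_op tau A1 mu (cut T) t|) in in_ nle.
have nle' : (\int[leb]_t (n t ^+ 2))%R <= k ^+ 2 * (\int[leb]_t (h t ^+ 2))%R.
  apply: (le_trans nle); apply: ler_wpM2l; first exact: sqr_ge0.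
  apply: le_Rintegral => //; first exact: indic_mul_integrable.
  move=> t _; rewrite indicE; case: (_ \in _); rewrite ?mul1r ?mul0r//; exact: sqr_ge0.
have al : 0 < alpha by rewrite (lt_le_trans d_gt0)// gerBl.
(* The weight k + eta of the delay term must be positive; eta is removed from the constant
   afterwards. *)
suff HH eta : 0 < eta -> Num.sqrt (\int[leb]_t (expR (- (beta * t)) * `|ext0 I w t|) ^+ 2)%R <=
    (alpha + L0 + eta) / d * Num.sqrt P.
  apply/ler_addgt0Pr => e e0.
  have q0 : 0 <= d^-1 * Num.sqrt P by rewrite mulr_ge0 ?sqrtr_ge0// invr_ge0 ltW.
  have e1 : 0 < e / (d^-1 * Num.sqrt P + 1) by rewrite divr_gt0// ltr_wpDl.
  apply: (le_trans (HH _ e1)); rewrite -!mulrA mulrDl lerD2l mulrAC ler_pdivrMr ?ltr_wpDl//.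
  by apply: ler_wpM2l; [exact: ltW|rewrite lerDl].
move=> e0; apply: sqrt_le_scale.
  by rewrite divr_ge0 ?(ltW d_gt0)// !addr_ge0// ltW.
have ke : 0 < k + eta by rewrite ltr_wpDl.
pose M := L0 + (k + eta) + d.
have M0 : 0 < M by apply: addr_gt0 => //; exact: addr_gt0.
have j1 := integrableZlR measurableT (L0^-1 * L0 ^+ 2) ih.
have j2 := integrableZlR measurableT (k + eta)^-1 in_.
have j3 := integrableZlR measurableT d^-1 ir.
have j12 := integrableDR measurableT j1 j2.
have j123 := integrableDR measurableT j12 j3.
have jM := integrableZlR measurableT M j123.
apply: (@le_trans _ _ (\int[leb]_t (M * (L0^-1 * L0 ^+ 2 * h t ^+ 2 + (k + eta)^-1 * n t ^+ 2 + d^-1 * rho t ^+ 2)))%R).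
  have g0 t : 0 <= M * (L0^-1 * L0 ^+ 2 * h t ^+ 2 + (k + eta)^-1 * n t ^+ 2 + d^-1 * rho t ^+ 2).
    apply: mulr_ge0; first exact: ltW.
    have pos (x y : R) : 0 < x -> 0 <= x^-1 * y ^+ 2 by move=> x0; rewrite mulr_ge0 ?sqr_ge0// invr_ge0 ltW.
    rewrite -mulrA -exprMn; apply: addr_ge0; last exact: pos.
    by apply: addr_ge0; exact: pos.
  apply: ae_le_Rintegral => //.
  apply: aeS difference_equation => t E.
  have [It|It] := pselect (I t); last first.
    by rewrite ext0_out// normr0 mulr0 expr0n.
  have It' := It; rewrite /= in_itv /= in It'; move/andP : It' => [t0 tT].
  have {}E : w t = - A0 (z t) - Kz t - rn t by apply: E; rewrite in_itv /= t0.
  have nE : n t = expR (- (beta * t)) * `|Kz t|.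
    have kE : delay_op tau A1 mu (cut T) t = Kz t.
      by apply: eq_delay => s /andP[s0 _]; rewrite /cut ifT// (le_lt_trans _ tT)// gerBl.
    exact: (congr1 (fun l : dual V => expR (- (beta * t)) * `|l|) kE).
  have wle : `|w t| <= L0 * `|z t| + `|Kz t| + `|rn t|.
    rewrite E; apply: (le_trans (ler_normB _ _)); rewrite lerD2r.
    by apply: (le_trans (ler_normB _ _)); rewrite normrN lerD2r.
  have := dt_arith L0_gt0 ke d_gt0 (expR_ge0 (- (beta * t))) (normr_ge0 _) wle.
  by rewrite nE /h /rho !(ext0E _ It) /M.
rewrite RintegralZl// RintegralD// RintegralD// !RintegralZl//.
apply: (dt_bound_arith (k := k) (eta := eta) (N := (\int[leb]_t (n t ^+ 2))%R) _ e0 _ (erefl d) _ _ difference_L2_bound nle') => //.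
by apply: Rintegral_ge0 => t _; exact: sqr_ge0.
Qed.

End stability.

(** * From integrals on the line to the extended-real norms *)

Theorem theorem5p1 (R : realType) (V H : hilbertType R)
    (sepV : separable V) (sepH : separable H) (G : gelfandTriple V H)
    (T tau : R) (T0 : 0 < T) (tau0 : 0 < tau)
    (a0 a1 : {biscalar V}) (L0 L1 alpha0 : R)
    (L0_gt0 : 0 < L0) (L1_gt0 : 0 < L1) (alpha0_gt0 : 0 < alpha0)
    (a0_bounded : forall w v : V, `|a0 w v| <= L0 * `|w| * `|v|)
    (a1_bounded : forall w v : V, `|a1 w v| <= L1 * `|w| * `|v|)
    (a0_coercive : forall v : V, alpha0 * `|v| ^+ 2 <= a0 v v)
    (A0 A1 : V -> dual V)
    (A0E : forall w v : V, A0 w v = a0 w v) (A1E : forall w v : V, A1 w v = a1 w v)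
    (mu nu : {charge set (measurableTypeR R) -> \bar R})
    (mu_M0 : in_M0 tau mu) (nu_M0 : in_M0 tau nu)
    (u0 : H) (f : R -> dual V) (psi : R -> V)
    (fL2 : in_L2 `]0, T[ f) (psiL2 : in_L2 `]- tau, 0[ psi)
    (umu unu : R -> V)
    (umu_sol : weak_solution G T tau A0 A1 mu u0 f psi umu)
    (unu_sol : weak_solution G T tau A0 A1 nu u0 f psi unu)
    (beta : R) (beta_ge0 : 0 <= beta) :
  let d := alpha0 - L1 * kappa tau mu beta in
  let r := delay_op tau A1 (cadd mu (copp nu)) (joined psi unu) in
  let rnorm := L2norm_w beta `]0, T[ r in
  0 < d ->
  in_L2_w beta `]0, T[ r /\
  [/\ (L2norm_w beta `]0%R, T[ (umu \- unu)%R <= d^-1%:E * rnorm)%E,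
      (Cnorm_w T beta (crep G T umu \- crep G T unu)%R
         <= (Num.sqrt alpha0 / d)%:E * rnorm)%E,
      (L2norm_w beta `]0%R, T[ (dt G T umu \- dt G T unu)%R
         <= ((alpha0 + L0) / d)%:E * rnorm)%E &
      (Wnorm G T (umu \- unu)%R + Cnorm T (crep G T (umu \- unu)%R)
         <= (expR (beta * T) * ((1 + Num.sqrt alpha0 + alpha0 + L0) / d))%:E *
            rnorm)%E].
Proof.
move=> d r rnorm d_gt0.
have A0B : forall u v, A0 (u - v) = A0 u - A0 v.
  by move=> u v; apply: dual_ext => x; rewrite A0E linearBl -!A0E.
have A1B : forall u v, A1 (u - v) = A1 u - A1 v.
  by move=> u v; apply: dual_ext => x; rewrite A1E linearBl -!A1E.
have A0_le u : `|A0 u| <= L0 * `|u|.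
  by apply: dual_norm_leP => [|v]; [rewrite mulr_ge0// ltW|rewrite A0E].
have A1_le u : `|A1 u| <= L1 * `|u|.
  by apply: dual_norm_leP => [|v]; [rewrite mulr_ge0// ltW|rewrite A1E].
have A0c v : alpha0 * `|v| ^+ 2 <= A0 v v by rewrite A0E.
have L1_ge0 := ltW L1_gt0.
pose I := `]0%R, T[%classic : set (measurableTypeR R).
have mI : measurable I by exact: measurable_itv.
pose hn := history tau T psi unu.
pose rn := delay_op tau A1 (cadd mu (copp nu)) hn.
(* For t in (0, T) and s in [0, tau], t - s stays in (-tau, T), where the joined trajectory and the
   history on the line coincide. *)
have rE t : I t -> r t = rn t.
  by rewrite /I /= in_itv /= => tI; exact: delay_history.
have er t : ext0 I r t = ext0 I rn t.
  have [It|It] := pselect (I t).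
    exact: etrans (ext0E r It) (etrans (rE t It) (esym (ext0E rn It))).
  exact: etrans (ext0_out r It) (esym (ext0_out rn It)).
have [srn irn] : strongly_measurable (setT : set (measurableTypeR R)) rn /\
    (@lebesgue_measure R).-integrable setT (EFin \o (fun t => (expR (- (beta * t)) * `|ext0 I rn t|) ^+ 2)).
  exact: (residual_integrable mu T0 tau0 beta_ge0 L1_ge0 A1B A1_le psiL2 unu_sol).
pose P := (\int[@lebesgue_measure R]_t (expR (- (beta * t)) * `|ext0 I rn t|) ^+ 2)%R.
have rnormE : rnorm = (Num.sqrt P)%:E.
  have E : (fun t => (expR (- (beta * t)) * `|ext0 I r t|) ^+ 2) =
      (fun t => (expR (- (beta * t)) * `|ext0 I rn t|) ^+ 2).
    by apply/funext => t; exact: (congr1 (fun l : dual V => (expR (- (beta * t)) * `|l|) ^+ 2) (er t)).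
  have ir : (@lebesgue_measure R).-integrable setT
      (EFin \o (fun t => (expR (- (beta * t)) * `|ext0 I r t|) ^+ 2)).
    exact: (eq_ind_r (fun F => (@lebesgue_measure R).-integrable setT (EFin \o F)) irn E).
  rewrite /rnorm (@L2norm_wE R (dual V) beta I r ir).
  exact: (congr1 (fun F : R -> R => (Num.sqrt (\int[@lebesgue_measure R]_t F t)%R)%:E) E).
pose z : R -> V := umu \- unu.
pose w : R -> dual V := dt G T umu \- dt G T unu.
have Wm : in_W G T umu by case: umu_sol.
have Wn : in_W G T unu by case: unu_sol.
have zW : in_W G T z by exact: in_WB.
have zL2 : in_L2 I z by case: zW.
have [sz iz _] := in_L2_itv zL2.
have ih := difference_weighted_integrable beta_ge0 umu_sol unu_sol.
have b1 := difference_L2_bound sepV T0 tau0 beta_ge0 L1_ge0 A0B A1B A1_le A0c psiL2 umu_sol unu_sol d_gt0.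
have b2 := difference_sup_bound sepV T0 tau0 beta_ge0 L1_ge0 A0B A1B A1_le A0c psiL2 umu_sol unu_sol d_gt0.
have [iw b3] := difference_dt_bound sepV T0 tau0 beta_ge0 L0_gt0 L1_ge0 A0B A1B A0_le A1_le A0c psiL2 umu_sol unu_sol d_gt0.
have d0 : 0 <= d^-1 by rewrite invr_ge0 ltW.
have b1' := sqrt_le_scale d0 b1.
split.
  split; last by rewrite -/rnorm rnormE ltry.
  apply: (sm_eq (f := rn)); first by move=> t /set_mem tI; exact: esym (rE t tI).
  by apply: (sm_sub (D := setT)).
have crepE t : 0 <= t <= T -> crep G T z t = crep G T umu t - crep G T unu t.
  exact: (crepB T0 sepV Wm Wn).
split; rewrite ?rnormE -?EFinM.
- by rewrite L2norm_wE// lee_fin.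
- apply: ge_ereal_sup => _ [t /= tT <-]; rewrite in_itv /= in tT.
  by rewrite lee_fin /= -crepE//; exact: b2.
- by rewrite L2norm_wE// lee_fin.
have wdt : is_dt G T z w.
  by apply: is_dtB; [case: Wm|case: Wn|exact: dtP|exact: dtP].
have [sw iw2 _] := in_L2_itv wdt.1.
have [sdt idt _] := in_L2_itv (dtP zW).1.
have ext_out (X : normedModType R) (g : R -> X) t : t \notin `]0, T[ -> ext0 I g t = 0.
  by move=> tI; apply: ext0_out => h; move: tI; rewrite /I /= in h; rewrite h.
have c1 := unweighted_le beta_ge0 (ltW T0) (@ext_out V z) iz ih.
have c3 := unweighted_le beta_ge0 (ltW T0) (@ext_out (dual V) w) iw2 iw.
(* [dt] of the difference and the difference of the two [dt] are separate choices; uniqueness of the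
   weak derivative makes them equal almost everywhere. *)
have dtE : (\int[@lebesgue_measure R]_t `|ext0 I (dt G T z) t| ^+ 2)%R =
    (\int[@lebesgue_measure R]_t `|ext0 I w t| ^+ 2)%R.
  apply: ae_eq_Rintegral => //; apply: aeS (dt_unique sepV zW wdt) => t E.
  have [It|It] := pselect (I t).
    by rewrite (ext0E (dt G T z) It) (ext0E w It) E.
  by rewrite (ext0_out (dt G T z) It) (ext0_out w It).
have e0 : 0 <= expR (beta * T) by exact: expR_ge0.
have N1 := le_trans (sqrt_le_scale e0 c1) (ler_wpM2l e0 b1').
have N2 := le_trans (sqrt_le_scale e0 c3) (ler_wpM2l e0 b3).
rewrite -dtE in N2.
(* The weight is removed at each time separately, with e^{beta t} <= e^{beta T}. *)
have C1 : (Cnorm T (crep G T z) <= (expR (beta * T) * (Num.sqrt alpha0 / d * Num.sqrt P))%:E)%E.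
  apply: ge_ereal_sup => _ [t /= tT <-]; rewrite in_itv /= in tT.
  have := b2 t tT; rewrite lee_fin => h.
  have et : expR (beta * t) * (expR (- (beta * t)) * `|crep G T z t|) = `|crep G T z t|.
    by rewrite mulrA -expRD subrr expR0 mul1r.
  rewrite -et; apply: (le_trans (ler_wpM2l (expR_ge0 _) h)).
  apply: ler_wpM2r; first by rewrite mulr_ge0 ?divr_ge0 ?sqrtr_ge0 ?(ltW d_gt0).
  by rewrite ler_expR; apply: ler_wpM2l => //; case/andP: tT.
(* Uses sqrt(x^2 + y^2) <= x + y for nonnegative x and y, so that the constants 1 and alpha + L0
   simply add. *)
have W1 : (Wnorm G T z <= (expR (beta * T) * (d^-1 * Num.sqrt P) +
    expR (beta * T) * ((alpha0 + L0) / d * Num.sqrt P))%:E)%E.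
  rewrite /Wnorm !L2normE// -!EFin_expe -EFinD poweR_half_EFin ?addr_ge0 ?sqr_ge0// lee_fin.
  apply: le_trans (lerD N1 N2).
  rewrite -[leRHS]ger0_norm ?addr_ge0 ?sqrtr_ge0// -sqrtr_sqr; apply: ler_wsqrtr.
  by rewrite sqrrD -addrA lerD2l lerDr mulrn_wge0// mulr_ge0 ?sqrtr_ge0.
apply: (le_trans (leeD W1 C1)); rewrite -EFinD lee_fin.
rewrite [leLHS](_ : _ = expR (beta * T) * ((1 + Num.sqrt alpha0 + alpha0 + L0) / d) * Num.sqrt P)//; ring.
Qed.
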